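(* Let $G$ be a homogeneous group with homogeneous dimension $Q$. Let $\Lambda,\Gamma\subseteq G$ be relatively separated sets, and let $P:\ell^2(\Gamma)\to\ell^2(\Gamma)$ and $A:\ell^2(\Gamma)\to\ell^2(\Lambda)$ be bounded linear operators. Suppose that $P$ is idempotent, i.e. $P^2=P$, and that there exist $\Theta_1,\Theta_2\in W^{st}(L^\infty,L^1_{w_\alpha})(G)$ for $\alpha\ge Q+1$ such that $$|A_{\lambda,\gamma}|\le\Theta_1(\lambda^{-1}\gamma),\quad\lambda\in\Lambda,\ \gamma\in\Gamma,\qquad\text{and}\qquad|P_{\gamma,\gamma'}|\le\Theta_2(\gamma^{-1}\gamma'),\quad\gamma,\gamma'\in\Gamma.$$ If there are some $p\in[1,\infty]$ and $C=C(p)>0$ such that $C\|Pc\|_{\ell^p}\le\|APc\|_{\ell^p}$ for all $c\in\ell^p(\Gamma)$, then there exists $C'>0$, independent of $q$, such that for all $q\in[1,\infty]$ and all $c\in\ell^q(\Gamma)$, $$C'\|Pc\|_{\ell^q}\le\|APc\|_{\ell^q}.$$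
   Context: Homogeneous groups. A family of dilations on a finite-dimensional real Lie algebra $\mathfrak{g}$ is a family of Lie algebra automorphisms $D_r^{\mathfrak g}=\exp_{\mathrm{GL}(\mathfrak g)}(A_0\ln r)$, $r>0$, where $A_0$ is a diagonalizable linear operator on $\mathfrak g$ with positive eigenvalues (the weights). A homogeneous group is a connected, simply connected Lie group $G$ whose Lie algebra is equipped with a family of dilations; the lowest weight is assumed, without loss of generality, to be $1$. Its homogeneous dimension is $Q=\operatorname{trace}(A_0)$. Put $D_r=\exp\circ D_r^{\mathfrak g}\circ\exp^{-1}$. A homogeneous norm is a continuous map $|\cdot|_G:G\to[0,\infty)$ with $|x^{-1}|_G=|x|_G$, $|D_r(x)|_G=r|x|_G$, $|xy|_G\le|x|_G+|y|_G$, and $|x|_G=0$ iff $x=e$; one is fixed. Balls: $B_R(x)=\{y\in G:|x^{-1}y|_G<R\}$. A set $\Lambda\subset G$ is relatively separated if $\sup_{x\in G}\#(\Lambda\cap B_1(x))<\infty$. Strong amalgam space. Let $w_\alpha(x)=(1+|x|_G)^\alpha$ and let $\mu_G$ be Haar measure. $W^{st}(L^\infty,L^1_{w_\alpha})(G)$ is the space of functions $F\in L^\infty_{\mathrm{loc}}(G)$ whose two-sided control function $F^\sharp_\sharp(x):=\operatorname{ess\,sup}_{u,v\in B_1(e)}|F(uxv)|$ satisfies $\|F\|:=\int_GF^\sharp_\sharp(x)\,w_\alpha(x)\,d\mu_G(x)<\infty$. $A_{\lambda,\gamma}$ and $P_{\gamma,\gamma'}$ denote the matrix entries with respect to the canonical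 bases, $(Ac)_\lambda=\sum_\gamma A_{\lambda,\gamma}c_\gamma$ and $(Pc)_\gamma=\sum_{\gamma'}P_{\gamma,\gamma'}c_{\gamma'}$; for $c\in\ell^q(\Gamma)$, $Pc$ and $APc$ are understood through this matrix action.
   Formalization: The entrywise bounds are read for representatives of Θ₁, Θ₂ with |Θᵢ(x)| ≤ (Θᵢ)^♯_♯(x) at every x; for arbitrary representatives the claim fails (G=ℝ, Λ=Γ=ℤ, Θ₁=1_ℤ has norm 0 and imposes no decay on A). *)

(* Defs.v *)
From HB Require Import structures.
From mathcomp Require Import all_boot all_order all_algebra.
From mathcomp Require Import all_classical all_reals all_analysis.
From mathcomp Require Import ess_sup_inf complex.

Set Implicit Arguments.
Unset Strict Implicit.
Unset Printing Implicit Defensive.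

Import Order.TTheory GRing.Theory Num.Theory.
Import numFieldNormedType.Exports.

Local Open Scope classical_set_scope.
Local Open Scope ring_scope.

(** * Lie groups with a global exponential chart *)

HB.mixin Record isTopologicalGroup G of PointedTopological G & Group G := {
  mulg_continuous : continuous (fun p : G * G => (p.1 * p.2)%g) ;
  invg_continuous : continuous (fun x : G => (x^-1)%g)
}.

#[short(type="topologicalGroupType")]
HB.structure Definition TopologicalGroup :=
  {G of PointedTopological G & Group G & isTopologicalGroup G}.

Fixpoint is_Ck (R : realType) (V W : normedModType R) (k : nat) (f : V -> W)
    : Prop :=
  continuous f /\
  (if k is k'.+1 then
     forall v : V, (forall x, derivable f x v) /\ is_Ck k' ('D_v f)
   else True).

Definition smooth (R : realType) (V W : normedModType R) (f : V -> W) : Prop :=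
  forall k : nat, is_Ck k f.

(** A Lie group whose exponential map is a global diffeomorphism. Its Lie
    algebra is ['rV[R]_lg_dim], its smooth structure is given by the single
    chart [lg_log]; so it is automatically connected and simply connected.
    Conversely, a connected, simply connected Lie group whose Lie algebra
    carries dilations has a nilpotent Lie algebra, and is therefore of this form.
    [lg_expD] says that [lg_exp] is the exponential map of this group: in the
    chart, the one-parameter subgroup with velocity [X] at the identity is the
    line [t *: X]. In particular inversion is [X |-> - X] in the chart. *)
Record expLieGroup (R : realType) := ExpLieGroup {
  lg_sort :> topologicalGroupType ;
  lg_dim : nat ;
  lg_exp : 'rV[R]_lg_dim -> lg_sort ;
  lg_log : lg_sort -> 'rV[R]_lg_dim ;
  lg_expK : cancel lg_exp lg_log ;
  lg_logK : cancel lg_log lg_exp ;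
  lg_exp_continuous : continuous lg_exp ;
  lg_log_continuous : continuous lg_log ;
  lg_mul_smooth :
    smooth (fun p : 'rV[R]_lg_dim * 'rV[R]_lg_dim =>
              lg_log (lg_exp p.1 * lg_exp p.2)%g) ;
  lg_expD : forall (X : 'rV[R]_lg_dim) (s t : R),
    lg_exp ((s + t) *: X) = (lg_exp (s *: X) * lg_exp (t *: X))%g
}.

Section LieAlgebra.
Variables (R : realType) (G : expLieGroup R).
Local Notation g := 'rV[R]_(lg_dim G).

(** [lie_Ad x] is the differential at the identity of [y |-> x y x^-1], and the
    bracket is the differential of [lie_Ad] at the identity. *)
Definition lie_Ad (x : G) (Y : g) : g :=
  derive1 (fun t : R => lg_log (x * lg_exp (t *: Y) * x^-1)%g) 0.

Definition lie_bracket (X Y : g) : g :=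
  derive1 (fun s : R => lie_Ad (lg_exp (s *: X)) Y) 0.

End LieAlgebra.

(** * Homogeneous groups *)

Definition mx_exp (R : realType) (n : nat) (A : 'M[R]_n) : 'M[R]_n :=
  limn (series (fun k : nat => (k`!%:R : R)^-1 *: A ^+ k)).

(** Matrices act on the Lie algebra on the right, as in the rest of the
    library: [A_0] stands for the operator [X |-> X *m A_0]. *)
Definition dilation_mx (R : realType) (n : nat) (A0 : 'M[R]_n) (r : R) :
  'M[R]_n := mx_exp (ln r *: A0).

Record homogeneousGroup (R : realType) := HomogeneousGroup {
  hg_lie :> expLieGroup R ;
  hg_A0 : 'M[R]_(lg_dim hg_lie) ;
  hg_diagonalizable : diagonalizable hg_A0 ;
  hg_weight_gt0 : forall a : R, eigenvalue hg_A0 a -> 0 < a ;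
  hg_dilation_bracket : forall (r : R) (X Y : 'rV[R]_(lg_dim hg_lie)), 0 < r ->
    lie_bracket X Y *m dilation_mx hg_A0 r =
    lie_bracket (X *m dilation_mx hg_A0 r) (Y *m dilation_mx hg_A0 r) ;
  hg_weight1 : eigenvalue hg_A0 1 ;
  hg_weight_ge1 : forall a : R, eigenvalue hg_A0 a -> 1 <= a
}.

Definition hom_dim (R : realType) (G : homogeneousGroup R) : R :=
  \tr (hg_A0 G).

Definition dilation (R : realType) (G : homogeneousGroup R) (r : R) (x : G) : G :=
  lg_exp (lg_log x *m dilation_mx (hg_A0 G) r).

Record homogeneous_norm (R : realType) (G : homogeneousGroup R) (N : G -> R)
    : Prop := HomogeneousNorm {
  hn_continuous : continuous N ;
  hn_ge0 : forall x, 0 <= N x ;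
  hn_inv : forall x, N (x^-1)%g = N x ;
  hn_dilation : forall (r : R) x, 0 < r -> N (dilation r x) = r * N x ;
  hn_mul : forall x y, N (x * y)%g <= N x + N y ;
  hn_eq0 : forall x, N x = 0 <-> x = 1%g
}.

Section Balls.
Variables (R : realType) (G : homogeneousGroup R) (N : G -> R).

Definition hball (r : R) (x : G) : set G := [set y | N (x^-1 * y)%g < r].

Definition relatively_separated (L : set G) : Prop :=
  exists n : nat, forall x : G, (L `&` hball 1 x #<= `I_n)%card.

End Balls.

(** * Haar measure *)

Definition borel (G : topologicalGroupType) := g_sigma_algebraType (@open G).

(** Left Haar measures; G being second countable and locally compact, Haar
    measures are sigma-finite, and regularity is automatic. *)
Record haar_measure (R : realType) (G : topologicalGroupType)
    (mu : set (borel G) -> \bar R) : Prop := HaarMeasure {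
  haar_compact : forall K : set G, compact K -> (mu K < +oo)%E ;
  haar_open : forall U : set G, open U -> U !=set0 -> (0 < mu U)%E ;
  haar_left_invariant : forall (x : G) (A : set (borel G)), measurable A ->
    mu [set (x * y)%g | y in (A : set G)] = mu A
}.

(** * The strong amalgam space *)

Section Amalgam.
Variables (R : realType) (G : homogeneousGroup R) (N : G -> R).
Variable mu : {sigma_finite_measure set (borel G) -> \bar R}.

Definition weight (a : R) (x : G) : R := (1 + N x) `^ a.

Definition Linfty_loc (F : G -> R) : Prop :=
  measurable_fun [set: borel G] (F : borel G -> R) /\
  forall K : set G, compact K ->
    (ess_sup mu ((fun x : borel G => `|F x|%:E) \_ K) < +oo)%E.

(** The essential supremum over [(u, v)] in [B_1(e) x B_1(e)]: as the function
    is nonnegative, it can be extended by 0 outside of this set. *)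
Definition control (F : G -> R) (x : G) : \bar R :=
  ess_sup (mu \x mu)%E
    ((fun p : borel G * borel G => `|F ((p.1 : G) * x * (p.2 : G))%g|%:E)
       \_ (hball N 1 1%g `*` hball N 1 1%g)).

Definition Wst (a : R) (F : G -> R) : Prop :=
  Linfty_loc F /\
  (\int[mu]_(x in [set: borel G]) (control F x * (weight a x)%:E) < +oo)%E.

(** The elements of the amalgam space are classes modulo null sets, whereas
    bounds of the form [|A_(l, k)| <= F (l^-1 * k)] involve values of [F] on a
    countable, hence null, set; they carry information only for representatives
    [F] whose values are dominated by the control function. This holds at almost
    every point for any [F], so each class has such a representative, and it
    holds everywhere if [F] is continuous. *)
Definition controlled_pointwise (F : G -> R) : Prop :=
  forall x : G, (`|F x|%:E <= control F x)%E.

End Amalgam.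

(** * Sequence spaces, operators and matrices *)

Section Sequences.
Variable R : realType.

Definition cabs (z : R[i]) : R := complex.Re `|z|.

Definition ell_norm (I : choiceType) (p : \bar R) (c : I -> R[i]) : \bar R :=
  match p with
  | r%:E => ((\esum_(i in [set: I]) (cabs (c i) `^ r)%:E) `^ r^-1)%E
  | +oo%E => ereal_sup (0%E |` [set (cabs (c i))%:E | i in [set: I]])
  | -oo%E => 0%E
  end.

Definition ell (I : choiceType) (p : \bar R) (c : I -> R[i]) : Prop :=
  (ell_norm p c < +oo)%E.

(** Unconditional sums of real and complex families, meaningful for absolutely
    summable ones. *)
Definition rsum (I : choiceType) (f : I -> R) : R :=
  fine (esum [set: I] (EFin \o f)^\+ - esum [set: I] (EFin \o f)^\-)%E.

Definition csum (I : choiceType) (f : I -> R[i]) : R[i] :=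
  Complex (rsum (fun i => complex.Re (f i))) (rsum (fun i => complex.Im (f i))).

Definition matrix_act (I J : choiceType) (M : J -> I -> R[i]) (c : I -> R[i])
    : J -> R[i] :=
  fun j => csum (fun i => M j i * c i).

(** A bounded linear operator from ell^2(I) to ell^2(J); the values of [T]
    outside ell^2(I) are irrelevant. *)
Record bounded_operator (I J : choiceType) (T : (I -> R[i]) -> (J -> R[i]))
    : Prop := BoundedOperator {
  bop_linear : forall (a : R[i]) (c d : I -> R[i]), ell 2%:E c -> ell 2%:E d ->
    T (fun i => a * c i + d i) = (fun j => a * T c j + T d j) ;
  bop_bounded : exists M : R, forall c : I -> R[i], ell 2%:E c ->
    (ell_norm 2%:E (T c) <= M%:E * ell_norm 2%:E c)%E
}.

Definition entry (I J : choiceType) (T : (I -> R[i]) -> (J -> R[i]))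
    (j : J) (i : I) : R[i] :=
  T (fun i' => (i' == i)%:R) j.

End Sequences.

(* Main.v *)
Require Import Defs.
From HB Require Import structures.
From mathcomp Require Import all_boot all_order all_algebra.
From mathcomp Require Import all_classical all_reals all_analysis.
From mathcomp Require Import ess_sup_inf complex.
From mathcomp Require Import measurable_realfun ring lra.

Set Implicit Arguments.
Unset Strict Implicit.
Unset Printing Implicit Defensive.

Import Order.TTheory GRing.Theory Num.Theory.
Import numFieldNormedType.Exports.

Local Open Scope classical_set_scope.
Local Open Scope ring_scope.

(** Write [d x y] for [|x^-1 y|], let [k] be the integer with [Q < k <= Q + 1]
    and [omega e x y = (1 + e * d x y) ^- k]. Since
    [|omega e x g - omega e x l| <= e * omega e x g * (1 + d g l) ^ k], the
    commutator of a matrix with the multiplication by [omega e x] has norm O(e)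
    on every l^p, uniformly in [x], as soon as the rows and the columns of the
    matrix weighted by [(1 + d) ^ k] are uniformly summable. For small [e] this
    commutator is absorbed by the stability constant for [p] because [Pc] is
    fixed by [P]. Hence [omega e x * Pc] is bounded by [omega e x * APc] in l^p.
    Evaluation at [x] gives
    [|Pc(x)| <= C * sum_l omega e x l * |APc(l)|], and Schur's test turns this
    into a bound in l^q for all [q] at once.

    The weighted row and column sums are bounded by the amalgam norm. The control
    function at a point is at most its value on a ball of radius 1/2 around a
    nearby point, on the left or on the right; these balls have bounded overlap.
    All of them have the same measure since the modular function, a homomorphism
    that grows at most polynomially along powers, is trivial.

    The polynomial growth follows from the dilations: being compatible with the
    bracket, they are group automorphisms; so in graded coordinates the lowest
    coordinate of a layer is additive, which gives coverings of balls by induction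
    on the layers. *)

(** * Continuously differentiable maps *)

Section C1.
Variable R : realType.

(** For [c] in l^q the sequence [Pc] need not lie in l^p. It is bounded, however, and [omega e x] is
    summable over the points, so the product lies in l^1, hence in l^p: the hypothesis for [p]
    applies to it, and its norm, being finite, can be absorbed. The weight therefore has to be
    summable and yet vary by a relative amount O(e); an inverse power does both, while the price, a
    factor [e ^- k] in the sums, is paid only once [e] is fixed. The product is no longer in the
    range of [P], so one commutator with [P] is spent besides the one with [A]. Idempotence is given
    on l^2 and has to be carried over to the matrix of [P] beforehand. On the side of the group,
    compatibility of the dilations with the bracket is integrated without the
    Baker-Campbell-Hausdorff formula: each identity says that some curve has zero derivative. As
    smoothness is phrased through directional derivatives, total differentiability comes first.
    Unimodularity is forced by the columns: their sums compare right translates of a ball, whereas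
    the measure is left invariant. *)

Lemma derivable_line (V W : normedModType R) (f : V -> W) (y v : V) (s : R) :
  derivable f (y + s *: v) v ->
  is_derive s 1 (fun s => f (y + s *: v)) ('D_v f (y + s *: v)).
Proof.
have E : (fun h : R => h^-1 *: (((fun s => f (y + s *: v)) \o shift s) (h *: 1)
            - f (y + s *: v))) =
         (fun h => h^-1 *: ((f \o shift (y + s *: v)) (h *: v) - f (y + s *: v))).
  apply/funext => h /=; congr (_ *: (f _ - _)).
  by rewrite [_ *: 1]mulr1 scalerDl addrCA.
by move=> d; split; [rewrite /derivable E | rewrite /derive E].
Qed.

Lemma line_MVT (V : normedModType R) (f : V -> R) (y v : V) (t : R) :
  (forall x, derivable f x v) ->
  exists2 c, `|c| <= `|t| & f (y + t *: v) - f y = t * 'D_v f (y + c *: v).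
Proof.
move=> df.
have D s : is_derive s (1:R) (fun s => f (y + s *: v)) ('D_v f (y + s *: v)).
  exact: derivable_line.
have C a b : {within `[a, b], continuous (fun s => f (y + s *: v))}.
  apply: continuous_subspaceT => s.
  by apply/differentiable_continuous/derivable1_diffP; exact: ex_derive.
have [t0|t0] := leP 0 t.
  have [c] := MVT_segment t0 (fun s _ => D s) (C 0 t).
  rewrite in_itv /= => /andP[c0 ct]; rewrite scale0r addr0 subr0 => ->.
  by exists c; [rewrite !ger0_norm | rewrite mulrC].
have [c] := MVT_segment (ltW t0) (fun s _ => D s) (C t 0).
rewrite in_itv /= => /andP[c0 ct]; rewrite scale0r addr0 sub0r mulrN => E.
exists c; first by rewrite !ler0_norm ?lerN2// ltW.
by rewrite mulrC -[RHS]opprK -E opprB.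
Qed.

(** One direction at a time, by the mean value theorem. The base point [y] is allowed to vary near
    [x] because the induction moves it, while the partial derivatives stay at [x]. *)
Lemma C1_estimate (V : normedModType R) (I : eqType) (e : I -> V) (f : V -> R)
    (s : seq I) (x : V) :
  (forall i y, derivable f y (e i)) -> (forall i, continuous ('D_(e i) f)) ->
  forall eps, 0 < eps -> exists2 d, 0 < d &
    forall (t : I -> R) y, (forall i, `|t i| < d) -> `|x - y| < d ->
    `|f (y + \sum_(i <- s) t i *: e i) - f y - \sum_(i <- s) t i * 'D_(e i) f x|
      <= eps * \sum_(i <- s) `|t i|.
Proof.
move=> df cf eps eps0; elim: s => [|i s [d d0 IH]].
  by exists 1 => // t y _ _; rewrite !big_nil addr0 subrr subr0 normr0 mulr0.
have /cvgrPdist_lt/(_ eps eps0)/nbhs_ballP[d1 /= d10 D1] := cf i x.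
pose M := 1 + `|e i|; have M0 : 0 < M by rewrite ltr_pwDl.
(* Dividing by [1 + |e i|] keeps [y + c *: e i] within [Num.min d d1] of [x] as soon as [|c|] and
   [|x - y|] are below [d2]. *)
pose d2 := Num.min d d1 / M.
have d20 : 0 < d2 by rewrite divr_gt0// lt_min d0.
have dM c y : `|c| < d2 -> `|x - y| < d2 -> `|x - (y + c *: e i)| < Num.min d d1.
  move=> hc hy; rewrite opprD addrA (le_lt_trans (ler_normB _ _))//.
  rewrite [ltRHS](_ : _ = d2 + d2 * `|e i|); last first.
    by rewrite -{1}[d2]mulr1 -mulrDr /d2 divfK// gt_eqF.
  by rewrite ltr_leD// normrZ ler_wpM2r// ltW.
exists (Num.min d d2); first by rewrite lt_min d0.
move=> t y ht; rewrite lt_min => /andP[yd yd2].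
have hti := ht i; rewrite lt_min in hti; case/andP: hti => td td2.
rewrite !big_cons addrA.
have /IH : forall j, `|t j| < d by move=> j; have := ht j; rewrite lt_min => /andP[].
move=> /(_ (y + t i *: e i)).
have := dM _ _ td2 yd2; rewrite lt_min => /andP[-> _] /(_ isT) IH1.
have [c ct E] := line_MVT y (t i) (df i).
have : `|x - (y + c *: e i)| < Num.min d d1 by apply: dM => //; exact: le_lt_trans td2.
rewrite lt_min => /andP[_ xd1].
have {}D1 := D1 (y + c *: e i); rewrite -ball_normE in D1; have {}D1 := D1 xd1.
set F := f _ in IH1 *; set S := \sum_(j <- s) _ in IH1 *.
rewrite (_ : F - _ - _ = (F - f (y + t i *: e i) - S) +
   (f (y + t i *: e i) - f y - t i * 'D_(e i) f x)); last by ring.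
rewrite (le_trans (ler_normD _ _))// mulrDr addrC lerD//.
by rewrite E -mulrBr normrM mulrC ler_wpM2r// distrC ltW//; exact: D1.
Qed.

(** The basis [e] and its coordinates [phi] are parameters because the domain of interest is a
    product of two row spaces. *)
Lemma C1_differentiable_real (V : normedModType R) (I : finType) (e : I -> V)
    (phi : I -> {linear V -> R}) (f : V -> R) (x : V) :
  (forall i, continuous (phi i)) -> (forall v, v = \sum_i phi i v *: e i) ->
  (forall i y, derivable f y (e i)) -> (forall i, continuous ('D_(e i) f)) ->
  differentiable f x.
Proof.
move=> cphi phiE df cf.
pose D v := \sum_i phi i v * 'D_(e i) f x.
have Dlin : linear D.
  move=> a u v; rewrite /D scaler_sumr -big_split; apply: eq_bigr => i _ /=.
  by rewrite linearP mulrDl scalerAl.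
pose DL : {linear V -> R} := HB.pack D (GRing.isLinear.Build _ _ _ _ D Dlin).
have cD : continuous DL.
  move=> v; rewrite /= /D; apply: cvg_big => //=; first exact: add_continuous.
  move=> i _; apply: cvgM; [exact: cphi | exact: cvg_cst].
have [k k0 kP] : exists2 k : I -> R, (forall i, 0 < k i) &
    forall i v, `|phi i v| <= k i * `|v|.
  have /choice[k kP] : forall i, exists k, 0 < k /\ forall v, `|phi i v| <= k * `|v|.
    by move=> i; have [k ? ?] := linear_lipschitz (cphi i); exists k.
  by exists k => i; case: (kP i).
have H : f \o shift x = cst (f x) + DL +o_ (0:V) id.
  apply/eqaddoP => _/posnumP[eps].
  (* Each [|phi i h|], and also their sum, is at most [M * |h|]; hence the radius [d / M] and the
     accuracy [eps / M]. *)
  pose M := 1 + \sum_i k i.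
  have M0 : 0 < M by rewrite ltr_pwDl// sumr_ge0// => i _; exact/ltW.
  have kM i : k i <= M.
    rewrite /M (bigD1 i)//= addrCA lerDl addr_ge0// sumr_ge0// => j _; exact/ltW.
  have [d d0 dP] := @C1_estimate V I e f (index_enum I) x df cf (eps%:num / M)
    (divr_gt0 (gt0 eps) M0).
  near=> h.
  have hd : `|h| < d / M.
    near: h; apply: nbhs0_lt; exact: divr_gt0.
  have := dP (fun i => phi i h) x; rewrite -phiE subrr normr0 => /(_ _ d0).
  have phid i : `|phi i h| < d.
    rewrite (le_lt_trans (kP i h))// (le_lt_trans (ler_wpM2r (normr_ge0 _) (kM i)))//.
    by rewrite mulrC -ltr_pdivlMr.
  move=> /(_ phid) le.
  rewrite /= [x in `|x|](_ : _ = f (x + h) - f x - D h); last first.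
    by rewrite addrfctE /= opprD addrA [h + x]addrC.
  apply: (le_trans le); rewrite -mulrA ler_wpM2l// mulrC ler_pdivrMr//.
  rewrite (@le_trans _ _ (\sum_i k i * `|h|))//; first exact: ler_sum.
  by rewrite -mulr_suml mulrC ler_wpM2l// /M lerDr.
have E := diff_unique cD H.
by apply/diff_locallyP; rewrite E.
Unshelve. all: by end_near. Qed.

Lemma C1_differentiable (V : normedModType R) (I : finType) (e : I -> V)
    (phi : I -> {linear V -> R}) (n : nat) (f : V -> 'rV[R]_n) (x : V) :
  (forall i, continuous (phi i)) -> (forall v, v = \sum_i phi i v *: e i) ->
  (forall i y, derivable f y (e i)) -> (forall i, continuous ('D_(e i) f)) ->
  differentiable f x.
Proof.
move=> cphi phiE df cf.
have fE : f = \sum_(j < n) (fun y => f y ord0 j *: 'e_j).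
  by apply/funext => y; rewrite fct_sumE -row_sum_delta.
rewrite fE; apply: differentiable_sum => j; apply: differentiableZl.
apply: (@C1_differentiable_real V I e phi (fun y => f y ord0 j) x cphi phiE) => i.
  by move=> y; have /derivable_mxP := df i y; apply.
have -> : 'D_(e i) (fun y => f y ord0 j) = (fun y => 'D_(e i) f y ord0 j).
  by apply/funext => y; rewrite derive_mx// mxE.
move=> y; have c2 := @coord_continuous R _ _ ord0 j ('D_(e i) f y).
exact: (cvg_comp ('D_(e i) f) _ (cf i y) c2).
Qed.

End C1.

(** * Derivatives of vector-valued curves *)

Section Curves.
Variable R : realType.

Lemma derive_curve_comp (V W : normedModType R) (f : V -> W) (u : R -> V) t du :
  differentiable f (u t) -> is_derive t (1 : R) u du ->
  is_derive t (1 : R) (fun s => f (u s)) ('d f (u t) du).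
Proof.
move=> df hu.
have Du : differentiable u t by apply/derivable1_diffP; exact: ex_derive.
have Dfu : differentiable (f \o u) t by exact: differentiable_comp.
split; first exact: diff_derivable.
rewrite -[X in derive X]/(f \o u) deriveE// diff_comp//=.
by case: hu => _ <-; rewrite [in RHS]deriveE.
Qed.

Lemma derive_curve_pair (V W : normedModType R) (u : R -> V) (v : R -> W) t du dv :
  is_derive t (1 : R) u du -> is_derive t (1 : R) v dv ->
  is_derive t (1 : R) (fun s => (u s, v s)) (du, dv).
Proof.
move=> hu hv.
have Du : differentiable u t by apply/derivable1_diffP; exact: ex_derive.
have Dv : differentiable v t by apply/derivable1_diffP; exact: ex_derive.
have D : differentiable (fun s => (u s, v s)) t by exact: differentiable_pair.
split; first exact: diff_derivable.
rewrite deriveE// diff_pair//=.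
by case: hu hv => _ <- [_ <-]; rewrite !deriveE.
Qed.

(** Moves the base point to 0, where the group law helps: [f (t + h)] factors in the group, and only
    the factors that depend on [h] are differentiated. *)
Lemma derive_curve_shift (V : normedModType R) (f : R -> V) t d :
  is_derive (0 : R) (1 : R) (fun h => f (t + h)) d -> is_derive t (1 : R) f d.
Proof.
have E : (fun h : R => h^-1 *: (((fun h => f (t + h)) \o shift 0) (h *: 1)
            - f (t + 0))) =
         (fun h : R => h^-1 *: ((f \o shift t) (h *: 1) - f t)).
  by apply/funext => h /=; rewrite !addr0 [t + _]addrC.
by move=> [d1 d2]; split; [rewrite /derivable -E | rewrite /derive -E].
Qed.

Lemma derive_curve_scale (V : normedModType R) (X : V) (t : R) :
  is_derive t (1 : R) (fun s => s *: X) X.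
Proof.
have D : differentiable (fun s : R => s *: X) t by exact: differentiableZl.
by split; [exact: diff_derivable | rewrite deriveE// diff_val scale1r].
Qed.

(** The difference quotient at 0 is [r] itself, so continuity of [r] suffices. It serves for an [r]
    built from [dlog], of which only continuity is established. *)
Lemma derive_curve_scale_cont (V : normedModType R) (r : R -> V) :
  {for 0, continuous r} -> is_derive (0 : R) (1 : R) (fun s => s *: r s) (r 0).
Proof.
move=> cr.
have H : (fun h : R => h^-1 *: (((fun s => s *: r s) \o shift 0) (h *: 1)
     - 0 *: r 0)) @ 0^' --> r 0.
  have c : r x @[x --> 0^'] --> r 0 by apply: cvg_trans cr; exact/cvg_app/nbhs_dnbhs.
  apply: cvg_trans c; apply: near_eq_cvg; near=> h.
  rewrite /= addr0 scale0r subr0 [h *: 1]mulr1 scalerA mulVf ?scale1r//.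
  by near: h; exact: nbhs_dnbhs_neq.
by split; [apply/cvg_ex; exists (r 0) | exact/cvg_lim].
Unshelve. all: by end_near. Qed.

Lemma derive_curve0_cst n (f : R -> 'rV[R]_n) :
  (forall t, is_derive t (1 : R) f 0) -> forall a b, f a = f b.
Proof.
move=> df a b; apply/rowP => j.
apply: (@is_derive_0_is_cst R (fun t => f t ord0 j)) => t.
have dt : derivable f t 1 by exact: ex_derive.
split; first by have /derivable_mxP := dt; apply.
by have := derive_mx dt; rewrite derive_val => /rowP/(_ j); rewrite !mxE.
Qed.

Lemma derive_curve_unique (V : normedModType R) (f : R -> V) t d d' :
  is_derive t (1 : R) f d -> is_derive t (1 : R) f d' -> d = d'.
Proof. by move=> [_ <-] [_ <-]. Qed.

Lemma linear_row_continuous n (V : normedModType R) (f : {linear 'rV[R]_n -> V}) :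
  continuous f.
Proof.
have fE : (f : 'rV[R]_n -> V) = \sum_(j < n) (fun x : 'rV[R]_n => x ord0 j *: f 'e_j).
  apply/funext => x; rewrite fct_sumE {1}[x]row_sum_delta linear_sum.
  by apply: eq_bigr => j _; rewrite linearZ.
move=> x; rewrite fE; apply: differentiable_continuous.
by apply: differentiable_sum => j; exact/differentiableZl/differentiable_coord.
Qed.

Lemma derive_curve_linear n (V : normedModType R) (f : {linear 'rV[R]_n -> V})
    (u : R -> 'rV[R]_n) t du :
  is_derive t (1 : R) u du -> is_derive t (1 : R) (fun s => f (u s)) (f du).
Proof.
move=> hu; have cf := @linear_row_continuous n V f.
have := derive_curve_comp (linear_differentiable (u t) cf) hu.
by rewrite diff_lin.
Qed.

Lemma derive_curve_mulmx n m (M : 'M[R]_(n, m)) (u : R -> 'rV[R]_n) t du :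
  is_derive t (1 : R) u du -> is_derive t (1 : R)
    (fun s => @mulmx R 1 n m (u s) M) (@mulmx R 1 n m du M).
Proof. exact: (@derive_curve_linear n _ (mulmxr M)). Qed.

Lemma mulmx_continuous n m (M : 'M[R]_(n, m)) : continuous (fun X : 'rV[R]_n => X *m M).
Proof. by move=> X; exact: (@linear_row_continuous n _ (mulmxr M)). Qed.

Lemma mulmx_lipschitz n m (M : 'M[R]_(n, m)) :
  exists2 k, 0 < k & forall X : 'rV[R]_n, `|X *m M| <= k * `|X|.
Proof. exact: (linear_lipschitz (@linear_row_continuous n _ (mulmxr M))). Qed.

End Curves.

(** * Group laws on a vector space and their automorphisms *)

Section GroupLaw.
Variables (R : realType) (n : nat).
Local Notation g := 'rV[R]_n.
Variable mm : g * g -> g.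
Hypothesis mm_diff : forall p, differentiable mm p.
Hypothesis mm_C1 : forall v, continuous ('D_v mm).
Local Notation mul X Y := (mm (X, Y)).
Implicit Types X Y Z U W : g.
Hypothesis mulA : forall X Y Z, mul X (mul Y Z) = mul (mul X Y) Z.
Hypothesis mulX0 : forall X, mul X 0 = X.
Hypothesis mul0X : forall X, mul 0 X = X.
Hypothesis mul_line : forall s t X, mul (s *: X) (t *: X) = (s + t) *: X.

Lemma diff_pair00 (f : g * g -> g) p : 'd f p (0, 0) = 0.
Proof. exact: (linear0 ('d f p)). Qed.

Lemma mulXN X : mul X (- X) = 0.
Proof. by have := mul_line 1 (-1) X; rewrite scale1r scaleN1r subrr scale0r. Qed.

Lemma mulNX X : mul (- X) X = 0.
Proof. by have := mul_line (-1) 1 X; rewrite scale1r scaleN1r addNr scale0r. Qed.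

Lemma mulK X Y : mul (mul X Y) (- Y) = X.
Proof. by rewrite -mulA mulXN mulX0. Qed.

Lemma mulKN X Y : mul (mul X (- Y)) Y = X.
Proof. by rewrite -mulA mulNX mulX0. Qed.

Lemma mulI X Y Z : mul X Y = mul X Z -> Y = Z.
Proof. by move=> /(congr1 (fun U => mul (- X) U)); rewrite !mulA mulNX !mul0X. Qed.

Lemma opp_mul X Y : - mul X Y = mul (- Y) (- X).
Proof. by apply: (@mulI (mul X Y)); rewrite mulXN mulA mulK mulXN. Qed.

Lemma derive_mul (u v : R -> g) t du dv :
  is_derive t (1 : R) u du -> is_derive t (1 : R) v dv ->
  is_derive t (1 : R) (fun s => mul (u s) (v s)) ('d mm (u t, v t) (du, dv)).
Proof.
move=> hu hv; have := derive_curve_pair hu hv.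
by move/(derive_curve_comp (mm_diff (u t, v t))).
Qed.

Lemma derive_mul_stat (u v : R -> g) t :
  is_derive t (1 : R) u 0 -> is_derive t (1 : R) v 0 ->
  is_derive t (1 : R) (fun s => mul (u s) (v s)) 0.
Proof.
by move=> hu hv; have := derive_mul hu hv; rewrite (diff_pair00 mm (u t, v t)).
Qed.

Lemma derive_cst (V : normedModType R) (X : V) t : is_derive t (1 : R) (fun=> X) 0.
Proof. exact: is_derive_cst. Qed.

Lemma derive_scale0 (X : g) t : is_derive t (1 : R) (fun s => s *: X) X.
Proof. exact: derive_curve_scale. Qed.

Lemma derive_affine (X K : g) t : is_derive t (1 : R) (fun s => X + s *: K) K.
Proof. by have := is_deriveD (derive_cst X t) (derive_scale0 K t); rewrite add0r. Qed.

Lemma dmm_split p H K : 'd mm p (H, K) = 'd mm p (H, 0) + 'd mm p (0, K).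
Proof. by rewrite -linearD -[_ + _]/(H + 0, 0 + K) addr0 add0r. Qed.

Lemma dmm_0l X K : 'd mm (0, X) (0, K) = K.
Proof.
have h1 : is_derive (0 : R) (1 : R) (fun s => mul 0 (X + s *: K)) ('d mm (0, X) (0, K)).
  have := derive_mul (derive_cst (0 : g) 0) (derive_affine X K 0).
  by rewrite /= scale0r !addr0.
apply: (derive_curve_unique h1).
rewrite (_ : (fun _ => _) = (fun s : R => X + s *: K)); last by apply/funext => s; rewrite mul0X.
exact: derive_affine.
Qed.

Lemma dmm_0r X H : 'd mm (X, 0) (H, 0) = H.
Proof.
have h1 : is_derive (0 : R) (1 : R) (fun s => mul (X + s *: H) 0) ('d mm (X, 0) (H, 0)).
  have := derive_mul (derive_affine X H 0) (derive_cst (0 : g) 0).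
  by rewrite /= scale0r !addr0.
apply: (derive_curve_unique h1).
rewrite (_ : (fun _ => _) = (fun s : R => X + s *: H)); last by apply/funext => s; rewrite mulX0.
exact: derive_affine.
Qed.

Lemma dmm00 H K : 'd mm (0, 0) (H, K) = H + K.
Proof. by rewrite dmm_split dmm_0l dmm_0r. Qed.

Lemma derive_mul0 (u v : R -> g) t du dv : u t = 0 -> v t = 0 ->
  is_derive t (1 : R) u du -> is_derive t (1 : R) v dv ->
  is_derive t (1 : R) (fun s => mul (u s) (v s)) (du + dv).
Proof. by move=> u0 v0 hu hv; have := derive_mul hu hv; rewrite u0 v0 dmm00. Qed.

(** The quotient [F] of the two subgroups is constant: passing from [t] to [t + h] only inserts the
    product of [c h] and [- (h *: Z)], whose derivative at 0 is [Z - Z]. *)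
Lemma one_parameter (c : R -> g) Z :
  (forall s t, c (s + t) = mul (c s) (c t)) -> is_derive (0 : R) (1 : R) c Z ->
  forall t, c t = t *: Z.
Proof.
move=> cD cZ.
have c0 : c 0 = 0.
  by apply: (@mulI (c 0)); rewrite -cD addr0 mulX0.
pose F t := mul (c t) (- (t *: Z)).
have dN t : is_derive t (1 : R) (fun s => - (s *: Z)) (- Z).
  by have := is_deriveN (derive_scale0 Z t).
have dF t : is_derive t (1 : R) F 0.
  apply: derive_curve_shift.
  have E : (fun h => F (t + h)) =
      (fun h => mul (mul (c t) (mul (c h) (- (h *: Z)))) (- (t *: Z))).
    by apply/funext => h; rewrite /F cD -mul_line opp_mul !mulA.
  rewrite E.
  have d1 : is_derive (0 : R) (1 : R) (fun h => mul (c h) (- (h *: Z))) 0.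
    have := derive_mul0 c0 _ cZ (dN 0); rewrite scale0r oppr0 subrr; exact.
  exact: (derive_mul_stat (derive_mul_stat (derive_cst (c t) 0) d1) (derive_cst _ 0)).
move=> t; have := derive_curve0_cst dF t 0.
rewrite /F c0 scale0r oppr0 mulX0 => /(congr1 (fun X => mul X (t *: Z))).
by rewrite mulKN mul0X.
Qed.

Definition cc (p : g * g) : g := mul (mul p.1 p.2) (- p.1).
Local Notation conj X Y := (cc (X, Y)).

Lemma cc_diff p : differentiable cc p.
Proof.
have lin1 : linear (fun q : g * g => q.1) by [].
have lin2 : linear (fun q : g * g => q.2) by [].
pose fst1 : {linear (g * g)%type -> g} :=
  HB.pack (fun q : g * g => q.1) (GRing.isLinear.Build _ _ _ _ _ lin1).
pose snd1 : {linear (g * g)%type -> g} :=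
  HB.pack (fun q : g * g => q.2) (GRing.isLinear.Build _ _ _ _ _ lin2).
have d1 : differentiable (fun q : g * g => q.1) p.
  by apply: (@linear_differentiable _ _ _ fst1) => q; exact: cvg_fst.
have d2 : differentiable (fun q : g * g => q.2) p.
  by apply: (@linear_differentiable _ _ _ snd1) => q; exact: cvg_snd.
have d3 : differentiable (fun q : g * g => (mul q.1 q.2, - q.1)) p.
  apply: differentiable_pair; last exact: differentiableN.
  exact: (differentiable_comp (differentiable_pair d1 d2) (mm_diff _)).
exact: (differentiable_comp d3 (mm_diff _)).
Qed.

Lemma conj0 Y : conj 0 Y = Y.
Proof. by rewrite /cc /= oppr0 mulX0 mul0X. Qed.

Lemma conjX0 X : conj X 0 = 0.
Proof. by rewrite /cc /= mulX0 mulXN. Qed.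

Lemma conjM X X' Y : conj (mul X X') Y = conj X (conj X' Y).
Proof. by rewrite /cc /= opp_mul !mulA. Qed.

Lemma conj_mul X Y Z : conj X (mul Y Z) = mul (conj X Y) (conj X Z).
Proof. by rewrite /cc /= !mulA mulKN. Qed.

Lemma derive_conj (u v : R -> g) t du dv :
  is_derive t (1 : R) u du -> is_derive t (1 : R) v dv ->
  is_derive t (1 : R) (fun s => conj (u s) (v s)) ('d cc (u t, v t) (du, dv)).
Proof.
move=> hu hv; have := derive_curve_pair hu hv.
by move/(derive_curve_comp (cc_diff (u t, v t))).
Qed.

(** Conjugation coincides with its own differential in the exponential chart, since
    [s |-> conj X (s *: Y)] is a one-parameter subgroup, hence a line. So [conj X] doubles as the
    adjoint action. *)
Lemma conjE X Y : conj X Y = 'd cc (X, 0) (0, Y).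
Proof.
have h : is_derive (0 : R) (1 : R) (fun s => conj X (s *: Y)) ('d cc (X, 0) (0, Y)).
  by have := derive_conj (derive_cst X 0) (derive_scale0 Y 0); rewrite scale0r.
have := one_parameter _ h; rewrite -[conj X Y]/(conj X Y) => /(_ _ 1).
rewrite !scale1r; apply => s t.
by rewrite -mul_line conj_mul.
Qed.

Lemma conj_linear X : linear (fun Y => conj X Y).
Proof.
move=> a Y Z; rewrite !conjE.
have -> : (0, a *: Y + Z) = a *: (0, Y) + (0, Z) :> g * g.
  by rewrite -[RHS]/(a *: 0 + 0, a *: Y + Z) scaler0 addr0.
by rewrite linearP.
Qed.

(** The Lie bracket, as the derivative of the adjoint action in the direction [X]; [lie_bracketE]
    makes the identification. *)
Definition br X Y : g := 'd cc (0, Y) (X, 0).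

Lemma derive_conj_line X Y : is_derive (0 : R) (1 : R) (fun s => conj (s *: X) Y) (br X Y).
Proof. by have := derive_conj (derive_scale0 X 0) (derive_cst Y 0); rewrite scale0r. Qed.

Lemma dcc0 Y H K : 'd cc (0, Y) (H, K) = br H Y + K.
Proof.
have -> : (H, K) = (H, 0) + (0, K) :> g * g.
  by rewrite -[RHS]/(H + 0, 0 + K) addr0 add0r.
rewrite linearD; congr (_ + _).
have h1 : is_derive (0 : R) (1 : R) (fun s => conj 0 (Y + s *: K)) ('d cc (0, Y) (0, K)).
  have := derive_conj (derive_cst (0 : g) 0) (derive_affine Y K 0).
  by rewrite /= scale0r !addr0.
apply: (derive_curve_unique h1).
rewrite (_ : (fun _ => _) = (fun s : R => Y + s *: K)); last by apply/funext => s; rewrite conj0.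
exact: derive_affine.
Qed.

Lemma dcc_0l X H : 'd cc (X, 0) (H, 0) = 0.
Proof.
have := derive_conj (derive_affine X H 0) (derive_cst (0 : g) 0).
rewrite scale0r addr0 => /derive_curve_unique; apply.
rewrite (_ : (fun _ => _) = fun=> 0); first exact: derive_cst.
by apply/funext => s; rewrite conjX0.
Qed.

Lemma conjD X Y Z : conj X (Y + Z) = conj X Y + conj X Z.
Proof. by have := conj_linear X 1 Y Z; rewrite !scale1r. Qed.

Lemma conjZ X a Y : conj X (a *: Y) = a *: conj X Y.
Proof. by have := conj_linear X a Y 0; rewrite !addr0 conjX0 addr0. Qed.

Lemma conjB X Y Z : conj X (Y - Z) = conj X Y - conj X Z.
Proof. by rewrite conjD -scaleN1r conjZ scaleN1r. Qed.

Lemma brN X Y : br (- X) Y = - br X Y.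
Proof.
rewrite /br; have -> : (- X, 0) = - (X, 0) :> g * g
  by rewrite -[RHS]/(- X, - 0) oppr0.
by rewrite linearN.
Qed.

Lemma derive_conj_stat X (v : R -> g) t : is_derive t (1 : R) v 0 ->
  is_derive t (1 : R) (fun s => conj X (v s)) 0.
Proof.
by move=> hv; have := derive_conj (derive_cst X t) hv; rewrite (diff_pair00 cc (X, v t)).
Qed.

Lemma derive_conjr X (v : R -> g) t dv : is_derive t (1 : R) v dv ->
  is_derive t (1 : R) (fun s => conj X (v s)) (conj X dv).
Proof.
pose cX : {linear g -> g} :=
  HB.pack (fun Y => conj X Y) (GRing.isLinear.Build _ _ _ _ _ (conj_linear X)).
exact: (@derive_curve_linear R n g cX).
Qed.

(** The Maurer-Cartan form in the exponential chart, classically [(1 - exp (- ad U)) / ad U] applied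
    to [W]. Its inverse [dexp U] is the differential at the identity of left translation by [U]. *)
Definition dlog U W : g := 'd mm (- U, U) (0, W).

Lemma dlogZ U a W : dlog U (a *: W) = a *: dlog U W.
Proof.
rewrite /dlog; have -> : (0, a *: W) = a *: (0, W) :> g * g
  by rewrite -[RHS]/(a *: 0, a *: W) scaler0.
by rewrite linearZ.
Qed.

Lemma derive_dlog U W : is_derive (0 : R) (1 : R) (fun s => mul (- U) (U + s *: W)) (dlog U W).
Proof.
by have := derive_mul (derive_cst (- U) 0) (derive_affine U W 0); rewrite scale0r addr0.
Qed.

Lemma dlog0 W : dlog 0 W = W.
Proof. by rewrite /dlog oppr0 dmm_0l. Qed.

Lemma dlog_continuous W : continuous (fun U => dlog U W).
Proof.
move=> U; rewrite /dlog.
have -> : (fun U => 'd mm (- U, U) (0, W)) = (fun U => 'D_(0, W) mm (- U, U)).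
  by apply/funext => V; rewrite deriveE.
apply: (@continuous_comp _ _ _ (fun U : g => (- U, U) : g * g) ('D_(0, W) mm)).
  apply: differentiable_continuous.
  by apply: differentiable_pair => //; exact: differentiableN.
exact: mm_C1.
Qed.

(** The point [(t + s) *: (U + h *: W)] is the product of its multiples by [t] and by [s];
    differentiating in [h] gives a cocycle in the scaling parameter. It takes the place of the power
    series of [dlog] in [ad U]. *)
Lemma dlog_cocycle U W s t : (t + s) *: dlog ((t + s) *: U) W =
  conj (- (s *: U)) (t *: dlog (t *: U) W) + s *: dlog (s *: U) W.
Proof.
rewrite -!dlogZ.
pose q t h := mul (- (t *: U)) (t *: U + h *: (t *: W)).
have dq r : is_derive (0 : R) (1 : R) (q r) (dlog (r *: U) (r *: W)) by exact: derive_dlog.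
have qE r h : q r h = mul (- (r *: U)) (r *: (U + h *: W)).
  by rewrite /q scalerDr !scalerA [r * h]mulrC.
have q0 r : q r 0 = 0 by rewrite qE scale0r addr0 mulNX.
apply: (derive_curve_unique (dq _)).
have -> : q (t + s) = (fun h => mul (conj (- (s *: U)) (q t h)) (q s h)).
  apply/funext => h; rewrite !qE -!mul_line opp_mul /cc /= opprK !mulA.
  by rewrite mulK.
have e0 : conj (- (s *: U)) (q t 0) = 0 by rewrite q0 conjX0.
exact: (derive_mul0 e0 (q0 s) (derive_conjr _ (dq t)) (dq s)).
Qed.

Definition dexp X Y : g := 'd mm (X, 0) (0, Y).

Lemma dlogK X Y : dlog X (dexp X Y) = Y.
Proof.
have d1 : is_derive (0 : R) (1 : R) (fun h => mul X (h *: Y)) (dexp X Y).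
  by have := derive_mul (derive_cst X 0) (derive_scale0 Y 0); rewrite scale0r.
have := derive_mul (derive_cst (- X) 0) d1; rewrite scale0r mulX0.
move/derive_curve_unique; apply.
rewrite (_ : (fun _ => _) = (fun s : R => s *: Y)); first exact: derive_scale0.
by apply/funext => s; rewrite mulA mulNX mul0X.
Qed.

Lemma dexpK X Y : dexp X (dlog X Y) = Y.
Proof.
have := derive_mul (derive_cst X 0) (derive_dlog X Y); rewrite scale0r addr0 mulNX.
move/derive_curve_unique; apply.
rewrite (_ : (fun _ => _) = (fun s : R => X + s *: Y)); first exact: derive_affine.
by apply/funext => s; rewrite mulA mulXN mul0X.
Qed.

Lemma derive_mul_line X Y t :
  is_derive t (1 : R) (fun t => mul X (t *: Y)) (dexp (mul X (t *: Y)) Y).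
Proof.
apply: derive_curve_shift.
rewrite (_ : (fun _ => _) = (fun h => mul (mul X (t *: Y)) (h *: Y))).
  have := derive_mul (derive_cst (mul X (t *: Y)) 0) (derive_scale0 Y 0).
  by rewrite scale0r.
by apply/funext => h; rewrite -mulA mul_line.
Qed.

Section Automorphism.
Variable M : 'M[R]_n.
Local Notation D X := (X *m M).
Hypothesis D_br : forall X Y, D (br X Y) = br (D X) (D Y).

(** The curve [f] undoes the conjugation by [s *: D X]. With [Z] the conjugate reached at [s], its
    derivative reduces to [br (- D X) (D Z) + D (br X Z)], which vanishes by [D_br]. *)
Lemma conj_auto X Y : D (conj X Y) = conj (D X) (D Y).
Proof.
pose f (s : R) := conj (- (s *: D X)) (D (conj (s *: X) Y)).
have df s : is_derive s (1 : R) f 0.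
  apply: derive_curve_shift; pose Z := conj (s *: X) Y.
  pose k (h : R) := conj (- (h *: D X)) (D (conj (h *: X) Z)).
  have -> : (fun h => f (s + h)) = (fun h => conj (- (s *: D X)) (k h)).
    by apply/funext => h; rewrite /f /k -conjM -opp_mul mul_line -conjM mul_line addrC.
  apply: derive_conj_stat.
  have d1 : is_derive (0 : R) (1 : R) (fun h => - (h *: D X)) (- D X).
    by have := is_deriveN (derive_scale0 (D X) 0).
  have d2 := derive_curve_mulmx M (derive_conj_line X Z).
  have := derive_conj d1 d2.
  by rewrite scale0r oppr0 scale0r conj0 dcc0 D_br brN addNr.
have := derive_curve0_cst df 1 0.
rewrite /f !scale1r !scale0r oppr0 !conj0 => <-.
by rewrite -conjM mulXN conj0.
Qed.

(** The difference [delta] of the two sides, rescaled by [t], inherits the cocycle identity and is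
    o(t) at 0, because [rho] is continuous with [rho 0 = 0]. Conjugation by [t *: D U] turns such a
    cocycle into a curve [e] with zero derivative everywhere. *)
Lemma dlog_auto U W : D (dlog U W) = dlog (D U) (D W).
Proof.
pose rho (t : R) := D (dlog (t *: U) W) - dlog (t *: D U) (D W).
pose delta t := t *: rho t.
have deltaE r : delta r = D (r *: dlog (r *: U) W) - r *: dlog (r *: D U) (D W).
  by rewrite /delta /rho scalerBr -[in RHS]scalemxAl.
have deltaD t s : delta (t + s) = conj (- (s *: D U)) (delta t) + delta s.
  rewrite !deltaE (dlog_cocycle U) (dlog_cocycle (D U)) mulmxDl conj_auto mulNmx.
  by rewrite -(scalemxAl s U) conjB opprD addrACA.
have d0 : is_derive (0 : R) (1 : R) delta 0.
  have -> : 0 = rho 0 by rewrite /rho !scale0r !dlog0 subrr.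
  apply: derive_curve_scale_cont; rewrite /rho; apply: continuousB.
    apply: (@continuous_comp _ _ _ (fun t : R => dlog (t *: U) W) (mulmxr M)).
      apply: (@continuous_comp _ _ _ (fun t : R => t *: U) (fun V => dlog V W)).
        exact: scalel_continuous.
      exact: dlog_continuous.
    exact: linear_row_continuous.
  apply: (@continuous_comp _ _ _ (fun t : R => t *: D U) (fun V => dlog V (D W))).
    exact: scalel_continuous.
  exact: dlog_continuous.
pose e t := conj (t *: D U) (delta t).
have de t : is_derive t (1 : R) e 0.
  apply: derive_curve_shift.
  have -> : (fun h => e (t + h)) = (fun h => e t + conj ((t + h) *: D U) (delta h)).
    by apply/funext => h; rewrite /e deltaD conjD -conjM -mul_line mulK.
  have d1 : is_derive (0 : R) (1 : R) (fun h => (t + h) *: D U) (D U).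
    have := derive_affine (t *: D U) (D U) 0; congr is_derive.
    by apply/funext => h; rewrite scalerDl.
  have := derive_conj d1 d0; rewrite [delta 0]scale0r dcc_0l => d2.
  by have := is_deriveD (derive_cst (e t) 0) d2; rewrite add0r.
have := derive_curve0_cst de 1 0.
rewrite /e /delta !scale0r conj0 !scale1r => /(congr1 (fun V => conj (- D U) V)).
rewrite -conjM mulNX conj0 conjX0 /rho !scale1r => /eqP; rewrite subr_eq0 => /eqP.
exact.
Qed.

(** Since [dexp] is inverse to [dlog], [M] commutes with it. Hence the image of the curve
    [mul X (t *: Y)] and the curve [mul (D X) (t *: D Y)] have the same left-invariant velocity
    [D Y], and so the quotient [F] of the former by [t *: D Y] is constant. *)
Lemma mul_auto X Y : D (mul X Y) = mul (D X) (D Y).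
Proof.
have dexp_auto Z : D (dexp Z Y) = dexp (D Z) (D Y).
  by rewrite -[LHS](dexpK (D Z)) -dlog_auto dlogK.
pose u t := D (mul X (t *: Y)).
have du t : is_derive t (1 : R) u (dexp (u t) (D Y)).
  by have := derive_curve_mulmx M (derive_mul_line X Y t); rewrite dexp_auto.
pose F t := mul (u t) (- (t *: D Y)).
have dF t : is_derive t (1 : R) F 0.
  have d1 : is_derive t (1 : R) (fun h => - (h *: D Y)) (- D Y).
    by have := is_deriveN (derive_scale0 (D Y) t).
  have dF := derive_mul (du t) d1.
  suff <- : 'd mm (u t, - (t *: D Y)) (dexp (u t) (D Y), - D Y) = 0 by [].
  (* The inner factors of [k] cancel, so [k] is constant; its derivative at 0 is the very value of
     the differential of [mm] that has to vanish. *)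
  pose k (h : R) := mul (mul (u t) (h *: D Y)) (- (t *: D Y) - h *: D Y).
  have dk : is_derive (0 : R) (1 : R) k 0.
    rewrite (_ : k = fun=> F t); first exact: derive_cst.
    by apply/funext => h; rewrite /k /F -opprD -scalerDl -mul_line opp_mul mulA mulK.
  have d2 : is_derive (0 : R) (1 : R) (fun h => mul (u t) (h *: D Y)) (dexp (u t) (D Y)).
    by have := derive_mul (derive_cst (u t) 0) (derive_scale0 (D Y) 0); rewrite scale0r.
  have d3 : is_derive (0 : R) (1 : R) (fun h => - (t *: D Y) - h *: D Y) (- D Y).
    have := derive_affine (- (t *: D Y)) (- D Y) 0; congr is_derive.
    by apply/funext => h; rewrite scalerN.
  have := derive_mul d2 d3; rewrite scale0r subr0 mulX0.
  by move/derive_curve_unique; apply.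
have := derive_curve0_cst dF 1 0.
rewrite /F /u !scale1r !scale0r oppr0 !mulX0 => /(congr1 (fun V => mul V (D Y))).
by rewrite mulKN.
Qed.

End Automorphism.

End GroupLaw.

(** * Dilations in an eigenbasis *)

Section DilationMatrix.
Variable R : realType.

(** The [E i] are the projections onto the lines of the eigenbasis. Powers and partial sums are
    combinations of them, so the matrix series converges coefficient by coefficient, as scalar
    exponential series. *)
Lemma mx_exp_diag n (P A : 'M[R]_n) (w : 'rV[R]_n) : P \in unitmx ->
  A = invmx P *m diag_mx w *m P ->
  mx_exp A = invmx P *m diag_mx (\row_i expR (w ord0 i)) *m P.
Proof.
move=> Pu AE.
pose E i := invmx P *m diag_mx ('e_i : 'rV[R]_n) *m P.
have split (v : 'rV[R]_n) : invmx P *m diag_mx v *m P = \sum_i v ord0 i *: E i.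
  rewrite {1}[v]row_sum_delta linear_sum mulmx_sumr mulmx_suml.
  by apply: eq_bigr => i _; rewrite linearZ -scalemxAr -scalemxAl.
have powE k : A ^+ k = \sum_i (w ord0 i) ^+ k *: E i.
  transitivity (\sum_i (\row_i (w ord0 i) ^+ k) ord0 i *: E i); last first.
    by apply: eq_bigr => i _; rewrite mxE.
  rewrite -split; elim: k => [|k IH].
    rewrite expr0 (_ : diag_mx _ = 1%:M) ?mulmx1 ?mulVmx//.
    by apply/matrixP => i j; rewrite !mxE expr0.
  rewrite exprS IH (_ : A * _ = A *m (invmx P *m diag_mx (\row_i w ord0 i ^+ k) *m P))//.
  rewrite AE !mulmxA mulmxK//; congr (_ *m _); rewrite -!mulmxA; congr (_ *m _).
  apply/matrixP => i j; rewrite mul_diag_mx !mxE exprS.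
  by case: eqP => [->|_]; rewrite ?mulr1n ?mulr0n ?mulr0.
rewrite /mx_exp (_ : series _ =
    (fun N => \sum_i (series (exp_coeff (w ord0 i)) N *: E i))); last first.
  apply/funext => N; rewrite /series /=.
  under eq_bigr do rewrite powE scaler_sumr.
  rewrite exchange_big /=; apply: eq_bigr => i _; rewrite scaler_suml.
  by apply: eq_bigr => k _; rewrite scalerA mulrC.
rewrite split; apply/cvg_lim => //.
under [X in _ --> X]eq_bigr do rewrite mxE.
apply: (@cvg_big _ _ _ _ _ _ _ _ _ (fun i N => series (exp_coeff (w ord0 i)) N *: E i)).
- exact: add_continuous.
- move=> i _; have c : series (exp_coeff (w ord0 i)) @ \oo --> expR (w ord0 i).
    exact: is_cvg_series_exp_coeff.
  by apply: cvgZr_tmp; exact: c.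
Qed.

Lemma dilation_mx_diag n (A0 : 'M[R]_n) : diagonalizable A0 ->
  exists P (w : 'rV[R]_n), [/\ P \in unitmx, A0 = invmx P *m diag_mx w *m P &
    forall r, 0 < r -> dilation_mx A0 r =
      invmx P *m diag_mx (\row_i r `^ (w ord0 i)) *m P].
Proof.
move=> [P Pu /(diagonalizable_forLR Pu)[w AE]].
rewrite mxpoly.conjumx ?unitmx_inv// invmxK in AE.
exists P, w; split => // r r0; rewrite /dilation_mx.
rewrite (@mx_exp_diag _ P _ (ln r *: w))//.
  congr (_ *m diag_mx _ *m _); apply/rowP => i; rewrite !mxE /powR gt_eqF//.
  by rewrite mulrC.
by rewrite AE linearZ /= -scalemxAr -scalemxAl.
Qed.

End DilationMatrix.

(** Exponential coordinates in an eigenbasis of [hg_A0]. Bracket and calculus enter the growth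
    estimates only through [gc_dilationM] and [gc_mul_first_order]. *)
Record graded_chart (R : realType) (G : homogeneousGroup R) := GradedChart {
  gc_weight : 'I_(lg_dim G) -> R ;
  gc_log : G -> 'rV[R]_(lg_dim G) ;
  gc_exp : 'rV[R]_(lg_dim G) -> G ;
  gc_expK : cancel gc_exp gc_log ;
  gc_logK : cancel gc_log gc_exp ;
  gc_exp_continuous : continuous gc_exp ;
  gc_log_continuous : continuous gc_log ;
  gc_expD : forall X s t, gc_exp ((s + t) *: X) = (gc_exp (s *: X) * gc_exp (t *: X))%g ;
  gc_weight_ge1 : forall i, 1 <= gc_weight i ;
  gc_weight_sum : \sum_i gc_weight i = hom_dim G ;
  gc_dilation : forall r x i, 0 < r ->
    gc_log (dilation r x) ord0 i = r `^ gc_weight i * gc_log x ord0 i ;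
  gc_dilationM : forall r (x y : G), 0 < r ->
    dilation r (x * y)%g = (dilation r x * dilation r y)%g ;
  gc_mul_first_order : forall eps, 0 < eps -> exists2 d, 0 < d &
    forall a b m, `|a| <= m -> `|b| <= m -> m < d ->
      `|gc_log (gc_exp a * gc_exp b)%g - a - b| <= eps * m
}.

(** * The group law in exponential and in graded coordinates *)

Section ExpLie.
Variables (R : realType) (G : expLieGroup R).
Local Notation g := 'rV[R]_(lg_dim G).
Implicit Types X Y : g.

Definition chart_mul (p : g * g) : g := lg_log (lg_exp p.1 * lg_exp p.2)%g.

Lemma lg_exp0 : lg_exp 0 = 1%g :> G.
Proof.
have := lg_expD (0 : g) 0 0; rewrite addr0 scale0r.
by move=> /(congr1 (fun x => (x * (lg_exp 0)^-1)%g)); rewrite -mulgA mulgV mulg1.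
Qed.

Lemma chart_mulA X Y Z : chart_mul (X, chart_mul (Y, Z)) = chart_mul (chart_mul (X, Y), Z).
Proof. by rewrite /chart_mul /= !lg_logK mulgA. Qed.

Lemma chart_mulX0 X : chart_mul (X, 0) = X.
Proof. by rewrite /chart_mul /= lg_exp0 mulg1 lg_expK. Qed.

Lemma chart_mul0X X : chart_mul (0, X) = X.
Proof. by rewrite /chart_mul /= lg_exp0 mul1g lg_expK. Qed.

Lemma chart_mul_line s t X : chart_mul (s *: X, t *: X) = (s + t) *: X.
Proof. by rewrite /chart_mul /= -lg_expD lg_expK. Qed.

Lemma lg_expN X : lg_exp (- X) = (lg_exp X)^-1%g.
Proof.
apply: (@mulgI _ (lg_exp X)); rewrite mulgV.
by have := lg_expD X 1 (-1); rewrite scale1r scaleN1r subrr scale0r lg_exp0.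
Qed.

Lemma chart_mul_C1 v : continuous ('D_v chart_mul).
Proof. by have [_ /(_ v)[_ []]] := lg_mul_smooth G 1%N. Qed.

(** [smooth] only provides iterated directional derivatives; its case of order 1 along the standard
    basis of the product space is enough for [C1_differentiable]. *)
Lemma chart_mul_diff p : differentiable chart_mul p.
Proof.
pose e (i : 'I_(lg_dim G) + 'I_(lg_dim G)) : g * g :=
  match i with inl j => ('e_j, 0) | inr j => (0, 'e_j) end.
pose phi i (v : g * g) : R :=
  match i with inl j => v.1 ord0 j | inr j => v.2 ord0 j end.
have lphi i : linear (phi i : g * g -> R).
  by case: i => j a u v; rewrite /phi !mxE.
pose Phi i : {linear (g * g)%type -> R} :=
  HB.pack (phi i) (GRing.isLinear.Build _ _ _ _ _ (lphi i)).
apply: (@C1_differentiable R _ _ e Phi).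
- case=> j v /=; rewrite /phi.
    apply: (@continuous_comp _ _ _ (fun v : g * g => v.1) (fun X : g => X ord0 j)).
      exact: cvg_fst.
    exact: coord_continuous.
  apply: (@continuous_comp _ _ _ (fun v : g * g => v.2) (fun X : g => X ord0 j)).
    exact: cvg_snd.
  exact: coord_continuous.
- move=> [u v]; rewrite big_sumType /=.
  have pl (x y : g) : (x + y, 0 : g) = (x, 0) + (y, 0).
    by rewrite -[RHS]/(x + y, 0 + 0) addr0.
  have pr (x y : g) : (0 : g, x + y) = (0, x) + (0, y).
    by rewrite -[RHS]/(0 + 0, x + y) addr0.
  transitivity ((u, 0) + (0, v) : g * g).
    by rewrite -[RHS]/(u + 0, 0 + v) addr0 add0r.
  rewrite {1}[u]row_sum_delta {1}[v]row_sum_delta.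
  rewrite (big_morph _ pl (erefl (0 : g * g))) (big_morph _ pr (erefl (0 : g * g))).
  congr (_ + _); apply: eq_bigr => i _.
    by rewrite -[RHS]/(u ord0 i *: 'e_i, u ord0 i *: 0) scaler0.
  by rewrite -[RHS]/(v ord0 i *: 0, v ord0 i *: 'e_i) scaler0.
- by move=> i y; have [_ /(_ (e i))[+ _]] := lg_mul_smooth G 1%N; exact.
- by move=> i; exact: chart_mul_C1.
Qed.

(** Conjugation is already linear in the chart, so [lie_Ad] is conjugation itself and a single
    derivative remains. *)
Lemma lie_bracketE X Y : lie_bracket X Y = br chart_mul X Y.
Proof.
have AdE x Z : lie_Ad (lg_exp x) Z = cc chart_mul (x, Z).
  rewrite /lie_Ad (_ : (fun t => _) = (fun t : R => t *: cc chart_mul (x, Z))).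
    rewrite derive1E; have [_ ->] := @derive_curve_scale R _ (cc chart_mul (x, Z)) 0.
    by [].
  apply/funext => t.
  rewrite -(conjZ chart_mul_diff chart_mulA chart_mulX0 chart_mul0X chart_mul_line).
  by rewrite /cc /chart_mul /= !lg_logK lg_expN.
rewrite /lie_bracket derive1E (_ : (fun s => _) = (fun s : R => cc chart_mul (s *: X, Y))).
  by have [_ ->] := derive_conj_line chart_mul_diff X Y.
by apply/funext => s; rewrite AdE.
Qed.

End ExpLie.

Section GradedChart.
Variables (R : realType) (G : homogeneousGroup R).
Local Notation g := 'rV[R]_(lg_dim G).

Lemma dilation_morph r (x y : G) : 0 < r ->
  dilation r (x * y)%g = (dilation r x * dilation r y)%g.
Proof.
move=> r0; apply: (can_inj (@lg_logK _ G)); rewrite /dilation.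
have D_br X Y : br (@chart_mul R G) X Y *m dilation_mx (hg_A0 G) r =
    br (@chart_mul R G) (X *m dilation_mx (hg_A0 G) r) (Y *m dilation_mx (hg_A0 G) r).
  by rewrite -!lie_bracketE hg_dilation_bracket.
have := mul_auto (@chart_mul_diff R G) (@chart_mul_C1 R G) (@chart_mulA R G)
  (@chart_mulX0 R G) (@chart_mul0X R G) (@chart_mul_line R G) D_br
  (lg_log x) (lg_log y).
by rewrite /chart_mul /= !lg_logK lg_expK => ->.
Qed.

Lemma exists_graded_chart : exists _ : graded_chart G, True.
Proof.
have [P [w [Pu A0E DE]]] := dilation_mx_diag (hg_diagonalizable G).
have PK : cancel (fun X : g => X *m P) (fun X : g => X *m invmx P).
  exact: mulmxK.
have PVK : cancel (fun X : g => X *m invmx P) (fun X : g => X *m P).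
  exact: mulmxKV.
unshelve eexists; last by [].
apply: (@GradedChart R G (fun i => w ord0 i) (fun x => lg_log x *m invmx P)
  (fun X => lg_exp (X *m P))).
- by move=> X; rewrite lg_expK mulmxK.
- by move=> x; rewrite mulmxKV// lg_logK.
- move=> X; apply: (@continuous_comp _ _ _ (fun X : g => X *m P) (@lg_exp _ G)).
    exact: mulmx_continuous.
  exact: lg_exp_continuous.
- move=> x; apply: (@continuous_comp _ _ _ (@lg_log _ G) (fun X : g => X *m invmx P)).
    exact: lg_log_continuous.
  exact: mulmx_continuous.
- by move=> X s t; rewrite -!scalemxAl lg_expD.
- move=> i; apply: hg_weight_ge1; apply/eigenvalueP; exists (row i P).
    rewrite A0E rowE !mulmxA mulmxK// scalemxAl; congr (_ *m _).
    by apply/rowP => j; rewrite mul_mx_diag !mxE eqxx /=; case: (eqVneq j i) => [->|_]; rewrite /= ?mulr1 ?mul1r ?mulr0 ?mul0r.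
  apply/eqP => /(congr1 (mulmx^~ (invmx P))); rewrite mul0mx rowE mulmxK//.
  by move=> /rowP/(_ i)/eqP; rewrite !mxE !eqxx oner_eq0.
- by rewrite /hom_dim A0E mxtrace_mulC mulmxA mulmxV// mul1mx mxtrace_diag.
- move=> r x i r0; rewrite /dilation lg_expK DE// !mulmxA mulmxK//.
  by rewrite mul_mx_diag !mxE mulrC.
- by move=> r x y r0; exact: dilation_morph.
- move=> eps eps0.
  have [k1 k10 K1] := mulmx_lipschitz P.
  have [k2 k20 K2] := mulmx_lipschitz (invmx P).
  have /diff_locally H := @chart_mul_diff R G (0, 0).
  (* The change of basis costs a factor [k1] on the way into the Lie algebra and [k2] on the way
     back. *)
  have e0 : 0 < eps / (k1 * k2) by rewrite divr_gt0// mulr_gt0.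
  move/eqaddoP: H => /(_ _ e0)/nbhs_ballP[d /= d0 dP].
  exists (d / k1); first by rewrite divr_gt0.
  move=> a b m am bm md.
  pose A : g := a *m P; pose B : g := b *m P.
  have Am : `|A| <= k1 * m by rewrite (le_trans (K1 a))// ler_wpM2l// ltW.
  have Bm : `|B| <= k1 * m by rewrite (le_trans (K1 b))// ler_wpM2l// ltW.
  have nAB : `|(A, B)| <= k1 * m by rewrite prod_normE /= ge_max Am Bm.
  have : ball 0 d (A, B).
    rewrite -ball_normE /= sub0r normrN (le_lt_trans nAB)//.
    by rewrite mulrC -ltr_pdivlMr.
  move/dP; rewrite /= => le.
  have E : lg_log (lg_exp A * lg_exp B)%g *m invmx P - a - b =
     (chart_mul (A, B) - A - B) *m invmx P.
    by rewrite !mulmxBl !mulmxK.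
  rewrite E (le_trans (K2 _))//.
  have -> : eps * m = k2 * (eps / (k1 * k2) * (k1 * m)) by field; rewrite !gt_eqF.
  rewrite ler_wpM2l ?(ltW k20)//.
  rewrite (@le_trans _ _ (eps / (k1 * k2) * `|(A, B)|))//; last first.
    by rewrite ler_wpM2l// ltW.
  apply: le_trans le; rewrite le_eqVlt; apply/orP; left; apply/eqP; congr (`|_|).
  rewrite !addrfctE opprD.
  rewrite -[RHS]/(chart_mul ((A, B) + 0) +
    (- chart_mul (0, 0) - 'd (@chart_mul R G) (0, 0) (A, B))).
  rewrite addr0 chart_mul0X oppr0 add0r.
  by rewrite (dmm00 (@chart_mul_diff R G) (@chart_mulX0 R G) (@chart_mul0X R G)) opprD addrA.
Qed.

End GradedChart.

(** * Growth of homogeneous groups *)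

Section Growth.
Variables (R : realType) (G : homogeneousGroup R) (gc : graded_chart G).
Local Notation n := (lg_dim G).
Local Notation w := (gc_weight gc).
Local Notation xi := (gc_log gc).
Local Notation ex := (gc_exp gc).
Variables (N : G -> R) (hN : homogeneous_norm N).
Implicit Types (x y : G) (S : {set 'I_n}) (i j : 'I_n).

Lemma weight_gt0 i : 0 < w i.
Proof. by apply: lt_le_trans (gc_weight_ge1 gc i). Qed.

Lemma gc_exp0 : ex 0 = 1%g.
Proof.
have := gc_expD gc 0 0 0; rewrite addr0 scale0r.
by move=> /(congr1 (fun x => (x * (ex 0)^-1)%g)); rewrite -mulgA mulgV mulg1.
Qed.

Lemma gc_expN X : ex (- X) = (ex X)^-1%g.
Proof.
apply: (@mulgI _ (ex X)); rewrite mulgV.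
by have := gc_expD gc X 1 (-1); rewrite scale1r scaleN1r subrr scale0r gc_exp0.
Qed.

Lemma gc_log1 : xi 1%g = 0.
Proof. by rewrite -gc_exp0 gc_expK. Qed.

Lemma N1 : N 1%g = 0.
Proof. exact/(hn_eq0 hN). Qed.

Definition in_layer S x := forall j, j \notin S -> xi x ord0 j = 0.

Lemma coord_le_norm (X : 'rV[R]_n) i : `|X ord0 i| <= `|X|.
Proof. by rewrite [leRHS]/Num.norm /= mx_normrE (le_bigmax _ _ (ord0, i)). Qed.

Lemma norm_le_coord (X : 'rV[R]_n) m : 0 <= m -> (forall i, `|X ord0 i| <= m) -> `|X| <= m.
Proof.
move=> m0 h; rewrite [leLHS]/Num.norm /= mx_normrE; apply: bigmax_le => // -[i j] _.
by rewrite ord1.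
Qed.

(* Under the dilation by [r], the layer shrinks at least like [r `^ w j], so that
   the second order part of the product disappears in the limit. *)
Lemma low_coord_mul S j x y : (forall i, i \in S -> w j <= w i) ->
  in_layer S x -> in_layer S y -> xi (x * y)%g ord0 j = xi x ord0 j + xi y ord0 j.
Proof.
move=> wS Sx Sy.
pose B := 1 + Num.max `|xi x| `|xi y|.
have B0 : 0 < B by rewrite ltr_pwDl// le_max normr_ge0.
have dil_le r z : 0 < r -> r <= 1 -> in_layer S z -> `|xi z| <= B ->
    `|xi (dilation r z)| <= r `^ w j * B.
  move=> r0 r1 Sz zB; apply: norm_le_coord; first by rewrite mulr_ge0 ?powR_ge0// ltW.
  move=> i; rewrite gc_dilation// normrM ger0_norm ?powR_ge0//.
  have [iS|/Sz ->] := boolP (i \in S); last first.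
    by rewrite normr0 mulr0 mulr_ge0 ?powR_ge0// ltW.
  rewrite ler_pM ?powR_ge0// ?(le_trans (coord_le_norm _ _) zB)//.
  by apply: ger_powR; rewrite ?r0 ?r1 ?wS.
have xB : `|xi x| <= B by rewrite /B (@le_trans _ _ (Num.max `|xi x| `|xi y|)) ?le_max ?lexx// lerDr.
have yB : `|xi y| <= B by rewrite /B (@le_trans _ _ (Num.max `|xi x| `|xi y|)) ?le_max ?lexx ?orbT// lerDr.
apply/eqP; rewrite -subr_eq0 -normr_le0; apply/ler_addgt0Pr => eps eps0; rewrite add0r.
have [d d0 dP] := @gc_mul_first_order _ _ gc (eps / B) (divr_gt0 eps0 B0).
pose r := Num.min 1 (d / (2 * B)).
have r0 : 0 < r by rewrite lt_min ltr01 divr_gt0// mulr_gt0.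
have r1 : r <= 1 by rewrite ge_min lexx.
have rj : 0 < r `^ w j by exact: powR_gt0.
have md : r `^ w j * B < d.
  have : r `^ w j <= r.
    by rewrite ge1r_powR ?r0 ?r1// gc_weight_ge1.
  have rd : r <= d / (2 * B) by rewrite ge_min lexx orbT.
  move=> /le_trans/(_ rd); rewrite ler_pdivlMr ?mulr_gt0// => h.
  apply: lt_le_trans (h); rewrite mulrA ltr_pM2r//.
  by rewrite ltr_pMr// ltr1n.
have := dP _ _ _ (dil_le r x r0 r1 Sx xB) (dil_le r y r0 r1 Sy yB) md.
rewrite !gc_logK -gc_dilationM// => /(le_trans (coord_le_norm _ j)).
rewrite !mxE !gc_dilation// -!mulrBr normrM gtr0_norm// mulrCA ler_pM2l//.
by rewrite divfK ?gt_eqF// opprD addrA.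
Qed.

(** [m0] is the minimum of the norm on the unit sphere of the coordinates. If [i] maximises [f i],
    the coordinate size to the power [(w i)^-1], then the dilation of factor [(f i)^-1] brings [x]
    to that sphere, and homogeneity transports the bound back. *)
Lemma norm_coord_bound : exists2 m0, 0 < m0 & forall x i, `|xi x ord0 i| <= (N x / m0) `^ w i.
Proof.
pose K := [set X : 'rV[R]_n | `|X| = 1].
have cK : compact K.
  apply: bounded_closed_compact.
    by exists 1; split => // t t1 X /= ->; exact: ltW.
  have -> : K = (fun X => `|X|) @^-1` [set 1] by [].
  by apply: closed_comp; [move=> X _; exact: norm_continuous | exact: closed_eq].
have cN : continuous (fun X => N (ex X)).
  move=> X; apply: (@continuous_comp _ _ _ ex N); first exact: gc_exp_continuous.
  exact: hn_continuous.
have [m0 m00 mP] : exists2 m0, 0 < m0 & forall X, `|X| = 1 -> m0 <= N (ex X).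
  have [K0|K0] := pselect (K !=set0); last first.
    by exists 1 => // X X1; exfalso; apply: K0; exists X.
  have [X KX XP] := EVT_min_rV K0 cK (continuous_subspaceT cN).
  exists (N (ex X)) => [|Y Y1]; last by apply: XP; rewrite inE.
  rewrite lt_neqAle hn_ge0// andbT eq_sym; apply/eqP => /(hn_eq0 hN) e1.
  move: KX; rewrite inE /K /= -[X](gc_expK gc) e1 gc_log1 normr0 => /eqP.
  by rewrite eq_sym oner_eq0.
exists m0 => // x i0.
pose f i := `|xi x ord0 i| `^ (w i)^-1.
have fw i : f i `^ w i = `|xi x ord0 i|.
  by rewrite -powRrM mulVf ?gt_eqF ?weight_gt0// powRr1.
have [i _ iP] := @arg_maxP _ _ _ i0 xpredT f isT.
have {}iP j : f j <= f i by exact: iP.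
have [fi0|fi0] := eqVneq (f i) 0.
  have -> : xi x ord0 i0 = 0.
    apply/eqP; rewrite -normr_eq0 -fw powR_eq0 (gt_eqF (weight_gt0 _)) andbT.
    by rewrite eq_le powR_ge0 andbT -fi0 iP.
  by rewrite normr0 powR_ge0.
have fip : 0 < f i by rewrite lt_neqAle eq_sym fi0 powR_ge0.
pose y := dilation (f i)^-1 x.
have yE j : `|xi y ord0 j| = (f i)^-1 `^ w j * `|xi x ord0 j|.
  by rewrite gc_dilation ?invr_gt0// normrM ger0_norm// powR_ge0.
have y1 : `|xi y| = 1.
  apply/eqP; rewrite eq_le; apply/andP; split.
    apply: norm_le_coord => // j; rewrite yE -fw -powRM ?invr_ge0 ?powR_ge0//.
    apply: (@le_trans _ _ (1 `^ w j)); last by rewrite powR1.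
    rewrite ge0_ler_powR ?nnegrE ?(ltW (weight_gt0 _)) ?mulr_ge0 ?invr_ge0 ?powR_ge0//.
    by rewrite mulrC ler_pdivrMr// mul1r iP.
  apply: le_trans (coord_le_norm _ i); rewrite yE -fw -powRM ?invr_ge0 ?powR_ge0//.
  by rewrite mulVf// powR1.
have := mP _ y1; rewrite gc_logK hn_dilation ?invr_gt0// => le.
rewrite -fw ge0_ler_powR ?nnegrE ?(ltW (weight_gt0 _)) ?divr_ge0 ?powR_ge0 ?hn_ge0 ?(ltW m00)//.
rewrite (le_trans (iP i0))// ler_pdivlMr// mulrC -ler_pdivlMr//.
by rewrite mulrC.
Qed.

Lemma norm_axis i t : N (ex (t *: 'e_i)) = `|t| `^ (w i)^-1 * N (ex 'e_i).
Proof.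
wlog t0 : t / 0 < t => [H|].
  have [t0|t0|->] := ltgtP t 0.
  - by rewrite -(opprK (t *: _)) gc_expN (hn_inv hN) -scaleNr H ?normrN// oppr_gt0.
  - exact: H.
  - by rewrite scale0r gc_exp0 N1 normr0 powR0 ?mul0r// invr_eq0 gt_eqF ?weight_gt0.
rewrite gtr0_norm// -(hn_dilation hN) ?powR_gt0//; congr N.
rewrite -[RHS](gc_logK gc); congr ex; apply/rowP => j.
rewrite gc_dilation ?powR_gt0// gc_expK !mxE eqxx /=.
case: (eqVneq j i) => [->|_]; last by rewrite !mulr0.
by rewrite -powRrM mulVf ?gt_eqF ?weight_gt0// powRr1// ltW.
Qed.

(** [S] keeps the coordinates of highest weights. Those outside are additive by [low_coord_mul], so
    the elements supported in [S] are closed under products. *)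
Definition upper_closed S := forall i j, i \in S -> j \notin S -> w j <= w i.

Lemma in_layerM S x y : upper_closed S -> in_layer S x -> in_layer S y -> in_layer S (x * y)%g.
Proof.
move=> uS Sx Sy j jS; rewrite (@low_coord_mul S j)//; last by move=> i iS; exact: uS.
by rewrite Sx// Sy// addr0.
Qed.

Lemma in_layer_axis S i t : i \in S -> in_layer S (ex (t *: 'e_i)).
Proof.
move=> iS j jS; rewrite gc_expK !mxE eqxx /=.
by case: eqVneq jS => [->|_ _]; rewrite ?iS// mulr0.
Qed.

(** A coordinate [i] of lowest weight in [S] is split off at each step. As it is additive, [x]
    factors into a multiple of the mesh [c] along ['e_i], an element [x'] of the smaller layer and a
    remainder along ['e_i]. The number of multiples is O(M ^ w i), so the exponents add up to the
    sum of the weights. *)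
Lemma layer_cover S : upper_closed S -> forall eta, 0 < eta ->
  exists2 C, 0 <= C & forall M, 1 <= M -> exists2 L : seq G,
    (size L)%:R <= C * M `^ (\sum_(i in S) w i) &
    forall x, in_layer S x -> N x <= M -> exists2 h, h \in L & N (h^-1 * x)%g <= eta.
Proof.
have [k] := ubnP #|S|; elim: k S => // k IH S Sk uS eta eta0.
have [S0|/finset.set0Pn[i0 i0S]] := eqVneq S finset.set0.
  exists 1 => // M M1; exists [:: 1%g].
    by rewrite S0 big_set0 powRr0 mulr1.
  move=> x Sx _; exists 1%g; first by rewrite inE.
  rewrite (_ : x = 1%g) ?mulg1 ?invg1 ?N1 ?ltW// -(gc_logK gc x) -gc_exp0; congr ex.
  by apply/rowP => j; rewrite Sx ?S0 ?inE// mxE.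
have [i iS imin] := @arg_minP _ _ _ i0 (mem S) w i0S.
have {}imin j : j \in S -> w i <= w j by exact: imin.
have {}iS : i \in S by exact: iS.
pose S' := S :\ i.
have wS : \sum_(j in S) w j = w i + \sum_(j in S') w j by rewrite (big_setD1 i).
have uS' : upper_closed S'.
  move=> a b; rewrite !inE => /andP[ai aS]; rewrite negb_and negbK => /orP[/eqP ->|bS].
    exact: imin.
  exact: uS.
have S'k : (#|S'| < k)%N by move: Sk; rewrite (cardsD1 i S) iS add1n ltnS.
have eta20 : 0 < eta / 2 by rewrite divr_gt0.
have [C' C'0 IHC] := IH S' S'k uS' _ eta20.
have [m0 m00 mP] := norm_coord_bound.
pose Ne := N (ex 'e_i).
have Ne0 : 0 <= Ne by exact: hn_ge0.
have wi := weight_gt0 i.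
(* A remainder [|s| <= c] has norm at most [eta / 2]; the other half of [eta] is left to the
   covering of the smaller layer. *)
pose c := (eta / (2 * (1 + Ne))) `^ w i.
have c0 : 0 < c by rewrite powR_gt0// divr_gt0// mulr_gt0// ltr_pwDl.
have cP s : `|s| <= c -> N (ex (s *: 'e_i)) <= eta / 2.
  move=> sc; rewrite norm_axis -/Ne.
  have : `|s| `^ (w i)^-1 <= eta / (2 * (1 + Ne)).
    rewrite (@le_trans _ _ (c `^ (w i)^-1))//.
      by rewrite ge0_ler_powR ?nnegrE// ?invr_ge0 ltW.
    rewrite /c -powRrM mulfV ?gt_eqF// powRr1// divr_ge0 ?(ltW eta0)// mulr_ge0//.
    by rewrite addr_ge0.
  move=> h; rewrite (le_trans (ler_wpM2r Ne0 h))//.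
  have Ne1 : 0 < 1 + Ne by rewrite ltr_pwDl.
  rewrite (_ : _ * Ne = eta / 2 * (Ne / (1 + Ne))); last by field; rewrite gt_eqF.
  by rewrite ler_piMr ?(ltW eta20)// ler_pdivrMr// mul1r lerDr.
(* [B1 * M * Ne] bounds the norm of the multiple of the mesh, whence [B2 * M] for [x']; and
   [K1 * M ^ w i] bounds the integer in front of [c]. *)
pose B1 := ((m0^-1) `^ w i + c) `^ (w i)^-1.
pose B2 := B1 * Ne + 1 + eta / 2.
have B10 : 0 <= B1 by exact: powR_ge0.
have B21 : 1 <= B2 by rewrite /B2 addrAC lerDr addr_ge0// ?mulr_ge0// ltW.
pose K1 := (m0^-1) `^ w i / c + 1.
exists (2 * (K1 + 1) * (C' * B2 `^ (\sum_(j in S') w j))) => [|M M1].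
  by rewrite !mulr_ge0 ?powR_ge0// ?addr_ge0// ?divr_ge0 ?powR_ge0 ?(ltW c0).
have M0 : 0 <= M by exact: le_trans M1.
have [|L' sL' L'P] := IHC (B2 * M); first by rewrite mulr_ege1.
have Mw1 : 1 <= M `^ w i by rewrite (le_trans M1)// le1r_powR// gc_weight_ge1.
pose J := Num.truncn (M `^ w i * K1).
pose ints := [seq Posz a | a <- iota 0 J.+1] ++ [seq - Posz a | a <- iota 0 J.+1].
exists [seq (ex ((k%:~R * c) *: 'e_i) * h)%g | k <- ints, h <- L'].
  have Mn0 : M != 0 by rewrite gt_eqF// (lt_le_trans ltr01).
  rewrite size_allpairs natrM wS powRD ?Mn0 ?implybT//.
  have e2 : (B2 * M) `^ (\sum_(j in S') w j) =
      B2 `^ (\sum_(j in S') w j) * M `^ (\sum_(j in S') w j).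
    by rewrite powRM// (le_trans ler01).
  rewrite e2 in sL'.
  have sI : (size ints)%:R <= 2 * (K1 + 1) * M `^ w i.
    rewrite size_cat !size_map size_iota addnn -muln2 natrM mulrC -mulrA ler_wpM2l// -addn1 natrD.
    rewrite mulrDl mul1r lerD// mulrC truncn_le mulr_ge0 ?powR_ge0//.
    by rewrite addr_ge0// divr_ge0 ?powR_ge0// ltW.
  rewrite [leRHS](_ : _ = (2 * (K1 + 1) * M `^ w i) *
    (C' * (B2 `^ (\sum_(j in S') w j) * M `^ (\sum_(j in S') w j)))); last by ring.
  by rewrite ler_pM.
move=> x Sx xM.
set t := xi x ord0 i.
have tM : `|t| <= M `^ w i * (m0^-1) `^ w i.
  rewrite -powRM ?invr_ge0 ?(ltW m00)// (le_trans (mP x i))//.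
  by rewrite ge0_ler_powR ?nnegrE ?(ltW wi)// ?divr_ge0 ?hn_ge0 ?(ltW m00)// ler_wpM2r// invr_ge0 ltW.
pose kk := Num.floor (t / c).
pose s := t - kk%:~R * c.
have s0 : 0 <= s by rewrite subr_ge0 -ler_pdivlMr// floor_le.
have sc : s < c.
  have := Num.Theory.floorD1_gt (t / c).
  by rewrite ltr_pdivrMr// intrD mulrDl mul1r /s ltrBlDr addrC.
have kc : `|kk%:~R * c| <= M `^ w i * ((m0^-1) `^ w i + c).
  rewrite (_ : _ * c = t - s); last by rewrite /s; ring.
  rewrite (le_trans (ler_normB _ _))// mulrDr lerD// ger0_norm// (le_trans (ltW sc))//.
  by rewrite ler_peMl// ltW.
have kints : kk \in ints.
  have kJ : (`|kk| <= J)%N.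
    have K0 : 0 <= M `^ w i * K1.
      by rewrite mulr_ge0 ?powR_ge0// addr_ge0// divr_ge0 ?powR_ge0// ltW.
    rewrite truncn_ge_nat// natr_absz intr_norm -(ler_pM2r c0) -{1}(gtr0_norm c0) -normrM.
    rewrite (le_trans kc)// /K1 -mulrA mulrDl mul1r divfK ?gt_eqF//.
  rewrite mem_cat; apply/orP; case: (intP kk) kJ => [|m|m] mJ.
  - by left; apply/mapP; exists 0%N.
  - by left; apply/mapP; exists m.+1 => //; rewrite mem_iota.
  - by right; apply/mapP; exists m.+1 => //; rewrite mem_iota.
(* The remainder stands on the right, where it adds at most [eta / 2] to the distance. To the left
   of [x'] it would get conjugated by an element of unbounded norm. *)
pose x' := ((ex ((kk%:~R * c) *: 'e_i))^-1 * x * (ex (s *: 'e_i))^-1)%g.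
have Sx' : in_layer S' x'.
  have S1 : in_layer S ((ex ((kk%:~R * c) *: 'e_i))^-1)%g by rewrite -gc_expN -scaleNr; exact: in_layer_axis.
  have S2 : in_layer S ((ex (s *: 'e_i))^-1)%g by rewrite -gc_expN -scaleNr; exact: in_layer_axis.
  have S12 := in_layerM uS S1 Sx.
  move=> j; rewrite !inE negb_and negbK => /orP[/eqP ->|jS].
    rewrite !(@low_coord_mul S i)// -!gc_expN !gc_expK !mxE !eqxx /= !mulr1 -/t /s.
    by ring.
  exact: (in_layerM uS S12 S2).
have Nx' : N x' <= B2 * M.
  rewrite (le_trans (hn_mul hN _ _))// (hn_inv hN).
  rewrite (le_trans (lerD (hn_mul hN _ _) (lexx _)))// (hn_inv hN) /B2 !mulrDl mul1r.
  rewrite lerD ?lerD//; last first.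
    by rewrite (le_trans (cP s _)) ?ger0_norm ?(ltW sc)// ler_peMr// ltW.
  rewrite norm_axis -/Ne mulrAC ler_wpM2r//.
  rewrite (@le_trans _ _ ((M `^ w i * ((m0^-1) `^ w i + c)) `^ (w i)^-1))//.
    by rewrite ge0_ler_powR ?nnegrE// ?invr_ge0 ?(ltW wi)// ?mulr_ge0 ?powR_ge0// addr_ge0 ?powR_ge0// ltW.
  rewrite powRM ?powR_ge0// ?addr_ge0 ?powR_ge0 ?(ltW c0)// -powRrM mulfV ?gt_eqF// powRr1//.
  by rewrite mulrC.
have [h hL' hx'] := L'P _ Sx' Nx'.
exists (ex ((kk%:~R * c) *: 'e_i) * h)%g.
  by apply/allpairsP; exists (kk, h).
have -> : ((ex ((kk%:~R * c) *: 'e_i) * h)^-1 * x = (h^-1 * x') * ex (s *: 'e_i))%g.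
  by rewrite /x' invgM !mulgA mulgVK.
rewrite (le_trans (hn_mul hN _ _))// [leRHS]splitr lerD//.
by rewrite cP// ger0_norm// ltW.
Qed.

Lemma norm_ball_cover eta : 0 < eta ->
  exists2 C, 0 <= C & forall M, 1 <= M -> exists2 L : seq G,
    (size L)%:R <= C * M `^ hom_dim G &
    forall x, N x <= M -> exists2 h, h \in L & N (h^-1 * x)%g <= eta.
Proof.
move=> eta0.
have uT : upper_closed [set: 'I_n]%SET by move=> i j _; rewrite inE.
have [C C0 CP] := layer_cover uT eta0.
exists C => // M M1; have [L sL LP] := CP M M1.
exists L; last by move=> x; apply: LP => j; rewrite inE.
rewrite -(gc_weight_sum gc) (le_trans sL)// le_eqVlt; apply/orP; left; apply/eqP.
by congr (_ * _ `^ _); apply: eq_bigl => i; rewrite inE.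
Qed.

End Growth.

(** * Points of relatively separated sets in balls *)

Section Counting.
Variables (R : realType) (G : homogeneousGroup R) (N : G -> R).
Hypothesis hN : homogeneous_norm N.

Lemma card_le_seq (T : choiceType) (A : set T) k (s : seq T) : (A #<= `I_k)%card ->
  uniq s -> (forall x, x \in s -> A x) -> (size s <= k)%N.
Proof.
move=> Ak us sA; have fA : finite_set A by apply/finite_set_leP; exists k.
apply: leq_trans (geq_card_fset_set Ak); apply: uniq_leq_size => // x xs.
by rewrite in_fset_set// inE; exact: sA.
Qed.

Lemma size_le_cover (T : eqType) (U : eqType) (P : U -> pred T) k (s : seq T) (L : seq U) :
  (forall x, x \in s -> exists2 h, h \in L & P h x) ->
  (forall h, (count (P h) s <= k)%N) -> (size s <= k * size L)%N.
Proof.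
elim: L s => [|h L IH] s sL Pk.
  by case: s sL Pk => // x s /(_ x) + _; rewrite inE eqxx => /(_ isT)[].
rewrite /= mulnS -(count_predC (P h) s) leq_add// -size_filter IH// => [x|h'].
  rewrite mem_filter /= => /andP[nP /sL[h']]; rewrite inE => /predU1P[->|? ?].
    by rewrite (negbTE nP).
  by exists h'.
by rewrite (leq_trans _ (Pk h'))// count_filter; apply: sub_count => x /= /andP[].
Qed.

(** The covering balls are closed, those of [relatively_separated] open of radius 1; hence the
    radius 1/2. *)
Lemma ball_count (L : set G) : relatively_separated N L ->
  exists2 C, 0 <= C & forall M x (s : seq L), 1 <= M -> uniq s ->
    (forall l, l \in s -> N (x^-1 * val l)%g <= M) -> (size s)%:R <= C * M `^ hom_dim G.
Proof.
move=> [k kP]; have [gc _] := exists_graded_chart G.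
have h2 : 0 < 2^-1 :> R by rewrite invr_gt0.
have [C C0 CP] := norm_ball_cover gc hN h2.
exists (k%:R * C) => [|M x s M1 us sM]; first by rewrite mulr_ge0.
have [L0 sL0 L0P] := CP M M1.
have : (size s <= k * size L0)%N.
  pose P (h : G) : pred L := fun l => N (h^-1 * (x^-1 * val l))%g <= 2^-1.
  apply: (@size_le_cover _ _ P) => [l ls|h].
    by have [h hL ?] := L0P _ (sM l ls); exists h.
  rewrite -size_filter -(size_map val).
  apply: (card_le_seq (kP (x * h)%g)).
    by rewrite map_inj_uniq ?filter_uniq//; exact: val_inj.
  move=> _ /mapP[l + ->]; rewrite mem_filter => /andP[Pl _]; split.
    exact/set_mem/valP.
  by rewrite /hball /= invgM -mulgA (le_lt_trans Pl)// invf_lt1// ltr1n.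
move=> le; have {}le : (size s)%:R <= (k * size L0)%:R :> R by rewrite ler_nat.
apply: (le_trans le); rewrite natrM.
by rewrite -mulrA ler_wpM2l.
Qed.

Lemma geometric_sum_le (q : R) k : 0 <= q < 1 -> \sum_(i < k) q ^+ i <= (1 - q)^-1.
Proof.
move=> /andP[q0 q1]; rewrite -[leRHS]mul1r ler_pdivlMr ?subr_gt0//.
by rewrite mulrC -opprB mulNr -subrX1 opprB lerBlDr lerDl exprn_ge0//.
Qed.

(** Dyadic shells: where [1 + d] lies between [2 ^ j] and [2 ^ (j + 1)] there are O(2 ^ (j Q))
    points, each of weight at most [2 ^ (- j k)]. The sum is dominated by a geometric series of
    ratio [q = 2 ^ (Q - k)]. *)
Lemma weight_sum_bound (L : set G) (k : nat) : relatively_separated N L ->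
  hom_dim G < k%:R ->
  exists2 K, 0 <= K & forall x (s : seq L), uniq s ->
    \sum_(l <- s) ((1 + N (x^-1 * val l)%g) ^+ k)^-1 <= K.
Proof.
move=> sL Qk; have [C C0 CP] := ball_count sL.
pose q := 2 `^ (hom_dim G - k%:R) : R.
have q01 : 0 <= q < 1.
  rewrite powR_ge0 /= /q /powR gt_eqF// -[ltRHS]expR0 ltr_expR.
  by rewrite pmulr_llt0 ?subr_lt0// ln_gt0// ltr1n.
exists (C * 2 `^ hom_dim G * (1 - q)^-1) => [|x s us].
  by rewrite !mulr_ge0 ?powR_ge0// invr_ge0 subr_ge0; case/andP: q01 => _ /ltW.
pose d (l : L) := N (x^-1 * val l)%g.
have d0 l : 0 <= d l by exact: hn_ge0.
pose lev l := trunc_log 2 (Num.truncn (1 + d l)).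
have levl l : 2 ^+ lev l <= 1 + d l.
  rewrite -natrX (@le_trans _ _ (Num.truncn (1 + d l))%:R)//.
    rewrite ler_nat trunc_logP// truncn_gt0 lerDl d0//.
  by rewrite truncn_le addr_ge0.
have levu l : 1 + d l <= 2 ^+ (lev l).+1.
  rewrite (@le_trans _ _ (Num.truncn (1 + d l)).+1%:R)//.
    by rewrite ltW// truncnS_gt.
  by rewrite -natrX ler_nat trunc_log_ltn.
(* [B] only turns the index of the shell into an ordinal to partition by; the final bound is free of
   it. *)
pose B := (\max_(l <- s) lev l).
have levB l : l \in s -> (lev l <= B)%N by move=> ls; rewrite /B (leq_bigmax_seq _ ls).
rewrite (partition_big (fun l => inord (lev l) : 'I_B.+1) xpredT)//=.
rewrite (@le_trans _ _ (\sum_(j < B.+1) C * 2 `^ hom_dim G * q ^+ j))//; last first.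
  rewrite -mulr_sumr ler_wpM2l ?mulr_ge0 ?powR_ge0//; exact: geometric_sum_le.
apply: ler_sum => j _.
pose t := [seq l <- s | lev l == j].
have -> : \sum_(l <- s | inord (lev l) == j) ((1 + N (x^-1 * val l)%g) ^+ k)^-1 =
    \sum_(l <- t) ((1 + d l) ^+ k)^-1.
  rewrite big_filter big_seq_cond [RHS]big_seq_cond; apply: eq_bigl => l.
  by case ls: (l \in s) => //=; rewrite -val_eqE /= inordK// ltnS levB.
rewrite (@le_trans _ _ (\sum_(l <- t) (2 ^+ j ^+ k)^-1))//.
  rewrite big_seq [leRHS]big_seq; apply: ler_sum => l.
  rewrite mem_filter => /andP[/eqP <- _].
  by rewrite lef_pV2 ?posrE ?exprn_gt0// ?ltr_wpDr// lerXn2r ?nnegrE ?addr_ge0 ?exprn_ge0.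
rewrite big_const_seq count_predT iter_addr_0 -[_ *+ size t]mulr_natl.
have : (size t)%:R <= C * (2 ^+ j.+1) `^ hom_dim G.
  apply: (CP _ x); rewrite ?filter_uniq// ?exprn_ege1 ?ler1n//.
  move=> l; rewrite mem_filter => /andP[/eqP <- _].
  by rewrite (le_trans _ (levu l))// lerDr.
move=> h; rewrite (@le_trans _ _ (C * (2 ^+ j.+1) `^ hom_dim G * (2 ^+ j ^+ k)^-1))//.
  by rewrite ler_wpM2r// invr_ge0 !exprn_ge0.
rewrite exprS powRM ?exprn_ge0// -!mulrA ler_wpM2l// ler_wpM2l ?powR_ge0//.
have -> : q ^+ j = (2 ^+ j) `^ hom_dim G * (2 ^+ j ^+ k)^-1.
  rewrite -exprM -[q ^+ j]powR_mulrn ?powR_ge0// -!powR_mulrn//.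
  rewrite -!powRrM -powRN -powRD ?pnatr_eq0 ?implybT//; congr (_ `^ _).
  by rewrite natrM; ring.
by [].
Qed.
End Counting.

(** * Sequence spaces and unconditional sums *)

Section Esum.
Variable R : realType.
Local Open Scope ereal_scope.

Lemma esum_le_seq (I : choiceType) (f : I -> \bar R) B :
  (forall s : seq I, uniq s -> \sum_(i <- s) f i <= B) -> esum [set: I] f <= B.
Proof.
move=> h; apply: ge_ereal_sup => _ [X [finX _] <-].
by rewrite fsbig_finite//; exact/h/finmap.fset_uniq.
Qed.

Lemma esum_ge_seq (I : choiceType) (f : I -> \bar R) (s : seq I) :
  uniq s -> \sum_(i <- s) f i <= esum [set: I] f.
Proof. by move=> us; apply: esum_ge; exists [set` s] => //; rewrite fsbig_seq. Qed.

Lemma esum_ge_term (I : choiceType) (f : I -> \bar R) i :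
  f i <= esum [set: I] f.
Proof. by have := @esum_ge_seq I f [:: i] isT; rewrite big_seq1. Qed.

Lemma esumZl (I : choiceType) (k : R) (f : I -> \bar R) : (0 <= k)%R ->
  (forall i, 0 <= f i) -> esum [set: I] (fun i => k%:E * f i) = k%:E * esum [set: I] f.
Proof.
move=> k0 f0.
have le (l : R) (g : I -> \bar R) : (0 <= l)%R -> (forall i, 0 <= g i) ->
    esum [set: I] (fun i => l%:E * g i) <= l%:E * esum [set: I] g.
  move=> l0 g0; apply: esum_le_seq => s us.
  by rewrite -ge0_sume_distrr// lee_wpmul2l// esum_ge_seq.
have [->|kn0] := eqVneq k 0%R.
  by rewrite mul0e esum1// => i _; rewrite mul0e.
apply/eqP; rewrite eq_le le//=.
have kk (x : \bar R) : k^-1%:E * (k%:E * x) = x.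
  by rewrite muleA -EFinM mulVf// mul1e.
have kf i : 0 <= k%:E * f i by rewrite mule_ge0.
have := le k^-1%R (fun i => k%:E * f i); rewrite invr_ge0 => /(_ k0 kf) h.
rewrite -[leRHS](_ : k%:E * (k^-1%:E * esum [set: I] (fun i => k%:E * f i)) = _); last first.
  by rewrite muleA -EFinM mulfV// mul1e.
rewrite lee_wpmul2l//; apply: le_trans h; apply: le_esum => i _; by rewrite kk.
Qed.

Lemma esum_exchange (I J : choiceType) (a : I -> J -> \bar R) : (forall i j, 0 <= a i j) ->
  esum [set: I] (fun i => esum [set: J] (a i)) =
  esum [set: J] (fun j => esum [set: I] (fun i => a i j)).
Proof.
move=> a0; rewrite !esum_esum//.
rewrite (@reindex_esum _ _ _ ([set: J] `*`` (fun=> [set: I])) _ (fun x => (x.2, x.1)))//.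
split=> //= [x y _ _ [] e1 e2|[i j] _]; last by exists (j, i).
by rewrite [x]surjective_pairing [y]surjective_pairing e1 e2.
Qed.

Lemma poweRD_le2 (x y : \bar R) (r : R) : 0 <= x -> 0 <= y -> (0 < r)%R ->
  (x + y) `^ r <= (2 `^ r)%:E * (x `^ r + y `^ r).
Proof.
move=> x0 y0 r0.
wlog xy : x y x0 y0 / x <= y => [H|].
  by have [/H->//|/ltW/H] := leP x y; rewrite addeC [y `^ r + _]addeC; apply.
apply: (@le_trans _ _ ((2%:E * y) `^ r)).
  apply: gt0_ler_poweR; rewrite ?in_itv /= ?leey ?adde_ge0 ?mule_ge0 ?(ltW r0)//.
  by rewrite -[2%R]/(1 + 1)%R EFinD ge0_muleDl// mul1e leeD2r.
by rewrite poweRM// poweR_EFin lee_wpmul2l ?lee_fin ?powR_ge0// leeDr ?poweR_ge0.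
Qed.

End Esum.

Section SequenceNorm.
Variable R : realType.

Definition lnorm (I : choiceType) (p : \bar R) (f : I -> R) : \bar R :=
  match p with
  | r%:E => ((\esum_(i in [set: I]) (f i `^ r)%:E) `^ r^-1)%E
  | +oo%E => ereal_sup (0%E |` [set (f i)%:E | i in [set: I]])
  | -oo%E => 0%E
  end.

Lemma ell_normE (I : choiceType) p (c : I -> R[i]) :
  ell_norm p c = lnorm p (fun i => cabs (c i)).
Proof. by case: p. Qed.

Section Lnorm.
Variable p : \bar R.
Hypothesis p1 : (1 <= p)%E.

Lemma exponentP (P : \bar R -> Prop) : (forall r : R, 1 <= r -> P r%:E) -> P +oo%E -> P p.
Proof. by move=> Pr Py; case: p p1 => [r| |]//; rewrite lee_fin => /Pr. Qed.

Lemma lnorm_ge0 (I : choiceType) (f : I -> R) : (0 <= lnorm p f)%E.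
Proof.
apply: (exponentP (P := fun p => 0 <= lnorm p f)%E) => [r r1|]; first exact: poweR_ge0.
by apply: ereal_sup_ubound; left.
Qed.

Lemma lnorm_le (I : choiceType) (f g : I -> R) : (forall i, 0 <= f i <= g i) ->
  (lnorm p f <= lnorm p g)%E.
Proof.
move=> fg; apply: (exponentP (P := fun p => lnorm p f <= lnorm p g)%E) => [r r1|].
  have r0 : 0 < r by exact: lt_le_trans r1.
  apply: gt0_ler_poweR; rewrite ?in_itv /= ?leey ?invr_ge0 ?(ltW r0)//.
  - by rewrite esum_ge0// => i _; rewrite lee_fin powR_ge0.
  - by rewrite esum_ge0// => i _; rewrite lee_fin powR_ge0.
  apply: le_esum => i _; have /andP[f0 fgi] := fg i.
  by rewrite lee_fin ge0_ler_powR ?nnegrE ?(ltW r0)// (le_trans f0).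
apply: ge_ereal_sup => _ [->|[i _ <-]]; first by apply: ereal_sup_ubound; left.
have /andP[f0 fgi] := fg i; apply: (@le_trans _ _ (g i)%:E); first by rewrite lee_fin.
by apply: ereal_sup_ubound; right; exists i.
Qed.

(** A triangle inequality up to a factor uniform in [p] is enough, which avoids Minkowski. One
    factor 2 is [(2 ^ r) ^ (1 / r)], the other one bounds [2 ^ (1 / r)]. *)
Lemma lnormD (I : choiceType) (f g : I -> R) : (forall i, 0 <= f i) -> (forall i, 0 <= g i) ->
  (lnorm p (fun i => f i + g i)%R <= 4%:E * (lnorm p f + lnorm p g))%E.
Proof.
move=> f0 g0; apply: (exponentP (P := fun p => lnorm p _ <= _ * (lnorm p f + lnorm p g))%E) => [r r1|].
  have r0 : 0 < r by exact: lt_le_trans r1.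
  rewrite /lnorm; set F := esum _ _; set F1 := esum _ _; set G1 := esum _ _.
  have F10 : (0 <= F1)%E by rewrite esum_ge0// => i _; rewrite lee_fin powR_ge0.
  have G10 : (0 <= G1)%E by rewrite esum_ge0// => i _; rewrite lee_fin powR_ge0.
  have F0 : (0 <= F)%E by rewrite esum_ge0// => i _; rewrite lee_fin powR_ge0.
  have le1 : (F <= (2 `^ r)%:E * (F1 + G1))%E.
    rewrite -esumD => [|i _|i _]; try by rewrite lee_fin powR_ge0.
    rewrite -esumZl ?powR_ge0// => [|i]; last by rewrite adde_ge0 ?lee_fin ?powR_ge0.
    apply: le_esum => i _.
    by have := @poweRD_le2 R (f i)%:E (g i)%:E r; rewrite !lee_fin f0 g0 r0; apply.
  apply: (@le_trans _ _ (((2 `^ r)%:E * (F1 + G1)) `^ r^-1)%E).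
    apply: gt0_ler_poweR; rewrite ?in_itv /= ?leey ?F0 ?invr_ge0 ?(ltW r0)//.
    by rewrite mule_ge0 ?lee_fin ?powR_ge0// adde_ge0.
  rewrite poweRM ?lee_fin ?powR_ge0 ?adde_ge0//.
  rewrite poweR_EFin -powRrM mulfV ?gt_eqF// powRr1//.
  rewrite (_ : 4%:E = 2%:E * 2%:E)%E; last by rewrite -EFinM; congr EFin; ring.
  rewrite -muleA lee_wpmul2l// (le_trans (poweRD_le2 F10 G10 _)) ?invr_gt0//.
  rewrite lee_wpmul2r ?adde_ge0 ?poweR_ge0// lee_fin.
  by rewrite ler1_powR ?ler1n// invf_le1.
apply: ge_ereal_sup => _ [->|[i _ <-]].
  by rewrite mule_ge0// adde_ge0//; apply: ereal_sup_ubound; left.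
rewrite EFinD (@le_trans _ _ (lnorm +oo f + lnorm +oo g)%E)//.
  by rewrite leeD//; apply: ereal_sup_ubound; right; exists i.
rewrite -[leLHS]mul1e lee_wpmul2r ?lee_fin ?ler1n//.
by rewrite adde_ge0//; apply: ereal_sup_ubound; left.
Qed.

Lemma lnorm_ge_term (I : choiceType) (f : I -> R) i : (forall i, 0 <= f i) ->
  ((f i)%:E <= lnorm p f)%E.
Proof.
move=> f0; apply: (exponentP (P := fun p => _ <= lnorm p f)%E) => [r r1|].
  have r0 : 0 < r by exact: lt_le_trans r1.
  rewrite (_ : (f i)%:E = ((f i `^ r)%:E `^ r^-1)%E); last first.
    by rewrite poweR_EFin -powRrM mulfV ?gt_eqF// powRr1.
  apply: gt0_ler_poweR; rewrite ?in_itv /= ?leey ?lee_fin ?powR_ge0 ?invr_ge0 ?(ltW r0)//.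
    by rewrite esum_ge0// => j _; rewrite lee_fin powR_ge0.
  exact: (esum_ge_term (fun i => (f i `^ r)%:E)).
by apply: ereal_sup_ubound; right; exists i.
Qed.

(** Every term is at most the total [t], so [f i ^ r <= t ^ (r - 1) * f i]. *)
Lemma lnorm_le_l1 (I : choiceType) (f : I -> R) : (forall i, 0 <= f i) ->
  (lnorm p f <= esum [set: I] (fun i => (f i)%:E))%E.
Proof.
move=> f0; set T := esum _ _.
have T0 : (0 <= T)%E by rewrite esum_ge0// => i _; rewrite lee_fin.
have fT i : ((f i)%:E <= T)%E by exact: (esum_ge_term (fun i => (f i)%:E)).
apply: (exponentP (P := fun p => lnorm p f <= _)%E) => [r r1|]; last first.
  by apply: ge_ereal_sup => _ [->|[i _ <-]].
have r0 : 0 < r by exact: lt_le_trans r1.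
have [Ty|Ty] := eqVneq T +oo%E; first by rewrite Ty leey.
have [t tE t0] : exists2 t, T = t%:E & 0 <= t.
  exists (fine T); rewrite ?fine_ge0// fineK// fin_numE Ty andbT.
  by rewrite gt_eqF// (lt_le_trans _ T0)// ltNyr.
rewrite (_ : T = ((t `^ r)%:E `^ r^-1)%E); last first.
  by rewrite poweR_EFin -powRrM mulfV ?gt_eqF// powRr1.
apply: gt0_ler_poweR; rewrite ?in_itv /= ?leey ?lee_fin ?powR_ge0 ?invr_ge0 ?(ltW r0)//.
  by rewrite esum_ge0// => i _; rewrite lee_fin powR_ge0.
rewrite -(mulr_powRB1 t0 r0) mulrC EFinM -tE -esumZl ?powR_ge0//.
apply: le_esum => i _; rewrite -(mulr_powRB1 (f0 i) r0) mulrC -EFinM lee_fin.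
rewrite ler_wpM2r// ge0_ler_powR ?nnegrE ?subr_ge0//.
by have := fT i; rewrite tE lee_fin.
Qed.

(* Splitting [f <= tau + f ^ r * tau ^ (1 - r)] at the level [tau = g j / (2 S)]
   replaces Jensen's inequality, at the cost of a factor 2. *)
Lemma schur_test (I J : choiceType) (m : J -> I -> R) (S : R) (f : I -> R) (g : J -> R) :
  0 < S -> (forall j i, 0 <= m j i) -> (forall i, 0 <= f i) -> (forall j, 0 <= g j) ->
  (forall j, esum [set: I] (fun i => (m j i)%:E) <= S%:E)%E ->
  (forall i, esum [set: J] (fun j => (m j i)%:E) <= S%:E)%E ->
  (forall j, (g j)%:E <= esum [set: I] (fun i => (m j i * f i)%:E))%E ->
  (lnorm p g <= (2 * S)%:E * lnorm p f)%E.
Proof.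
move=> S0 m0 f0 g0 rowS colS gP.
apply: (exponentP (P := fun p => lnorm p g <= _ * lnorm p f)%E) => [r r1|]; last first.
  apply: ge_ereal_sup => _ [->|[j _ <-]].
    by rewrite mule_ge0 ?lee_fin ?mulr_ge0 ?(ltW S0)//; apply: ereal_sup_ubound; left.
  set T := lnorm _ _.
  have T0 : (0 <= T)%E by apply: ereal_sup_ubound; left.
  have fT i : ((f i)%:E <= T)%E by apply: ereal_sup_ubound; right; exists i.
  have [Ty|Ty] := eqVneq T +oo%E; first by rewrite Ty gt0_muley ?leey// lte_fin mulr_gt0.
  have [t tE t0] : exists2 t, T = t%:E & 0 <= t.
    exists (fine T); rewrite ?fine_ge0// fineK// fin_numE Ty andbT.
    by rewrite gt_eqF// (lt_le_trans _ T0)// ltNyr.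
  rewrite (le_trans (gP j))// (@le_trans _ _ (t%:E * S%:E)%E)//; last first.
    by rewrite tE -!EFinM lee_fin mulrC ler_wpM2r// ler_peMl ?ler1n// ltW.
  apply: le_trans (lee_wpmul2l _ (rowS j)); rewrite ?lee_fin// -esumZl// => [|i]; last by rewrite lee_fin.
  apply: le_esum => i _; rewrite -EFinM lee_fin mulrC ler_wpM2r//.
  by have := fT i; rewrite tE lee_fin.
have r0 : 0 < r by exact: lt_le_trans r1.
pose B j := esum [set: I] (fun i => (m j i * f i `^ r)%:E).
have B0 j : (0 <= B j)%E by rewrite esum_ge0// => i _; rewrite lee_fin mulr_ge0 ?powR_ge0.
pose k := (2 * S) `^ r / S.
have k0 : 0 < k by rewrite divr_gt0// powR_gt0// mulr_gt0.
have gB j : ((g j `^ r)%:E <= k%:E * B j)%E.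
  have [->|gj0] := eqVneq (g j) 0; first by rewrite powR0 ?gt_eqF// mule_ge0// lee_fin ltW.
  have gj : 0 < g j by rewrite lt_neqAle eq_sym gj0 g0.
  have [By|By] := eqVneq (B j) +oo%E; first by rewrite By gt0_muley ?leey// lte_fin.
  have [b bE b0] : exists2 b, B j = b%:E & 0 <= b.
    exists (fine (B j)); rewrite ?fine_ge0// fineK// fin_numE By andbT.
    by rewrite gt_eqF// (lt_le_trans _ (B0 j))// ltNyr.
  pose tau := g j / (2 * S).
  have tau0 : 0 < tau by rewrite divr_gt0// mulr_gt0.
  have gE : g j = 2 * S * tau by rewrite /tau mulrC divfK// mulf_neq0 ?gt_eqF.
  clearbody tau.
  have young x : 0 <= x -> x <= tau + tau `^ (1 - r) * x `^ r.
    move=> x0; have [xt|tx] := leP x tau.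
      by rewrite (le_trans xt)// lerDl mulr_ge0 ?powR_ge0.
    rewrite -[leLHS]add0r lerD ?(ltW tau0)// -[1 - r]opprB powRN.
    rewrite ler_pdivlMl ?powR_gt0// -[leRHS](mulr_powRB1 x0 r0) mulrC ler_wpM2l//.
    by rewrite ge0_ler_powR ?nnegrE ?subr_ge0// ltW.
  have : ((g j)%:E <= (tau * S + tau `^ (1 - r) * b)%:E)%E.
    rewrite (le_trans (gP j))// EFinD !EFinM -bE.
    rewrite (@le_trans _ _ (tau%:E * esum [set: I] (fun i => (m j i)%:E) + (tau `^ (1 - r))%:E * B j)%E)//.
      rewrite -!esumZl ?powR_ge0 ?(ltW tau0)// => [|i|i]; rewrite ?lee_fin ?mulr_ge0 ?powR_ge0//.
      rewrite -esumD => [|i _|i _]; rewrite ?mule_ge0 ?lee_fin ?mulr_ge0 ?powR_ge0 ?(ltW tau0)//.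
      apply: le_esum => i _; rewrite -!EFinM -EFinD lee_fin.
      rewrite [leRHS](_ : _ = m j i * (tau + tau `^ (1 - r) * f i `^ r)); last by ring.
      by rewrite ler_wpM2l// young.
    by rewrite leeD2r// lee_wpmul2l ?lee_fin// ltW.
  rewrite lee_fin => le1.
  have le2 : S * tau <= tau `^ (1 - r) * b by move: le1; rewrite {1}gE; lra.
  have le3 : S * tau `^ r <= b.
    move: le2; rewrite -[1 - r]opprB powRN ler_pdivlMl ?powR_gt0//.
    by rewrite mulrCA [_ * tau]mulrC mulr_powRB1// ltW.
  rewrite bE -EFinM lee_fin gE powRM ?mulr_ge0 ?(ltW S0) ?(ltW tau0)//.
  by rewrite /k -mulrA ler_wpM2l ?powR_ge0// ler_pdivlMl.
rewrite /lnorm (_ : (2 * S)%:E = (((2 * S) `^ r)%:E `^ r^-1)%E); last first.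
  by rewrite poweR_EFin -powRrM mulfV ?gt_eqF// powRr1// mulr_ge0// ltW.
rewrite -poweRM ?lee_fin ?powR_ge0//; last first.
  by rewrite esum_ge0// => i _; rewrite lee_fin powR_ge0.
apply: gt0_ler_poweR; rewrite ?in_itv /= ?leey ?invr_ge0 ?(ltW r0)//.
- by rewrite esum_ge0// => i _; rewrite lee_fin powR_ge0.
- rewrite mule_ge0 ?lee_fin ?powR_ge0//.
  by rewrite esum_ge0// => i _; rewrite lee_fin powR_ge0.
apply: le_trans (le_esum (fun j _ => gB j)) _; rewrite esumZl ?(ltW k0)//.
have Bsum : (esum [set: J] B <= S%:E * esum [set: I] (fun i => (f i `^ r)%:E))%E.
  rewrite esum_exchange => [|j i]; last by rewrite lee_fin mulr_ge0 ?powR_ge0.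
  rewrite -esumZl ?(ltW S0)// => [|i]; last by rewrite lee_fin powR_ge0.
  apply: le_esum => i _; under eq_esum do rewrite mulrC EFinM.
  rewrite esumZl ?powR_ge0// => [|j]; last by rewrite lee_fin.
  by rewrite muleC lee_wpmul2r ?lee_fin ?powR_ge0.
rewrite (le_trans (lee_wpmul2l _ Bsum)) ?lee_fin ?(ltW k0)//.
by rewrite muleA -EFinM /k divfK ?gt_eqF.
Qed.

End Lnorm.
End SequenceNorm.

(** * Unconditional sums of real and complex families *)

Section UnconditionalSums.
Variable R : realType.

(** Any splitting into summable nonnegative parts computes the sum, not just that into positive and
    negative parts. Additivity and homogeneity then amount to a choice of splitting. *)
Lemma rsum_diff (I : choiceType) (f g h : I -> R) :
  (forall i, 0 <= g i) -> (forall i, 0 <= h i) -> (forall i, f i = g i - h i) ->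
  (esum [set: I] (fun i => (g i)%:E) < +oo)%E ->
  (esum [set: I] (fun i => (h i)%:E) < +oo)%E ->
  rsum f = fine (esum [set: I] (fun i => (g i)%:E)) - fine (esum [set: I] (fun i => (h i)%:E)).
Proof.
move=> g0 h0 fE gy hy.
have sg : summable [set: I] (EFin \o g).
  by rewrite /summable (eq_esum (b := EFin \o g))// => i _; rewrite /= ger0_norm.
have sh : summable [set: I] (EFin \o h).
  by rewrite /summable (eq_esum (b := EFin \o h))// => i _; rewrite /= ger0_norm.
have := esumB sg sh; rewrite /rsum.
have -> : EFin \o f = ((EFin \o g) \- (EFin \o h))%E.
  by apply/funext => i; rewrite /= fE.
move=> -> => [|i _|i _]; rewrite ?lee_fin//.
rewrite fineB// ge0_fin_numE// esum_ge0// => i _; by rewrite lee_fin.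
Qed.

Let pos (x : R) := Num.max x 0.
Let neg (x : R) := Num.max (- x) 0.

Let pos_ge0 x : 0 <= pos x. Proof. by rewrite le_max lexx orbT. Qed.
Let neg_ge0 x : 0 <= neg x. Proof. by rewrite le_max lexx orbT. Qed.
Let pos_neg x : x = pos x - neg x.
Proof. by rewrite /pos /neg; case: (leP x 0) => h; case: (leP (- x) 0) => h'; lra. Qed.
Let abs_pos_neg x : `|x| = pos x + neg x.
Proof. by rewrite /pos /neg; case: (ger0P x) => h; case: (leP x 0) => h1; case: (leP (- x) 0) => h'; lra. Qed.

Definition abs_summable (I : choiceType) (f : I -> R) :=
  (esum [set: I] (fun i => `|f i|%:E) < +oo)%E.

Lemma abs_summable_le (I : choiceType) (f g : I -> R) :
  (forall i, `|f i| <= `|g i|) -> abs_summable g -> abs_summable f.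
Proof. by move=> fg; apply: le_lt_trans; apply: le_esum => i _; rewrite lee_fin. Qed.

Let pos_sum (I : choiceType) (f : I -> R) : abs_summable f ->
  (esum [set: I] (fun i => (pos (f i))%:E) < +oo)%E.
Proof.
apply: le_lt_trans; apply: le_esum => i _; by rewrite lee_fin abs_pos_neg lerDl.
Qed.

Let neg_sum (I : choiceType) (f : I -> R) : abs_summable f ->
  (esum [set: I] (fun i => (neg (f i))%:E) < +oo)%E.
Proof.
apply: le_lt_trans; apply: le_esum => i _; by rewrite lee_fin abs_pos_neg lerDr.
Qed.

Lemma rsumE (I : choiceType) (f : I -> R) : abs_summable f ->
  rsum f = fine (esum [set: I] (fun i => (pos (f i))%:E)) -
           fine (esum [set: I] (fun i => (neg (f i))%:E)).
Proof. by move=> sf; apply: rsum_diff => //; [exact: pos_sum | exact: neg_sum]. Qed.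

Let esum_finD (I : choiceType) (f g : I -> R) : (forall i, 0 <= f i) -> (forall i, 0 <= g i) ->
  (esum [set: I] (fun i => (f i)%:E) < +oo)%E -> (esum [set: I] (fun i => (g i)%:E) < +oo)%E ->
  (esum [set: I] (fun i => (f i + g i)%:E) < +oo)%E /\
  fine (esum [set: I] (fun i => (f i + g i)%:E)) =
  fine (esum [set: I] (fun i => (f i)%:E)) + fine (esum [set: I] (fun i => (g i)%:E)).
Proof.
move=> f0 g0 fy gy; under eq_esum do rewrite EFinD.
rewrite esumD => [|i _|i _]; rewrite ?lee_fin//.
rewrite lte_add_pinfty//; split => //; rewrite fineD// ge0_fin_numE// esum_ge0// => i _; by rewrite lee_fin.
Qed.

Lemma rsum_abs (I : choiceType) (f : I -> R) : abs_summable f ->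
  ((`|rsum f|)%:E <= esum [set: I] (fun i => `|f i|%:E))%E.
Proof.
move=> sf; have [_] := esum_finD (fun i => pos_ge0 (f i)) (fun i => neg_ge0 (f i)) (pos_sum sf) (neg_sum sf).
under eq_esum do rewrite -abs_pos_neg; move=> E.
rewrite -[leRHS]fineK; last by rewrite ge0_fin_numE// esum_ge0// => i _; rewrite lee_fin.
rewrite E lee_fin rsumE// (le_trans (ler_normB _ _))// !ger0_norm//; apply: fine_ge0; apply: esum_ge0 => i _; by rewrite lee_fin.
Qed.

Lemma rsumD (I : choiceType) (f g : I -> R) : abs_summable f -> abs_summable g ->
  rsum (fun i => f i + g i) = rsum f + rsum g.
Proof.
move=> sf sg.
have [sp ep] := esum_finD (fun i => pos_ge0 (f i)) (fun i => pos_ge0 (g i)) (pos_sum sf) (pos_sum sg).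
have [sn en] := esum_finD (fun i => neg_ge0 (f i)) (fun i => neg_ge0 (g i)) (neg_sum sf) (neg_sum sg).
rewrite (@rsum_diff _ _ (fun i => pos (f i) + pos (g i)) (fun i => neg (f i) + neg (g i)))//.
- by rewrite ep en !rsumE//; ring.
- by move=> i; rewrite addr_ge0.
- by move=> i; rewrite addr_ge0.
- by move=> i; rewrite {1}[f i]pos_neg {1}[g i]pos_neg; ring.
Qed.

Lemma rsumN (I : choiceType) (f : I -> R) : abs_summable f ->
  rsum (fun i => - f i) = - rsum f.
Proof.
move=> sf; rewrite (@rsum_diff _ _ (fun i => neg (f i)) (fun i => pos (f i)))//.
- by rewrite rsumE// opprB.
- by move=> i; rewrite {1}[f i]pos_neg opprB.
- exact: neg_sum.
- exact: pos_sum.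
Qed.

Lemma rsumZ (I : choiceType) k (f : I -> R) : abs_summable f ->
  rsum (fun i => k * f i) = k * rsum f.
Proof.
wlog k0 : k f / 0 <= k => [H sf|sf].
  have [/H|k0] := leP 0 k; first exact.
  have sNf : abs_summable (fun i => - f i).
    by apply: abs_summable_le sf => i; rewrite normrN.
  rewrite -[k * rsum f]mulrNN -rsumN// -H ?oppr_ge0 ?ltW//.
  by congr rsum; apply/funext => i; rewrite mulrNN.
have fZ (h : I -> R) : (forall i, 0 <= h i) -> (esum [set: I] (fun i => (h i)%:E) < +oo)%E ->
    (esum [set: I] (fun i => (k * h i)%:E) < +oo)%E /\
    fine (esum [set: I] (fun i => (k * h i)%:E)) = k * fine (esum [set: I] (fun i => (h i)%:E)).
  move=> h0 hy; under eq_esum do rewrite EFinM.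
  rewrite esumZl//; have fh : esum [set: I] (fun i => (h i)%:E) \is a fin_num.
    by rewrite ge0_fin_numE// esum_ge0// => i _; rewrite lee_fin.
  by rewrite fineM//; split => //; rewrite -(fineK fh) -EFinM ltry.
have [sp ep] := fZ _ (fun i => pos_ge0 (f i)) (pos_sum sf).
have [sn en] := fZ _ (fun i => neg_ge0 (f i)) (neg_sum sf).
rewrite (@rsum_diff _ _ (fun i => k * pos (f i)) (fun i => k * neg (f i)))//.
- by rewrite ep en rsumE//; ring.
- by move=> i; rewrite mulr_ge0.
- by move=> i; rewrite mulr_ge0.
- by move=> i; rewrite {1}[f i]pos_neg mulrBr.
Qed.

Lemma rsum_exchange (I J : choiceType) (a : I -> J -> R) :
  (esum [set: I] (fun i => esum [set: J] (fun j => `|a i j|%:E)) < +oo)%E ->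
  rsum (fun i => rsum (a i)) = rsum (fun j => rsum (fun i => a i j)).
Proof.
have key (I1 J1 : choiceType) (b : I1 -> J1 -> R) :
    (esum [set: I1] (fun i => esum [set: J1] (fun j => `|b i j|%:E)) < +oo)%E ->
    rsum (fun i => rsum (b i)) =
    fine (esum [set: I1] (fun i => esum [set: J1] (fun j => (pos (b i j))%:E))) -
    fine (esum [set: I1] (fun i => esum [set: J1] (fun j => (neg (b i j))%:E))).
  move=> sb; have sbi i : abs_summable (b i).
    exact: le_lt_trans (esum_ge_term (fun i => esum [set: J1] (fun j => `|b i j|%:E)) i) sb.
  have fp i : esum [set: J1] (fun j => (pos (b i j))%:E) \is a fin_num.
    by rewrite ge0_fin_numE ?pos_sum// esum_ge0// => j _; rewrite lee_fin.
  have fn i : esum [set: J1] (fun j => (neg (b i j))%:E) \is a fin_num.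
    by rewrite ge0_fin_numE ?neg_sum// esum_ge0// => j _; rewrite lee_fin.
  rewrite (@rsum_diff _ _ (fun i => fine (esum [set: J1] (fun j => (pos (b i j))%:E)))
     (fun i => fine (esum [set: J1] (fun j => (neg (b i j))%:E)))).
  - by congr (fine _ - fine _); apply: eq_esum => i _; rewrite fineK.
  - by move=> i; rewrite fine_ge0// esum_ge0// => j _; rewrite lee_fin.
  - by move=> i; rewrite fine_ge0// esum_ge0// => j _; rewrite lee_fin.
  - by move=> i; rewrite rsumE.
  - apply: le_lt_trans sb; apply: le_esum => i _; rewrite fineK//.
    by apply: le_esum => j _; rewrite lee_fin abs_pos_neg lerDl.
  - apply: le_lt_trans sb; apply: le_esum => i _; rewrite fineK//.
    by apply: le_esum => j _; rewrite lee_fin abs_pos_neg lerDr.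
move=> sa; rewrite !key//; last by rewrite -esum_exchange// => i j; rewrite lee_fin.
by congr (fine _ - fine _); rewrite esum_exchange// => i j; rewrite lee_fin.
Qed.

End UnconditionalSums.

Section ComplexSums.
Variable R : realType.
Implicit Types z u : R[i].

Lemma cabsE z : cabs z = Num.sqrt ((complex.Re z) ^+ 2 + (complex.Im z) ^+ 2).
Proof. by rewrite /cabs normc_def. Qed.

Lemma norm_cabs z : `|z| = (cabs z)%:C%C.
Proof. by rewrite cabsE normc_def. Qed.

Lemma cabs_ge0 z : 0 <= cabs z.
Proof. by rewrite cabsE sqrtr_ge0. Qed.

Lemma cabs0 : cabs (0 : R[i]) = 0.
Proof. by rewrite /cabs normr0. Qed.

Lemma cabsM z u : cabs (z * u) = cabs z * cabs u.
Proof. by apply: complexI; rewrite rmorphM /= -!norm_cabs normrM. Qed.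

Lemma cabsD z u : cabs (z + u) <= cabs z + cabs u.
Proof. by rewrite -lecR rmorphD /= -!norm_cabs ler_normD. Qed.

Lemma cabs_real (k : R) : cabs (k%:C%C) = `|k|.
Proof. by rewrite cabsE /= expr0n /= addr0 sqrtr_sqr. Qed.

Lemma cabs_Re z : `|complex.Re z| <= cabs z.
Proof. by rewrite cabsE -sqrtr_sqr ler_wsqrtr// lerDl sqr_ge0. Qed.

Lemma cabs_Im z : `|complex.Im z| <= cabs z.
Proof. by rewrite cabsE -sqrtr_sqr ler_wsqrtr// lerDr sqr_ge0. Qed.

Lemma cabs_ReIm z : cabs z <= `|complex.Re z| + `|complex.Im z|.
Proof.
case: z => a b /=; have -> : Complex a b = Complex a 0 + Complex 0 b.
  by apply/eqP; rewrite eq_complex /= addr0 add0r !eqxx.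
rewrite (le_trans (cabsD _ _))// !cabsE /= expr0n /= addr0 add0r !sqrtr_sqr//.
Qed.

Definition csummable (I : choiceType) (f : I -> R[i]) :=
  (esum [set: I] (fun i => (cabs (f i))%:E) < +oo)%E.

Lemma csummable_le (I : choiceType) (f g : I -> R[i]) :
  (forall i, cabs (f i) <= cabs (g i)) -> csummable g -> csummable f.
Proof. by move=> fg; apply: le_lt_trans; apply: le_esum => i _; rewrite lee_fin. Qed.

Lemma csummable_Re (I : choiceType) (f : I -> R[i]) : csummable f ->
  abs_summable (fun i => complex.Re (f i)).
Proof. by apply: le_lt_trans; apply: le_esum => i _; rewrite lee_fin cabs_Re. Qed.

Lemma csummable_Im (I : choiceType) (f : I -> R[i]) : csummable f ->
  abs_summable (fun i => complex.Im (f i)).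
Proof. by apply: le_lt_trans; apply: le_esum => i _; rewrite lee_fin cabs_Im. Qed.

(** Real and imaginary parts are bounded separately; the resulting 2 reappears in the kernels of
    [lnorm_matrix_act] and [lnorm_commutator]. *)
Lemma csum_cabs (I : choiceType) (f : I -> R[i]) :
  ((cabs (csum f))%:E <= 2%:E * esum [set: I] (fun i => (cabs (f i))%:E))%E.
Proof.
have [sf|] := ltP (esum [set: I] (fun i => (cabs (f i))%:E)) +oo%E; last first.
  by rewrite leye_eq => /eqP ->; rewrite gt0_muley ?leey.
rewrite (@le_trans _ _ ((`|rsum (fun i => complex.Re (f i))|)%:E +
                      (`|rsum (fun i => complex.Im (f i))|)%:E)%E)//.
  by rewrite -EFinD lee_fin (le_trans (cabs_ReIm _)).
rewrite -[2]/(1 + 1) EFinD ge0_muleDl// mul1e leeD//.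
  apply: le_trans (rsum_abs (csummable_Re sf)) _.
  by apply: le_esum => i _; rewrite lee_fin cabs_Re.
apply: le_trans (rsum_abs (csummable_Im sf)) _.
by apply: le_esum => i _; rewrite lee_fin cabs_Im.
Qed.

Lemma csumD (I : choiceType) (f g : I -> R[i]) : csummable f -> csummable g ->
  csum (fun i => f i + g i) = csum f + csum g.
Proof.
move=> sf sg; rewrite /csum; apply/eqP; rewrite eq_complex /=.
rewrite -(rsumD (csummable_Re sf) (csummable_Re sg)) -(rsumD (csummable_Im sf) (csummable_Im sg)).
by apply/andP; split; apply/eqP; congr rsum; apply/funext => i; case: (f i) (g i) => ? ? [].
Qed.

Lemma csumZ (I : choiceType) z (f : I -> R[i]) : csummable f ->
  csum (fun i => z * f i) = z * csum f.
Proof.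
move=> sf; have sR := csummable_Re sf; have sI := csummable_Im sf.
have sZ k (h : I -> R) : abs_summable h -> abs_summable (fun i => k * h i).
  rewrite /abs_summable => sh; under eq_esum do rewrite normrM EFinM.
  rewrite esumZl//; have fh : esum [set: I] (fun i => `|h i|%:E) \is a fin_num.
    by rewrite ge0_fin_numE// esum_ge0.
  by rewrite -(fineK fh) -EFinM ltry.
case: z => a b; set sr := rsum (fun i => complex.Re (f i)).
set si := rsum (fun i => complex.Im (f i)).
have E1 : rsum (fun i => complex.Re (Complex a b * f i)) = a * sr - b * si.
  transitivity (rsum (fun i => a * complex.Re (f i) + (- b) * complex.Im (f i))).
    by congr rsum; apply/funext => i; case: (f i) => x y /=; rewrite mulNr.
  by rewrite (rsumD (sZ a _ sR) (sZ (- b) _ sI)) (rsumZ a sR) (rsumZ (- b) sI) mulNr.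
have E2 : rsum (fun i => complex.Im (Complex a b * f i)) = a * si + b * sr.
  transitivity (rsum (fun i => a * complex.Im (f i) + b * complex.Re (f i))).
    by congr rsum; apply/funext => i; case: (f i) => x y.
  by rewrite (rsumD (sZ a _ sI) (sZ b _ sR)) (rsumZ a sI) (rsumZ b sR).
by rewrite /csum E1 E2.
Qed.

Lemma csum_exchange (I J : choiceType) (a : I -> J -> R[i]) :
  (esum [set: I] (fun i => esum [set: J] (fun j => (cabs (a i j))%:E)) < +oo)%E ->
  csum (fun i => csum (a i)) = csum (fun j => csum (fun i => a i j)).
Proof.
move=> sa; rewrite /csum /=; congr Complex; apply: rsum_exchange;
  apply: le_lt_trans sa; apply: le_esum => i _; apply: le_esum => j _;
  by rewrite lee_fin ?cabs_Re ?cabs_Im.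
Qed.

End ComplexSums.

(** * Stability of localized matrices *)

Section Weights.
Variable R : realType.

(** The chord bound for the convex function [e |-> (1 + e * t) ^ k] on the unit interval. *)
Lemma expr_convex (e t : R) k : 0 <= e <= 1 -> 0 <= t ->
  (1 + e * t) ^+ k - 1 <= e * ((1 + t) ^+ k - 1).
Proof.
move=> /andP[e0 e1] t0; elim: k => [|k IH]; first by rewrite !expr0 subrr mulr0.
have y1 : 1 <= (1 + t) ^+ k by rewrite exprn_ege1// lerDl.
rewrite !exprS; set y := (1 + t) ^+ k in IH y1 *; set z := (1 + e * t) ^+ k in IH *.
have : (1 + e * t) * (z - 1) <= (1 + e * t) * (e * (y - 1)).
  by rewrite ler_wpM2l// addr_ge0// mulr_ge0.
have : e * (e * t * (y - 1)) <= 1 * (e * t * (y - 1)).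
  by rewrite ler_wpM2r// !mulr_ge0// subr_ge0.
by move=> h1 h2; rewrite mul1r in h1; lra.
Qed.

(** The error is relative to the weight at [a], so that a commutator can be bounded by the weighted
    sequence itself. As [a] and [b] are at least 1, their quotient [q] lies between [T^-1] and [T],
    and the chord bound extracts the factor [e] from [T ^ k - 1]. *)
Lemma weight_diff (a b e t : R) k : 0 <= e <= 1 -> 0 <= t -> 1 <= a -> 1 <= b ->
  `|a - b| <= e * t -> `|(a ^+ k)^-1 - (b ^+ k)^-1| <= e * (a ^+ k)^-1 * (1 + t) ^+ k.
Proof.
move=> e01 t0 a1 b1 ab; have /andP[e0 e1] := e01.
have a0 : 0 < a by exact: lt_le_trans a1.
have b0 : 0 < b by exact: lt_le_trans b1.
have et0 : 0 <= e * t by rewrite mulr_ge0.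
pose T := 1 + e * t; have T1 : 1 <= T by rewrite lerDl.
have T0 : 0 < T by exact: lt_le_trans T1.
pose q := a / b; have q0 : 0 < q by rewrite divr_gt0.
have [ab1 ab2] : a - b <= e * t /\ b - a <= e * t.
  by move: ab; rewrite ler_norml => /andP[]; split; lra.
have qT : q <= T.
  rewrite ler_pdivrMr// mulrDl mul1r -lerBlDl (le_trans ab1)// ler_peMr//.
have TqV : T^-1 <= q.
  rewrite -[leRHS]invrK lef_pV2 ?posrE ?invr_gt0// invf_div ler_pdivrMr// mulrDl mul1r.
  by rewrite -lerBlDl (le_trans ab2)// ler_peMr.
have Tk1 : 1 <= T ^+ k by rewrite exprn_ege1.
have key : `|1 - q ^+ k| <= T ^+ k - 1.
  have : q ^+ k <= T ^+ k by rewrite lerXn2r ?nnegrE// ltW.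
  have : (T ^+ k)^-1 <= q ^+ k by rewrite -exprVn lerXn2r ?nnegrE ?invr_ge0 ?(ltW q0) ?(ltW T0).
  (* Equivalent to [(T ^ k - 1) ^ 2 >= 0]: going down from 1 to [T ^ - k] is no longer a way than
     going up to [T ^ k]. *)
  have h : 2 - T ^+ k <= (T ^+ k)^-1.
    rewrite -[leRHS]mul1r ler_pdivlMr ?exprn_gt0//.
    have := sqr_ge0 (T ^+ k - 1); rewrite sqrrB1 expr2; lra.
  by move=> h1 h2; rewrite ler_norml; apply/andP; split; lra.
have -> : (a ^+ k)^-1 - (b ^+ k)^-1 = (a ^+ k)^-1 * (1 - q ^+ k).
  by rewrite mulrBr mulr1 /q expr_div_n mulKf// expf_neq0// gt_eqF.
rewrite normrM ger0_norm ?invr_ge0 ?exprn_ge0 ?(ltW a0)//.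
rewrite [e * _]mulrC -mulrA ler_wpM2l ?invr_ge0 ?exprn_ge0 ?(ltW a0)//.
rewrite (le_trans key)// (le_trans (expr_convex k e01 t0))// ler_wpM2l//.
by rewrite gerBl.
Qed.

End Weights.

(** * Commutators with weights and transfer between exponents *)

Section Stability.
Variables (R : realType) (X : Type) (d : X -> X -> R).
Hypothesis d_ge0 : forall x y, 0 <= d x y.
Hypothesis dxx : forall x, d x x = 0.
Hypothesis d_sym : forall x y, d x y = d y x.
Hypothesis d_tri : forall x y z, d x z <= d x y + d y z.
Variables (I J : choiceType) (pI : I -> X) (pJ : J -> X) (k : nat).

Definition omega (e : R) (x y : X) : R := ((1 + e * d x y) ^+ k)^-1.

Definition pweight (x y : X) : R := (1 + d x y) ^+ k.

Lemma pweight_ge1 x y : 1 <= pweight x y.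
Proof. by rewrite exprn_ege1// lerDl. Qed.

Lemma omega_gt0 e x y : 0 <= e -> 0 < omega e x y.
Proof. by move=> e0; rewrite invr_gt0 exprn_gt0// ltr_pwDl// mulr_ge0. Qed.

Lemma omega_sym e x y : omega e x y = omega e y x.
Proof. by rewrite /omega d_sym. Qed.

Lemma omegaxx e x : omega e x x = 1.
Proof. by rewrite /omega dxx mulr0 addr0 expr1n invr1. Qed.

Lemma omega_le1 e x y : 0 <= e -> omega e x y <= 1.
Proof.
move=> e0; have h : 0 <= e * d x y by rewrite mulr_ge0.
by rewrite invf_le1 ?exprn_gt0 ?ltr_pwDl// exprn_ege1// lerDl.
Qed.

Lemma omega_diff e x y z : 0 <= e <= 1 ->
  `|omega e x y - omega e x z| <= e * omega e x y * pweight y z.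
Proof.
move=> e01; have /andP[e0 e1] := e01; apply: weight_diff => //.
- by rewrite lerDl mulr_ge0.
- by rewrite lerDl mulr_ge0.
rewrite opprD addrACA subrr add0r -mulrBr normrM ger0_norm// ler_wpM2l//.
rewrite ler_norml lerBlDr lerBrDr addrC; apply/andP; split.
  by rewrite lerBlDr addrC [d y z]d_sym addrC (le_trans (d_tri x y z))// [d z y]d_sym.
by rewrite addrC [d y z]d_sym; exact: d_tri.
Qed.

(** Summability over the points is assumed for [omega 1] only, since [e] is fixed later by the
    stability constant. The reason is [e * (1 + d) <= 1 + e * d]. *)
Lemma omega_le e x y : 0 < e <= 1 -> omega e x y <= (e ^+ k)^-1 * omega 1 x y.
Proof.
move=> /andP[e0 e1]; rewrite /omega mul1r -invfM -exprMn.
rewrite lef_pV2 ?posrE ?exprn_gt0// ?mulr_gt0 ?ltr_pwDl// ?mulr_ge0 ?(ltW e0)//.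
rewrite lerXn2r ?nnegrE ?addr_ge0 ?mulr_ge0 ?(ltW e0) ?addr_ge0//.
by rewrite mulrDr mulr1 lerD.
Qed.

Definition wmul (U : choiceType) (pU : U -> X) e x (c : U -> R[i]) : U -> R[i] :=
  fun u => (omega e x (pU u))%:C%C * c u.

Section Kernel.
Variables (K : R) (U V : choiceType) (pU : U -> X) (pV : V -> X) (M : V -> U -> R[i]).
Hypothesis K0 : 0 < K.
Hypothesis rowM : forall v,
  (esum [set: U] (fun u => (cabs (M v u) * pweight (pV v) (pU u))%:E) <= K%:E)%E.
Hypothesis colM : forall u,
  (esum [set: V] (fun v => (cabs (M v u) * pweight (pV v) (pU u))%:E) <= K%:E)%E.

Let cabs_le_pweight v u : cabs (M v u) <= cabs (M v u) * pweight (pV v) (pU u).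
Proof. by rewrite ler_peMr ?cabs_ge0// pweight_ge1. Qed.

Lemma matrix_act_summable B c v : 0 <= B -> (forall u, cabs (c u) <= B) ->
  (esum [set: U] (fun u => (cabs (M v u * c u))%:E) <= (B * K)%:E)%E.
Proof.
move=> B0 cB; apply: (@le_trans _ _ (B%:E * K%:E)%E); last by rewrite EFinM.
apply: le_trans (lee_wpmul2l _ (rowM v)); rewrite ?lee_fin// -esumZl// => [|u].
  apply: le_esum => u _; rewrite -EFinM lee_fin cabsM mulrC.
  by rewrite ler_pM ?cabs_ge0.
by rewrite lee_fin mulr_ge0 ?cabs_ge0// (le_trans ler01)// pweight_ge1.
Qed.

Lemma matrix_act_csummable B c v : 0 <= B -> (forall u, cabs (c u) <= B) ->
  csummable (fun u => M v u * c u).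
Proof. by move=> B0 cB; apply: le_lt_trans (matrix_act_summable v B0 cB) _; exact: ltry. Qed.

Lemma matrix_act_bounded B c v : 0 <= B -> (forall u, cabs (c u) <= B) ->
  cabs (matrix_act M c v) <= 2 * (B * K).
Proof.
move=> B0 cB; rewrite -lee_fin EFinM; apply: le_trans (csum_cabs _) _.
by rewrite lee_wpmul2l ?lee_fin//; exact: matrix_act_summable.
Qed.

Lemma matrix_actD B c c' : 0 <= B -> (forall u, cabs (c u) <= B) ->
  (forall u, cabs (c' u) <= B) ->
  forall v, matrix_act M (fun u => c u + c' u) v = matrix_act M c v + matrix_act M c' v.
Proof.
move=> B0 cB cB' v; rewrite /matrix_act -csumD//; last 2 first.
- exact: (matrix_act_csummable v B0 cB).
- exact: (matrix_act_csummable v B0 cB').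
by congr csum; apply/funext => u; rewrite mulrDr.
Qed.

Lemma lnorm_matrix_act p c : (1 <= p)%E ->
  (lnorm p (fun v => cabs (matrix_act M c v)) <=
   (4 * K)%:E * lnorm p (fun u => cabs (c u)))%E.
Proof.
move=> p1; rewrite (_ : 4 * K = 2 * (2 * K)); last by ring.
apply: (@schur_test _ p p1 _ _ (fun v u => 2 * cabs (M v u))) => //.
- by rewrite mulr_gt0.
- by move=> v u; rewrite mulr_ge0 ?cabs_ge0.
- by move=> u; exact: cabs_ge0.
- by move=> v; exact: cabs_ge0.
- move=> v; under eq_esum do rewrite EFinM.
  rewrite esumZl// => [|u]; last by rewrite lee_fin cabs_ge0.
  rewrite EFinM lee_wpmul2l ?lee_fin// (le_trans _ (rowM v))//.
  by apply: le_esum => u _; rewrite lee_fin.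
- move=> u; under eq_esum do rewrite EFinM.
  rewrite esumZl// => [|v]; last by rewrite lee_fin cabs_ge0.
  rewrite EFinM lee_wpmul2l ?lee_fin// (le_trans _ (colM u))//.
  by apply: le_esum => v _; rewrite lee_fin.
- move=> v; apply: le_trans (csum_cabs _) _.
  rewrite -esumZl// => [|u]; last by rewrite lee_fin cabs_ge0.
  by apply: le_esum => u _; rewrite -EFinM lee_fin cabsM mulrA.
Qed.

(** By [omega_diff], the entry of the commutator at [(v, u)] is at most [e * |M v u| * pweight]
    times the weight at [u], and this last factor is left with [c u]. Boundedness of [c] makes the
    sums converge; [B] stays out of the constant. *)
Lemma lnorm_commutator p e x B c : (1 <= p)%E -> 0 < e <= 1 -> 0 <= B -> (forall u, cabs (c u) <= B) ->
  (lnorm p (fun v => cabs (matrix_act M (wmul pU e x c) v - wmul pV e x (matrix_act M c) v)%R) <=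
   (4 * (e * K))%:E * lnorm p (fun u => cabs (wmul pU e x c u)))%E.
Proof.
move=> p1 /andP[e0 e1] B0 cB.
have e01 : 0 <= e <= 1 by rewrite ltW.
have om0 y : 0 < omega e x y by exact: omega_gt0 (ltW e0).
rewrite (_ : 4 * (e * K) = 2 * (2 * (e * K))); last by ring.
apply: (@schur_test _ p p1 _ _ (fun v u => 2 * (e * (cabs (M v u) * pweight (pV v) (pU u))))) => //.
- by rewrite !mulr_gt0.
- by move=> v u; rewrite !mulr_ge0 ?cabs_ge0 ?(ltW e0)// (le_trans ler01)// pweight_ge1.
- by move=> u; exact: cabs_ge0.
- by move=> v; exact: cabs_ge0.
- move=> v; under eq_esum do rewrite mulrA EFinM.
  rewrite esumZl ?mulr_ge0 ?(ltW e0)// => [|u]; last first.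
    by rewrite lee_fin mulr_ge0 ?cabs_ge0// (le_trans ler01)// pweight_ge1.
  by rewrite mulrA (EFinM (2 * e) K) lee_wpmul2l ?lee_fin ?mulr_ge0 ?(ltW e0).
- move=> u; under eq_esum do rewrite mulrA EFinM.
  rewrite esumZl ?mulr_ge0 ?(ltW e0)// => [|v]; last first.
    by rewrite lee_fin mulr_ge0 ?cabs_ge0// (le_trans ler01)// pweight_ge1.
  by rewrite mulrA (EFinM (2 * e) K) lee_wpmul2l ?lee_fin ?mulr_ge0 ?(ltW e0).
move=> v.
have sc := matrix_act_csummable v B0 cB.
have som : csummable (fun u => M v u * ((omega e x (pU u))%:C%C * c u)).
  apply: csummable_le sc => u; rewrite mulrCA !cabsM cabs_real gtr0_norm// ler_piMl ?mulr_ge0 ?cabs_ge0//.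
  by rewrite omega_le1// ltW.
have -> : matrix_act M (wmul pU e x c) v - wmul pV e x (matrix_act M c) v =
    csum (fun u => M v u * ((omega e x (pU u) - omega e x (pV v))%:C%C * c u)).
  rewrite /wmul /matrix_act -mulNr -csumZ// -csumD//; last first.
    apply: csummable_le sc => u; rewrite -rmorphN !cabsM cabs_real normrN gtr0_norm// ler_piMl ?mulr_ge0 ?cabs_ge0//.
    by rewrite omega_le1// ltW.
  by congr csum; apply/funext => u; rewrite rmorphB /=; ring.
apply: le_trans (csum_cabs _) _.
rewrite -esumZl// => [|u]; last by rewrite lee_fin cabs_ge0.
apply: le_esum => u _; rewrite -EFinM lee_fin /wmul !cabsM !cabs_real (gtr0_norm (om0 _)).
rewrite [leRHS](_ : _ = 2 * (cabs (M v u) * ((e * omega e x (pU u) * pweight (pV v) (pU u)) * cabs (c u)))); last by ring.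
rewrite !ler_wpM2l// ?cabs_ge0// ler_wpM2r ?cabs_ge0//.
by have := omega_diff x (pU u) (pV v) e01; rewrite {1 2}/pweight [d (pU u) _]d_sym.
Qed.

End Kernel.

Variables (K0 K : R) (P : I -> I -> R[i]) (A : J -> I -> R[i]).
Hypothesis K0_gt0 : 0 < K0.
Hypothesis K_gt0 : 0 < K.
Hypothesis omega_sumI : forall x, (esum [set: I] (fun i => (omega 1 x (pI i))%:E) <= K0%:E)%E.
Hypothesis omega_sumJ : forall x, (esum [set: J] (fun j => (omega 1 x (pJ j))%:E) <= K0%:E)%E.
Hypothesis rowP : forall i,
  (esum [set: I] (fun i' => (cabs (P i i') * pweight (pI i) (pI i'))%:E) <= K%:E)%E.
Hypothesis colP : forall i',
  (esum [set: I] (fun i => (cabs (P i i') * pweight (pI i) (pI i'))%:E) <= K%:E)%E.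
Hypothesis rowA : forall j,
  (esum [set: I] (fun i => (cabs (A j i) * pweight (pJ j) (pI i))%:E) <= K%:E)%E.
Hypothesis colA : forall i,
  (esum [set: J] (fun j => (cabs (A j i) * pweight (pJ j) (pI i))%:E) <= K%:E)%E.
Hypothesis idemP : forall i l, csum (fun i' => P i i' * P i' l) = P i l.

Lemma ell_bounded q (c : I -> R[i]) : (1 <= q)%E -> ell q c ->
  exists2 B, 0 <= B & forall i, cabs (c i) <= B.
Proof.
rewrite /ell ell_normE => q1 cq; have c0 i : 0 <= cabs (c i) by exact: cabs_ge0.
have n0 := lnorm_ge0 q1 (fun i => cabs (c i)).
have fin : lnorm q (fun i => cabs (c i)) \is a fin_num by rewrite ge0_fin_numE.
exists (fine (lnorm q (fun i => cabs (c i)))); first exact: fine_ge0.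
move=> i; rewrite -lee_fin fineK//.
exact: (@lnorm_ge_term _ q q1 _ (fun i => cabs (c i)) i c0).
Qed.

(** Fubini, justified by the row sums of [P]. It is stated for bounded sequences because [c] in l^q
    need not lie in l^2. *)
Lemma matrix_act_idem B c : 0 <= B -> (forall i, cabs (c i) <= B) ->
  forall i, matrix_act P (matrix_act P c) i = matrix_act P c i.
Proof.
move=> B0 cB i; rewrite /matrix_act.
have sc j := matrix_act_csummable rowP j B0 cB.
transitivity (csum (fun j => csum (fun l => P i j * (P j l * c l)))).
  by congr csum; apply/funext => j; rewrite csumZ.
rewrite csum_exchange; last first.
  apply: (@le_lt_trans _ _ ((B * K)%:E * K%:E)%E); last by rewrite -EFinM ltry.
  apply: le_trans (lee_wpmul2l _ (rowP i)); rewrite ?lee_fin ?mulr_ge0 ?(ltW K_gt0)//.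
  rewrite -esumZl ?mulr_ge0 ?(ltW K_gt0)// => [|j]; last first.
    by rewrite lee_fin mulr_ge0 ?cabs_ge0// (le_trans ler01)// pweight_ge1.
  apply: le_esum => j _; under eq_esum do rewrite cabsM EFinM.
  rewrite esumZl ?cabs_ge0// => [|l]; last by rewrite lee_fin cabs_ge0.
  rewrite muleC; apply: (@le_trans _ _ ((B * K)%:E * (cabs (P i j))%:E)%E).
    by rewrite lee_wpmul2r ?lee_fin ?cabs_ge0//; exact: (matrix_act_summable rowP j B0 cB).
  by rewrite -!EFinM lee_fin ler_wpM2l ?mulr_ge0 ?(ltW K_gt0)// ler_peMr ?cabs_ge0// pweight_ge1.
congr csum; apply/funext => l.
rewrite -[in RHS]idemP mulrC -csumZ; last first.
  apply: (matrix_act_csummable (c := fun j => P j l) rowP i (ltW K_gt0)).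
  move=> j; rewrite -lee_fin (le_trans _ (colP l))//.
  rewrite (le_trans _ (esum_ge_term _ j))// lee_fin ler_peMr ?cabs_ge0// pweight_ge1//.
by congr csum; apply/funext => j; ring.
Qed.

Section FromP.
Variables (p : \bar R) (C : R).
Hypotheses (p1 : (1 <= p)%E) (C0 : 0 < C).
Hypothesis stableP : forall c : I -> R[i], ell p c ->
  (C%:E * ell_norm p (matrix_act P c) <= ell_norm p (matrix_act A (matrix_act P c)))%E.

Lemma weighted_lower_bound : exists2 e, 0 < e <= 1 & forall x B D, 0 <= B ->
  (forall i, cabs (D i) <= B) -> (forall i, matrix_act P D i = D i) ->
  (lnorm p (fun i => cabs (wmul pI e x D i)) <=
   (32 / C)%:E * lnorm p (fun j => cabs (wmul pJ e x (matrix_act A D) j)))%E.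
Proof.
(* Let [t] be the norm of [wD]. Each commutator contributes at most [4 * (e * K) * t]; through the
   factors 4 of [lnormD], the norm of [A] and [C^-1] the errors add up to [e * kappa * t], which the
   choice of [e] keeps below [t / 2]. *)
pose kappa := 256 / C * (K + 4 * K * K) + 16 * K.
have kappa0 : 0 < kappa.
  by rewrite /kappa addr_gt0 ?mulr_gt0 ?divr_gt0 ?invr_gt0// addr_gt0 ?mulr_gt0.
pose e := Num.min 1 (2 * kappa)^-1.
have e0 : 0 < e by rewrite lt_min ltr01 invr_gt0 mulr_gt0.
have e1 : e <= 1 by rewrite ge_min lexx.
have ek : e * kappa <= 2^-1.
  have : e <= (2 * kappa)^-1 by rewrite ge_min lexx orbT.
  by rewrite invfM ler_pdivlMr.
have e01 : 0 < e <= 1 by rewrite e0.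
exists e => // x B D B0 DB PD.
have om0 y : 0 < omega e x y by exact: omega_gt0 (ltW e0).
set wD := wmul pI e x D; set T := lnorm p _; set H := lnorm p _.
have T0 : (0 <= T)%E by exact: lnorm_ge0.
have H0 : (0 <= H)%E by exact: lnorm_ge0.
(* Finiteness serves twice: [wD] lies in l^p, so [stableP] applies to it, and [t / 2] can be
   subtracted at the end. Nothing of the kind is known for [D]. *)
have Tfin : (T < +oo)%E.
  apply: le_lt_trans (lnorm_le_l1 p1 _) _ => [i|]; first exact: cabs_ge0.
  apply: (@le_lt_trans _ _ ((B * (e ^+ k)^-1)%:E * K0%:E)%E); last by rewrite -EFinM ltry.
  apply: le_trans (lee_wpmul2l _ (omega_sumI x)); last first.
    by rewrite lee_fin mulr_ge0// invr_ge0 exprn_ge0// ltW.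
  rewrite -esumZl => [||i]; last 2 first.
  - by rewrite mulr_ge0// invr_ge0 exprn_ge0// ltW.
  - by rewrite lee_fin ltW// omega_gt0.
  apply: le_esum => i _; rewrite -EFinM lee_fin /wD /wmul cabsM cabs_real gtr0_norm//.
  rewrite mulrC -mulrA ler_pM ?cabs_ge0 ?(ltW (om0 _))//.
  exact: omega_le.
have [Hy|Hy] := eqVneq H +oo%E.
  by rewrite Hy gt0_muley ?leey// lte_fin divr_gt0.
have Tf : T = (fine T)%:E by rewrite fineK// ge0_fin_numE.
have Hf : H = (fine H)%:E by rewrite fineK// ge0_fin_numE// ltey.
set t := fine T in Tf; set h := fine H in Hf.
have WB i : cabs (wD i) <= B.
  rewrite /wD /wmul cabsM cabs_real gtr0_norm// (le_trans _ (DB i))//.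
  by rewrite ler_piMl ?cabs_ge0// omega_le1// ltW.
(* As [P] fixes [D], this is the commutator of [P] with the weight, applied to [D]. *)
pose E i := matrix_act P wD i - wD i.
have nE : (lnorm p (fun i => cabs (E i)) <= (4 * (e * K) * t)%:E)%E.
  have := lnorm_commutator K_gt0 rowP colP x p1 e01 B0 DB; rewrite -/wD -/T Tf -EFinM.
  congr (lnorm _ _ <= _)%E; apply/funext => i; rewrite /E; congr (cabs (_ - _)).
  by rewrite /wD /wmul PD.
have PwB i : cabs (matrix_act P wD i) <= 2 * (B * K) by exact: (matrix_act_bounded rowP).
have BK0 : 0 <= 2 * (B * K) by rewrite !mulr_ge0// ltW.
pose B' := 2 * (B * K) + B; have B'0 : 0 <= B' by rewrite addr_ge0.
have EB i : cabs (E i) <= B'.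
  rewrite (le_trans (cabsD _ _))// lerD// (_ : cabs _ = cabs (wD i)) ?WB//.
  by apply: complexI; rewrite -!norm_cabs normrN.
have wDB' i : cabs (wD i) <= B' by rewrite (le_trans (WB i))// lerDr.
have PwE : matrix_act P wD = (fun i => wD i + E i).
  by apply/funext => i; rewrite /E addrCA subrr addr0.
have APw j : matrix_act A (matrix_act P wD) j = matrix_act A wD j + matrix_act A E j.
  by rewrite PwE (matrix_actD rowA B'0 wDB' EB).
have nA1 : (lnorm p (fun j => cabs (matrix_act A wD j - wmul pJ e x (matrix_act A D) j)%R)
    <= (4 * (e * K) * t)%:E)%E.
  by have := lnorm_commutator K_gt0 rowA colA x p1 e01 B0 DB; rewrite -/wD -/T Tf -EFinM.
have nA2 : (lnorm p (fun j => cabs (matrix_act A E j)) <= (4 * K * (4 * (e * K) * t))%:E)%E.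
  apply: le_trans (lnorm_matrix_act K_gt0 rowA colA E p1) _.
  by rewrite (EFinM (4 * K)) lee_wpmul2l// lee_fin mulr_ge0// ltW.
have nAP : (lnorm p (fun j => cabs (matrix_act A (matrix_act P wD) j)) <=
    (4 * (h + 4 * (4 * (e * K) * t + 4 * K * (4 * (e * K) * t))))%:E)%E.
  pose g1 j := cabs (matrix_act A wD j - wmul pJ e x (matrix_act A D) j).
  pose g2 j := cabs (matrix_act A E j).
  apply: (@le_trans _ _ (lnorm p (fun j => cabs (wmul pJ e x (matrix_act A D) j) + (g1 j + g2 j)))).
    apply: lnorm_le => // j; rewrite cabs_ge0 /= APw.
    rewrite [X in cabs X](_ : _ = wmul pJ e x (matrix_act A D) j +
      ((matrix_act A wD j - wmul pJ e x (matrix_act A D) j) + matrix_act A E j)); last by ring.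
    by rewrite (le_trans (cabsD _ _))// lerD2l cabsD.
  apply: le_trans (lnormD p1 _ _) _ => [j|j|]; rewrite ?addr_ge0 ?cabs_ge0//.
  rewrite EFinM lee_wpmul2l// EFinD -/H Hf leeD2l//.
  apply: le_trans (lnormD p1 _ _) _ => [j|j|]; rewrite ?cabs_ge0//.
  by rewrite EFinM lee_wpmul2l// EFinD leeD.
have nP : (lnorm p (fun i => cabs (matrix_act P wD i)) <=
    (C^-1 * (4 * (h + 4 * (4 * (e * K) * t + 4 * K * (4 * (e * K) * t)))))%:E)%E.
  have := @stableP wD; rewrite /ell !ell_normE -/T => /(_ Tfin).
  rewrite -lee_pdivlMl// => /le_trans; apply.
  by rewrite EFinM lee_wpmul2l// lee_fin invr_ge0 ltW.
have : (T <= (4 * (C^-1 * (4 * (h + 4 * (4 * (e * K) * t + 4 * K * (4 * (e * K) * t)))) +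
    4 * (e * K) * t))%:E)%E.
  apply: (@le_trans _ _ (lnorm p (fun i => cabs (matrix_act P wD i) + cabs (E i)))).
    apply: lnorm_le => // i; rewrite cabs_ge0 /=.
    rewrite [X in cabs X <= _](_ : _ = matrix_act P wD i - E i); last first.
      by rewrite /E opprB addrC subrK.
    rewrite (le_trans (cabsD _ _))// lerD2l (_ : cabs (- _) = cabs (E i))//.
    by apply: complexI; rewrite -!norm_cabs normrN.
  apply: le_trans (lnormD p1 _ _) _ => [i|i|]; rewrite ?cabs_ge0//.
  by rewrite EFinM lee_wpmul2l// EFinD leeD.
have t0 : 0 <= t by exact: fine_ge0.
rewrite Tf Hf -EFinM !lee_fin => le.
have : e * kappa * t <= 2^-1 * t by rewrite ler_wpM2r.
move: le; rewrite [X in t <= X](_ : _ = 16 / C * h + e * kappa * t); last first.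
  by rewrite /kappa; field; rewrite gt_eqF.
rewrite [32 / C * h](_ : _ = 2 * (16 / C * h)); last by ring.
by lra.
Qed.

Theorem stability_all_exponents : exists C', 0 < C' /\
  forall q : \bar R, (1 <= q)%E -> forall c : I -> R[i], ell q c ->
    (C'%:E * ell_norm q (matrix_act P c) <= ell_norm q (matrix_act A (matrix_act P c)))%E.
Proof.
have [e e01 low] := weighted_lower_bound; have /andP[e0 e1] := e01.
(* A bound for the row and column sums of the kernel [32 / C * omega e], free of [q]; the 2 in [C']
   is that of [schur_test]. *)
pose S := 32 / C * ((e ^+ k)^-1 * K0).
have S0 : 0 < S by rewrite !mulr_gt0 ?invr_gt0 ?exprn_gt0.
exists (2 * S)^-1; split; first by rewrite invr_gt0 mulr_gt0.
move=> q q1 c /(ell_bounded q1)[B B0 cB].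
pose D := matrix_act P c.
have DB i : cabs (D i) <= 2 * (B * K) by exact: (matrix_act_bounded rowP).
have B20 : 0 <= 2 * (B * K) by rewrite !mulr_ge0// ltW.
have PD i : matrix_act P D i = D i by exact: (matrix_act_idem B0 cB).
have S20 : 0 < 2 * S by rewrite mulr_gt0.
rewrite !ell_normE lee_pdivrMl//.
apply: (@schur_test _ q q1 _ _ (fun i j => 32 / C * omega e (pI i) (pJ j))) => //.
- by move=> i j; rewrite mulr_ge0 ?divr_ge0 ?(ltW C0)// ltW// omega_gt0// ltW.
- by move=> j; exact: cabs_ge0.
- by move=> i; exact: cabs_ge0.
- move=> i; under eq_esum do rewrite EFinM.
  rewrite esumZl ?divr_ge0 ?(ltW C0)// => [|j]; last by rewrite lee_fin ltW// omega_gt0// ltW.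
  rewrite /S (EFinM (32 / C)) lee_wpmul2l ?lee_fin ?divr_ge0 ?(ltW C0)//.
  rewrite (EFinM _ K0) (le_trans _ (lee_wpmul2l _ (omega_sumJ (pI i)))) ?lee_fin ?invr_ge0 ?exprn_ge0 ?(ltW e0)//.
  rewrite -esumZl ?invr_ge0 ?exprn_ge0 ?(ltW e0)// => [|j]; last by rewrite lee_fin ltW// omega_gt0.
  by apply: le_esum => j _; rewrite -EFinM lee_fin omega_le.
- move=> j; under eq_esum do rewrite omega_sym EFinM.
  rewrite esumZl ?divr_ge0 ?(ltW C0)// => [|i]; last by rewrite lee_fin ltW// omega_gt0// ltW.
  rewrite /S (EFinM (32 / C)) lee_wpmul2l ?lee_fin ?divr_ge0 ?(ltW C0)//.
  rewrite (EFinM _ K0) (le_trans _ (lee_wpmul2l _ (omega_sumI (pJ j)))) ?lee_fin ?invr_ge0 ?exprn_ge0 ?(ltW e0)//.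
  rewrite -esumZl ?invr_ge0 ?exprn_ge0 ?(ltW e0)// => [|i]; last by rewrite lee_fin ltW// omega_gt0.
  by apply: le_esum => i _; rewrite -EFinM lee_fin omega_le.
(* The weight is centred at the point of evaluation, where it equals 1. The l^p norm exceeds a
   single term on one side and is below the l^1 norm on the other, so [p] drops out. *)
move=> i; apply: (@le_trans _ _ (lnorm p (fun i' => cabs (wmul pI e (pI i) D i')))).
  have := @lnorm_ge_term _ p p1 _ (fun i' => cabs (wmul pI e (pI i) D i')) i
    (fun i' => cabs_ge0 _).
  by rewrite {1}/wmul omegaxx mul1r.
apply: le_trans (low (pI i) _ _ B20 DB PD) _.
have l1 := @lnorm_le_l1 _ p p1 _ (fun j => cabs (wmul pJ e (pI i) (matrix_act A D) j))
  (fun j => cabs_ge0 _).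
have C32 : 0 <= 32 / C by rewrite divr_ge0// ltW.
apply: le_trans (lee_wpmul2l _ l1) _; first by rewrite lee_fin.
rewrite -esumZl// => [|j]; last by rewrite lee_fin cabs_ge0.
apply: le_esum => j _; rewrite -EFinM lee_fin /wmul cabsM cabs_real gtr0_norm ?omega_gt0 ?(ltW e0)//.
by rewrite mulrA.
Qed.

End FromP.

End Stability.

(** * Operators on l^2 and their matrices *)

Section OperatorMatrix.
Variable R : realType.

Lemma esum_tail (I : choiceType) (f : I -> R) eps : (forall i, 0 <= f i) ->
  (esum [set: I] (fun i => (f i)%:E) < +oo)%E -> 0 < eps ->
  exists2 s : seq I, uniq s & (esum [set: I] (fun i => (if i \in s then 0 else f i)%:E) <= eps%:E)%E.
Proof.
move=> f0 fy eps0; set T := esum _ _ in fy.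
have T0 : (0 <= T)%E by rewrite esum_ge0// => i _; rewrite lee_fin.
have Tf : T \is a fin_num by rewrite ge0_fin_numE.
have [_ [X [finX _] <-] XT] := @ub_ereal_sup_adherent _ _ _ eps0 Tf.
pose s : seq I := finmap.enum_fset (fset_set X).
have us : uniq s by exact: finmap.fset_uniq.
exists s => //.
have E : T = (esum [set: I] (fun i => (if i \in s then f i else 0)%:E) +
         esum [set: I] (fun i => (if i \in s then 0 else f i)%:E))%E.
  rewrite -esumD => [|i _|i _]; try by case: ifP => _; rewrite lee_fin.
  by apply: eq_esum => i _; case: ifP => _; rewrite ?adde0 ?add0e.
have le : (\sum_(i \in X) (f i)%:E <=
    esum [set: I] (fun i => (if i \in s then f i else 0)%:E))%E.
  rewrite fsbig_finite//=.
  apply: le_trans (esum_ge_seq _ us).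
  by rewrite big_seq [leRHS]big_seq; apply: lee_sum => i ->.
set a := esum _ _ in E le; set b := esum _ _ in E *.
have a0 : (0 <= a)%E by rewrite esum_ge0// => i _; case: ifP => _; rewrite lee_fin.
have b0 : (0 <= b)%E by rewrite esum_ge0// => i _; case: ifP => _; rewrite lee_fin.
have af : a \is a fin_num by rewrite ge0_fin_numE// (le_lt_trans _ fy)// E leeDl.
have bf : b \is a fin_num by rewrite ge0_fin_numE// (le_lt_trans _ fy)// E leeDr.
have := lt_le_trans XT le; rewrite -[ereal_sup _]/T E.
case: (a) af => // a' _; case: (b) bf => // b' _.
rewrite lee_fin -[(_ - _)%E]/((a' + b' - eps)%:E) lte_fin.
by lra.
Qed.

Lemma esum_delta (I : choiceType) (l : I) (x : R) : 0 <= x ->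
  esum [set: I] (fun i => (if i == l then x else 0)%:E) = x%:E.
Proof.
move=> x0; rewrite -(@esum_set1 _ _ l (fun=> x%:E)) ?lee_fin// [RHS]esum_mkcond.
by apply: eq_esum => i _; rewrite in_set1; case: eqP.
Qed.

Lemma csum_delta (I : choiceType) (m : I -> R[i]) l :
  csum (fun i => m i * (i == l)%:R) = m l.
Proof.
have rsd (x : R) : rsum (fun i : I => if i == l then x else 0) = x.
  rewrite (@rsum_diff _ _ _ (fun i => if i == l then Num.max x 0 else 0)
     (fun i => if i == l then Num.max (- x) 0 else 0)).
  - rewrite !esum_delta ?le_max ?lexx ?orbT//=.
    by case: (leP x 0) => h; case: (leP (- x) 0) => h'; lra.
  - by move=> i; case: ifP; rewrite // le_max lexx orbT.
  - by move=> i; case: ifP; rewrite // le_max lexx orbT.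
  - move=> i; case: ifP => _; last by rewrite subrr.
    by case: (leP x 0) => h; case: (leP (- x) 0) => h'; lra.
  - by rewrite esum_delta ?ltry// le_max lexx orbT.
  - by rewrite esum_delta ?ltry// le_max lexx orbT.
rewrite /csum; case E : (m l) => [a b]; congr Complex.
  rewrite -[RHS]rsd; congr rsum; apply/funext => i.
  by case: eqP => [->|_]; rewrite ?mulr1 ?mulr0// E.
rewrite -[RHS]rsd; congr rsum; apply/funext => i.
by case: eqP => [->|_]; rewrite ?mulr1 ?mulr0// E.
Qed.

Variables (I J : choiceType) (T : (I -> R[i]) -> (J -> R[i])).
Hypothesis bT : bounded_operator T.

Lemma ell2E (K : choiceType) (c : K -> R[i]) :
  ell_norm 2%:E c = ((esum [set: K] (fun i => (cabs (c i) ^+ 2)%:E)) `^ 2^-1)%E.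
Proof.
congr (_ `^ _)%E; apply: eq_esum => i _; by rewrite powR_mulrn ?cabs_ge0.
Qed.

Lemma ell2P (K : choiceType) (c : K -> R[i]) :
  ell 2%:E c <-> (esum [set: K] (fun i => (cabs (c i) ^+ 2)%:E) < +oo)%E.
Proof.
rewrite /ell ell2E; split; last exact: poweR_lty.
by apply: lty_poweRy; rewrite invr_eq0 pnatr_eq0.
Qed.

Lemma bop0 : T (fun=> 0) = fun=> 0.
Proof.
have z2 : ell 2%:E (fun _ : I => 0 : R[i]).
  by apply/ell2P; rewrite esum1 ?ltry// => i _; rewrite cabs0 expr0n.
have := bop_linear bT (-1) z2 z2.
rewrite (_ : (fun i : I => _) = (fun=> 0)); last by apply/funext => i; rewrite mulr0 addr0.
by move=> ->; apply/funext => j; rewrite mulN1r addNr.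
Qed.

Lemma delta_ell2 (l : I) : ell 2%:E (fun i : I => (i == l)%:R : R[i]).
Proof.
apply/ell2P; rewrite (eq_esum (b := fun i => (if i == l then 1 else 0)%:E)).
  by rewrite esum_delta ?ltry.
move=> i _; case: eqP => _; last by rewrite cabs0 expr0n.
by rewrite -(rmorph1 (@real_complex R)) cabs_real normr1 expr1n.
Qed.

Lemma ell2_le (K : choiceType) (c c' : K -> R[i]) : (forall i, cabs (c i) <= cabs (c' i)) ->
  ell 2%:E c' -> ell 2%:E c.
Proof.
move=> cc' /ell2P h; apply/ell2P; apply: le_lt_trans h; apply: le_esum => i _.
by rewrite lee_fin lerXn2r ?nnegrE ?cabs_ge0.
Qed.

(** Linearity settles finite truncations. The rest of [c] has to be small both in l^2, for the
    operator, and against the row [j], for the matrix; one tail estimate for the sum of the two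
    families gives both. *)
Lemma bop_matrix_act (c : I -> R[i]) j : ell 2%:E c ->
  csummable (fun i => entry T j i * c i) -> T c j = matrix_act (entry T) c j.
Proof.
move=> c2 sc; pose cut (s : seq I) i := if i \in s then c i else 0.
pose rest (s : seq I) i := if i \in s then 0 else c i.
have cut_le s i : cabs (cut s i) <= cabs (c i).
  by rewrite /cut; case: ifP => _ //; rewrite cabs0 cabs_ge0.
have rest_le s i : cabs (rest s i) <= cabs (c i).
  by rewrite /rest; case: ifP => _ //; rewrite cabs0 cabs_ge0.
have cut2 s : ell 2%:E (cut s) by exact: ell2_le (cut_le s) c2.
have rest2 s : ell 2%:E (rest s) by exact: ell2_le (rest_le s) c2.
have scut s : csummable (fun i => entry T j i * cut s i).
  by apply: csummable_le sc => i; rewrite !cabsM ler_wpM2l ?cabs_ge0.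
have srest s : csummable (fun i => entry T j i * rest s i).
  by apply: csummable_le sc => i; rewrite !cabsM ler_wpM2l ?cabs_ge0.
have Tcut s : uniq s -> T (cut s) j = csum (fun i => entry T j i * cut s i).
  elim: s => [_|x s IH /= /andP[xs us]].
    rewrite (_ : cut [::] = fun=> 0) // bop0 (_ : (fun i => _) = (fun i : I => 0 * 0)).
      rewrite csumZ ?mul0r// /csummable esum1 ?ltry// => i _; by rewrite cabs0.
    by apply/funext => i; rewrite !mulr0.
  have cutE i : cut (x :: s) i = c x * (i == x)%:R + cut s i.
    rewrite /cut inE; case: eqP => [->|_] /=; last by rewrite mulr0 add0r.
    by rewrite (negbTE xs) mulr1 addr0.
  rewrite (_ : cut (x :: s) = fun i => c x * (i == x)%:R + cut s i); last exact/funext.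
  rewrite (bop_linear bT _ (delta_ell2 x) (cut2 s)) IH//.
  have sd : csummable (fun i => entry T j i * (i == x)%:R).
    apply: (@le_lt_trans _ _ (cabs (entry T j x))%:E); last by rewrite ltry.
    rewrite -[leRHS](esum_delta x (cabs_ge0 _)); apply: le_esum => i _.
    by case: eqP => [->|_]; rewrite ?mulr1// mulr0 cabs0.
  have sdc : csummable (fun i => c x * (entry T j i * (i == x)%:R)).
    rewrite /csummable; under eq_esum do rewrite cabsM EFinM.
    rewrite esumZl ?cabs_ge0// => [|i]; last by rewrite lee_fin cabs_ge0.
    rewrite lte_mul_pinfty ?lee_fin ?cabs_ge0//.
  have -> : T (fun i => (i == x)%:R) j = csum (fun i => entry T j i * (i == x)%:R).
    by rewrite csum_delta.
  rewrite -csumZ// -csumD//.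
  by congr csum; apply/funext => i; rewrite mulrDr mulrCA.
have [M0 MP0] := bop_bounded bT; pose M := `|M0|.
have MP v : ell 2%:E v -> (ell_norm 2%:E (T v) <= M%:E * ell_norm 2%:E v)%E.
  move=> v2; apply: le_trans (MP0 v v2) _; rewrite lee_wpmul2r ?lee_fin ?ler_norm//.
  by rewrite ell_normE lnorm_ge0// lee_fin ler1n.
have split s : c = (fun i => 1 * cut s i + rest s i).
  apply/funext => i; rewrite /cut /rest; case: ifP => _; rewrite mul1r ?addr0 ?add0r//.
apply/eqP; rewrite -subr_eq0; apply/eqP.
suff : cabs (T c j - matrix_act (entry T) c j) <= 0.
  move=> h; apply/eqP; rewrite -normr_eq0 norm_cabs; apply/eqP; congr (_%:C)%C.
  by apply/eqP; rewrite eq_le h cabs_ge0.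
apply/ler_addgt0Pr => eps eps0; rewrite add0r.
(* [csum_cabs] doubles [eps / 4], and the operator multiplies [eps / (2 * (M + 1))] by at most [M]:
   each part stays below [eps / 2]. *)
pose e := Num.min (eps / 4) ((eps / (2 * (M + 1))) ^+ 2).
have M1 : 0 < M + 1 by rewrite ltr_wpDl// /M.
have e0 : 0 < e by rewrite lt_min divr_gt0// exprn_gt0// divr_gt0// mulr_gt0.
have f0 i : 0 <= cabs (c i) ^+ 2 + cabs (entry T j i * c i).
  by rewrite addr_ge0 ?exprn_ge0 ?cabs_ge0.
have fy : (esum [set: I] (fun i => (cabs (c i) ^+ 2 + cabs (entry T j i * c i))%:E) < +oo)%E.
  under eq_esum do rewrite EFinD.
  rewrite esumD => [|i _|i _]; rewrite ?lee_fin ?exprn_ge0 ?cabs_ge0//.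
  by rewrite lte_add_pinfty//; exact/ell2P.
have [s us tail] := esum_tail f0 fy e0.
have tail1 : (esum [set: I] (fun i => (cabs (entry T j i * rest s i))%:E) <= (eps / 4)%:E)%E.
  apply: (@le_trans _ _ e%:E); last by rewrite lee_fin ge_min lexx.
  apply: le_trans tail; apply: le_esum => i _; rewrite lee_fin /rest.
  by case: ifP => _; rewrite ?mulr0 ?cabs0// lerDr exprn_ge0// cabs_ge0.
have tail2 : (ell_norm 2%:E (rest s) <= (eps / (2 * (M + 1)))%:E)%E.
  have E0 : 0 <= eps / (2 * (M + 1)) by rewrite divr_ge0 ?(ltW eps0)// mulr_ge0// ltW.
  rewrite ell2E (_ : (_ / _)%:E = (((eps / (2 * (M + 1))) ^+ 2)%:E `^ 2^-1)%E); last first.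
    by rewrite poweR_EFin -powR_mulrn// -powRrM mulfV// powRr1.
  apply: gt0_ler_poweR; rewrite ?in_itv /= ?leey ?lee_fin ?exprn_ge0//.
    by rewrite esum_ge0// => i _; rewrite lee_fin exprn_ge0// cabs_ge0.
  apply: (@le_trans _ _ e%:E); last by rewrite lee_fin ge_min lexx orbT.
  apply: le_trans tail; apply: le_esum => i _; rewrite lee_fin /rest.
  by case: ifP => _; rewrite ?cabs0 ?expr0n// lerDl cabs_ge0.
have -> : T c j - matrix_act (entry T) c j =
    T (rest s) j - csum (fun i => entry T j i * rest s i).
  have -> : matrix_act (entry T) c j =
      csum (fun i => entry T j i * cut s i) + csum (fun i => entry T j i * rest s i).
    rewrite -csumD//; congr csum; apply/funext => i; rewrite {1}(split s) mul1r mulrDr//.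
  rewrite {1}(split s) (bop_linear bT _ (cut2 s) (rest2 s)) mul1r Tcut//.
  by ring.
rewrite (le_trans (cabsD _ _))// [leRHS]splitr lerD//.
  rewrite -lee_fin; apply: (@le_trans _ _ (ell_norm 2%:E (T (rest s)))).
    rewrite ell_normE; apply: (@lnorm_ge_term _ 2%:E _ _ (fun j => cabs (T (rest s) j))).
      by rewrite lee_fin ler1n.
    by move=> j'; exact: cabs_ge0.
  apply: le_trans (MP _ (rest2 s)) _; apply: le_trans (lee_wpmul2l _ tail2) _.
    by rewrite lee_fin /M.
  rewrite -EFinM lee_fin [leLHS](_ : _ = eps / 2 * (M / (M + 1))); last first.
    by field; rewrite gt_eqF.
  rewrite ler_piMr ?divr_ge0 ?(ltW eps0)//.
  by rewrite ler_pdivrMr// mul1r lerDl.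
rewrite (_ : cabs (- _) = cabs (csum (fun i => entry T j i * rest s i))); last first.
  by apply: complexI; rewrite -!norm_cabs normrN.
rewrite -lee_fin; apply: le_trans (csum_cabs _) _.
apply: le_trans (lee_wpmul2l _ tail1) _; first by rewrite lee_fin.
by rewrite -EFinM lee_fin; lra.
Qed.
End OperatorMatrix.

(** The matrix of [P] is applied to one of its own columns, which lies in l^2 as the image of a
    basis vector. *)
Lemma entry_idem (R : realType) (I : choiceType) (P : (I -> R[i]) -> (I -> R[i])) :
  bounded_operator P -> (forall c, ell 2%:E c -> P (P c) = P c) ->
  (forall i l, csummable (fun k => entry P i k * entry P k l)) ->
  forall i l, csum (fun k => entry P i k * entry P k l) = entry P i l.
Proof.
move=> bP PP sP i l.
have e2 : ell 2%:E (fun i : I => (i == l)%:R : R[i]) := @delta_ell2 R I l.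
have u2 : ell 2%:E (P (fun i : I => (i == l)%:R)).
  have [M MP] := bop_bounded bP; apply: le_lt_trans (MP _ e2) _.
  rewrite -(@fineK _ (ell_norm _ _)) -?EFinM ?ltry// ge0_fin_numE// ell_normE lnorm_ge0//.
  by rewrite lee_fin ler1n.
have := bop_matrix_act bP u2 (sP i l); rewrite (PP _ e2) => E.
exact: (esym E).
Qed.

(** * Haar measure *)

Section BorelStructure.
Variables (R : realType) (G : expLieGroup R).
Local Notation n := (lg_dim G).

(** Cubes of the chart with rational centres and radii [1 / (m + 1)]: a base of the topology with a
    countable index type. *)
Definition chart_ball (q : {ffun 'I_n -> rat} * nat) : set G :=
  [set x | forall i, `|lg_log x ord0 i - ratr (q.1 i)| < q.2.+1%:R^-1].

Lemma chart_ball_open q : open (chart_ball q).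
Proof.
have -> : chart_ball q = @lg_log R G @^-1`
    ball (\row_i ratr (q.1 i) : 'rV[R]_n) (q.2.+1%:R^-1 : R).
  apply/seteqP; split => x /=.
    move=> h; split=> [|i j]; first by rewrite invr_gt0.
    by rewrite ord1 mxE -ball_normE /= distrC; exact: h.
  by move=> [_ h] i; have := h ord0 i; rewrite mxE -ball_normE /= distrC.
apply: open_comp; last by apply: ball_open; rewrite invr_gt0.
by move=> x _; exact: lg_log_continuous.
Qed.

Lemma chart_ball_base (x : G) (A : set G) : nbhs x A ->
  exists2 q, chart_ball q x & chart_ball q `<=` A.
Proof.
move=> xA; have : nbhs (lg_log x) (@lg_exp R G @^-1` A).
  by apply: lg_exp_continuous; rewrite lg_logK.
move=> /nbhs_ballP[e /= e0 eA].
have [m me] : exists m : nat, 2 * m.+1%:R^-1 < e.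
  exists (Num.truncn (2 / e)); rewrite mulrC ltr_pdivrMl//.
  rewrite -ltr_pdivrMr//; exact: truncnS_gt.
have m0 : 0 < m.+1%:R^-1 :> R by rewrite invr_gt0.
have [q qP] : exists q : {ffun 'I_n -> rat}, forall i, `|lg_log x ord0 i - ratr (q i)| < m.+1%:R^-1.
  have ex i : exists r : rat, `|lg_log x ord0 i - ratr r| < m.+1%:R^-1.
    have lt : lg_log x ord0 i - m.+1%:R^-1 < lg_log x ord0 i + m.+1%:R^-1.
      by rewrite ltrD2l gtrN.
    have [r] := rat_in_itvoo lt; rewrite in_itv /= => /andP[r1 r2].
    by exists r; rewrite distrC ltr_norml ltrBlDl ltrBrDl r1.
  exists [ffun i => projT1 (cid (ex i))] => i; rewrite ffunE.
  by case: (cid (ex i)).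
exists (q, m) => [//|y yq]; rewrite -[y]lg_logK; apply: eA; split=> // i j.
rewrite ord1 -ball_normE /=; have := yq j; have := qP j => /= h1 h2.
rewrite (le_lt_trans _ me)// (le_trans (ler_distD (ratr (q j)) _ _))//.
by rewrite mulr_natl mulr2n lerD// ltW// distrC.
Qed.

Lemma measurable_open (U : set G) : open U -> measurable (U : set (borel G)).
Proof. exact: sub_sigma_algebra. Qed.

(* The Borel sigma-algebra of the product is the product sigma-algebra because
   [G] has a countable base. *)
Lemma measurable_prod_open (O : set (G * G)) : open O ->
  measurable (O : set (borel G * borel G)%type).
Proof.
move=> oO.
have -> : O = \bigcup_(q in [set q | chart_ball q.1 `*` chart_ball q.2 `<=` O])
    (chart_ball q.1 `*` chart_ball q.2).
  apply/seteqP; split => [[x y] Oxy|z [q qO qz]]; last exact: qO.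
  have [[A B] /= [xA yB] AB] := open_nbhs_nbhs (conj oO Oxy).
  have [a ax aA] := chart_ball_base xA.
  have [b bx bB] := chart_ball_base yB.
  by exists (a, b) => //= z [/= /aA ? /bB ?]; exact: AB.
rewrite bigcup_mkcond; apply: countable_bigcupT_measurable => [|q]; first exact: countableP.
by case: ifPn => // _; apply: measurableX; apply: measurable_open; exact: chart_ball_open.
Qed.

Lemma measurable_preimage_prod (f : G * G -> G) (A : set (borel G)) : continuous f ->
  measurable A -> measurable (f @^-1` A : set (borel G * borel G)%type).
Proof.
move=> cf mA.
have mf : measurable_fun [set: (borel G * borel G)%type] (f : _ -> borel G).
  apply: (@measurability _ _ _ (borel G) _ _ (@open G)) => // _ [U oU <-].
  rewrite setTI; apply: measurable_prod_open; apply: open_comp => // x _; exact: cf.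
by rewrite -[_ @^-1` _]setTI; exact: mf.
Qed.

Lemma measurable_preimage (f : G -> G) (A : set (borel G)) : continuous f ->
  measurable A -> measurable (f @^-1` A : set (borel G)).
Proof.
move=> cf mA; have mf : measurable_fun [set: borel G] (f : _ -> borel G).
  apply: (@measurability _ _ _ (borel G) _ _ (@open G)) => // _ [U oU <-].
  rewrite setTI; apply: measurable_open; apply: open_comp => // x _; exact: cf.
by rewrite -[_ @^-1` _]setTI; exact: mf.
Qed.

Lemma continuous_mulg (T : topologicalType) (f g : T -> G) : continuous f ->
  continuous g -> continuous (fun x => f x * g x)%g.
Proof.
move=> cf cg x; apply: (@continuous_comp _ _ _ (fun x => (f x, g x)) (fun p => p.1 * p.2)%g).
  by apply: cvg_pair; [exact: cf|exact: cg].
exact: mulg_continuous.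
Qed.

Lemma continuous_invg (T : topologicalType) (f : T -> G) : continuous f ->
  continuous (fun x => (f x)^-1)%g.
Proof.
move=> cf x; apply: (@continuous_comp _ _ _ f (fun p => p^-1)%g); [exact: cf|].
exact: invg_continuous.
Qed.

End BorelStructure.

(** Bernoulli's inequality for [d = c ^ (1 / (m + 1))]: [d ^ k] grows at least linearly, hence
    [c ^ k] at least like [k ^ (m + 1)]. *)
Lemma exp_not_polynomial (R : realType) (c K : R) m : 1 < c ->
  ~ (forall k, c ^+ k <= K * k.+1%:R ^+ m).
Proof.
move=> c1 cK; have c0 : 0 <= c by rewrite (le_trans _ (ltW c1)).
pose d := c `^ m.+1%:R^-1.
have d0 : 0 <= d by rewrite powR_ge0.
have dm : d ^+ m.+1 = c.
  by rewrite -powR_mulrn// -powRrM mulVf ?pnatr_eq0// powRr1.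
have d1 : 1 < d.
  by rewrite ltNge; apply: contraL c1 => dle; rewrite -leNgt -dm exprn_ile1.
pose a := Num.min 1 (d - 1).
have a0 : 0 < a by rewrite lt_min ltr01 subr_gt0.
have bernoulli k : a * k.+1%:R <= d ^+ k.
  elim: k => [|k IH]; first by rewrite mulr1 expr0 ge_min lexx.
  rewrite exprS -natr1 mulrDr mulr1 -[X in X * d ^+ k](subrK 1) mulrDl mul1r addrC lerD//.
  rewrite (@le_trans _ _ (d - 1)) ?ge_min ?lexx ?orbT//.
  by rewrite ler_peMr ?subr_ge0 ?(ltW d1)// exprn_ege1// ltW.
pose k := Num.truncn (K / a ^+ m.+1).
have : a ^+ m.+1 * k.+1%:R <= K.
  rewrite -(@ler_pM2r _ (k.+1%:R ^+ m)) ?exprn_gt0// -mulrA -exprS -exprMn.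
  apply: le_trans (cK k); rewrite -dm -exprM mulnC exprM.
  by rewrite lerXn2r ?nnegrE ?mulr_ge0 ?exprn_ge0 ?(ltW a0).
rewrite leNgt => /negP; apply; rewrite mulrC -ltr_pdivrMr ?exprn_gt0//.
exact: truncnS_gt.
Qed.

(** * Null sets and the modular function *)

Section Haar.
Variables (R : realType) (G : homogeneousGroup R) (N : G -> R).
Hypothesis hN : homogeneous_norm N.
Variable mu : {sigma_finite_measure set (borel G) -> \bar R}.
Hypothesis hmu : haar_measure mu.
Implicit Types (A E : set (borel G)) (x y z : G).

Lemma haar_translate x A : measurable A -> mu [set y : G | A (x * y)%g] = mu A.
Proof.
move=> mA; rewrite -[RHS](haar_left_invariant hmu x^-1%g mA); congr (mu _).
apply/seteqP; split => [y Ay|_ [y Ay <-]] /=; last by rewrite mulVKg.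
by exists (x * y)%g => //; rewrite mulKg.
Qed.

Lemma section_tonelli (S : set (borel G * borel G)) : measurable S ->
  (\int[mu]_x mu (xsection S x) = \int[mu]_y mu (ysection S y))%E.
Proof.
move=> mS; have := indic_fubini_tonelli mu mu mS.
by rewrite indic_fubini_tonelli_FE// indic_fubini_tonelli_GE.
Qed.

Lemma measurable_mulr y A : measurable A -> measurable ([set x : G | A (x * y)%g] : set (borel G)).
Proof.
apply: (@measurable_preimage _ _ (fun x : G => x * y)%g).
by apply: continuous_mulg; [move=> ?; exact: cvg_id|move=> ?; exact: cvg_cst].
Qed.

Lemma measurable_mull y A : measurable A -> measurable ([set x : G | A (y * x)%g] : set (borel G)).
Proof.
apply: (@measurable_preimage _ _ (fun x : G => y * x)%g).
by apply: continuous_mulg; [move=> ?; exact: cvg_cst|move=> ?; exact: cvg_id].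
Qed.

Lemma measurable_inv A : measurable A -> measurable ([set x : G | A x^-1%g] : set (borel G)).
Proof.
apply: (@measurable_preimage _ _ (fun x : G => x^-1)%g).
by apply: continuous_invg => ?; exact: cvg_id.
Qed.

Lemma measurable_hball r x : measurable (hball N r x : set (borel G)).
Proof.
apply: measurable_open; rewrite /hball.
have -> : [set y | N (x^-1 * y)%g < r] = (fun y => N (x^-1 * y)%g) @^-1` [set t | t < r] by [].
apply: open_comp; last exact: open_lt.
move=> y _; apply: (@continuous_comp _ _ _ (fun y => (x^-1 * y)%g) N); last exact: (hn_continuous hN).
by apply: continuous_mulg => ?; [exact: cvg_cst|exact: cvg_id].
Qed.

(** Both sides are the product measure of [S]. Its sections at [x] in [A] are translates of the
    inverse of [E]; over [y], the substitution [x = y * z] turns [S] into [S']. *)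
Lemma haar_convolution A E : measurable A -> measurable E ->
  (mu A * mu [set y : G | E y^-1%g] = \int[mu]_(z in E) mu [set y : G | A (y * z)%g])%E.
Proof.
move=> mA mE.
pose S : set (borel G * borel G) := [set p | A p.1 /\ E ((p.2 : G)^-1 * (p.1 : G))%g].
have mS : measurable S.
  apply: measurableI.
    by apply: (@measurable_preimage_prod _ _ (fun p : G * G => p.1)) => // ?; exact: cvg_fst.
  apply: (@measurable_preimage_prod _ _ (fun p : G * G => p.2^-1 * p.1)%g) => //.
  apply: continuous_mulg => [|?]; last exact: cvg_fst.
  by apply: continuous_invg => ?; exact: cvg_snd.
pose S' : set (borel G * borel G) := [set p | A ((p.1 : G) * (p.2 : G))%g /\ E p.2].
have mS' : measurable S'.
  apply: measurableI; last first.
    by apply: (@measurable_preimage_prod _ _ (fun p : G * G => p.2)) => // ?; exact: cvg_snd.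
  apply: (@measurable_preimage_prod _ _ (fun p : G * G => p.1 * p.2)%g) => //.
  by apply: continuous_mulg => [?|?]; [exact: cvg_fst|exact: cvg_snd].
transitivity (\int[mu]_x mu (xsection S x))%E.
  rewrite muleC -integral_cst// integral_mkcond; apply: eq_integral => x _.
  rewrite patchE; case: ifPn => [/set_mem Ax|nAx].
    rewrite -(haar_translate x^-1%g) /=; last exact: measurable_inv.
    congr (mu _); apply/seteqP; split => y /=; rewrite /xsection /= invgM invgK.
      by move=> h; rewrite inE; split.
    by rewrite inE => -[].
  rewrite (_ : xsection S x = set0) ?measure0//; apply/seteqP; split => y //=.
  by rewrite /xsection /= inE => -[/= Ax]; move: nAx; rewrite notin_setE.
rewrite section_tonelli//.
transitivity (\int[mu]_y mu (xsection S' y))%E.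
  apply: eq_integral => y _; rewrite -(haar_translate y); last exact: measurable_ysection.
  congr (mu _); apply/seteqP; split => z /=; rewrite /xsection /ysection /= !inE.
    by move=> -[/= ?]; rewrite mulKg => ?; split.
  by move=> -[/= ? ?]; split; rewrite //= mulKg.
rewrite section_tonelli// [RHS]integral_mkcond; apply: eq_integral => z _.
rewrite patchE; case: ifPn => [/set_mem Ez|nEz].
  by congr (mu _); apply/seteqP; split => y /=; rewrite /ysection /= inE => // -[].
rewrite (_ : ysection S' z = set0) ?measure0//; apply/seteqP; split => y //=.
by rewrite /ysection /= inE => -[/= _ Ez]; move: nEz; rewrite notin_setE.
Qed.

Lemma haar_hball_gt0 r x : 0 < r -> (0 < mu (hball N r x))%E.
Proof.
move=> r0; apply: (haar_open hmu); last by exists x; rewrite /hball /= mulVg (N1 hN).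
rewrite /hball.
have -> : [set y | N (x^-1 * y)%g < r] = (fun y => N (x^-1 * y)%g) @^-1` [set t | t < r] by [].
apply: open_comp; last exact: open_lt.
move=> y _; apply: (@continuous_comp _ _ _ (fun y => (x^-1 * y)%g) N); last exact: (hn_continuous hN).
by apply: continuous_mulg => ?; [exact: cvg_cst|exact: cvg_id].
Qed.

Lemma norm_le_compact r : compact [set x | N x <= r].
Proof.
have [gc _] := exists_graded_chart G; have [m0 m00 mP] := norm_coord_bound gc hN.
have cN : continuous (fun X => N (gc_exp gc X)).
  move=> X; apply: (@continuous_comp _ _ _ (gc_exp gc) N); first exact: gc_exp_continuous.
  exact: hn_continuous.
have -> : [set x | N x <= r] = gc_exp gc @` [set X | N (gc_exp gc X) <= r].
  apply/seteqP; split => [x Nx|_ [X NX <-]//]; exists (gc_log gc x); last exact: gc_logK.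
  by rewrite /= gc_logK.
apply: continuous_compact.
  by apply: continuous_subspaceT => X; exact: gc_exp_continuous.
apply: bounded_closed_compact; last first.
  have -> : [set X | N (gc_exp gc X) <= r] = (fun X => N (gc_exp gc X)) @^-1` [set t | t <= r] by [].
  by apply: closed_comp => [X _|]; [exact: cN|exact: closed_le].
pose c : R := \sum_i (`|r| / m0) `^ gc_weight gc i.
have c0 : 0 <= c by apply: sumr_ge0 => i _; exact: powR_ge0.
exists c; split=> [|t ct X /= NX]; first exact: num_real.
rewrite (le_trans _ (ltW ct))//; apply: norm_le_coord => // i.
have := mP (gc_exp gc X) i; rewrite gc_expK => /le_trans; apply.
rewrite /c (bigD1 i)//= ler_wpDr ?sumr_ge0// => [j _|]; first exact: powR_ge0.
rewrite ge0_ler_powR ?nnegrE ?(ltW (weight_gt0 _ _)) ?divr_ge0 ?hn_ge0 ?(ltW m00)//.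
by rewrite ler_wpM2r ?invr_ge0 ?(ltW m00)// (le_trans NX)// ler_norm.
Qed.

Lemma measurable_norm_le r : measurable ([set x | N x <= r] : set (borel G)).
Proof.
have -> : [set x | N x <= r] = ~` [set x | r < N x].
  by apply/seteqP; split => x /=; rewrite leNgt => /negP.
apply: measurableC; apply: measurable_open.
have -> : [set x | r < N x] = N @^-1` [set t | r < t] by [].
by apply: open_comp => [x _|]; [exact: (hn_continuous hN)|exact: open_gt].
Qed.

Lemma haar_norm_le_lty r : (mu [set x | (N x <= r)%R] < +oo)%E.
Proof. by apply: (haar_compact hmu); exact: norm_le_compact. Qed.

Lemma haar_seqU (I : eqType) (F : I -> set (borel G)) (s : seq I) :
  (forall i, measurable (F i)) ->
  measurable [set x | exists2 i, i \in s & F i x] /\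
  (mu [set x | exists2 i, i \in s & F i x] <= \sum_(i <- s) mu (F i))%E.
Proof.
move=> mF; elim: s => [|i s [mU le]].
  have -> : [set x | exists2 i, i \in [::] & F i x] = set0 by apply/seteqP; split => x //= -[].
  by rewrite measure0 big_nil; split.
have -> : [set x | exists2 j, j \in i :: s & F j x] = F i `|` [set x | exists2 j, j \in s & F j x].
  apply/seteqP; split => [x [j]|x [?|[j js ?]]].
  - by rewrite inE => /predU1P[->|js] ?; [left|right; exists j].
  - by exists i; rewrite ?mem_head.
  - by exists j; rewrite // inE js orbT.
split; first exact: measurableU.
by rewrite big_cons (le_trans (measureU2 _ _ _))// leeD2l.
Qed.

Lemma haar_poly_growth : exists2 C, 0 <= C & forall M, 1 <= M ->
  (mu [set x | (N x <= M)%R] <= (C * M `^ hom_dim G)%:E)%E.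
Proof.
have [gc _] := exists_graded_chart G.
have [C C0 CP] := norm_ball_cover gc hN ltr01.
pose v := fine (mu [set x | (N x <= 1)%R]).
have vE : mu [set x | (N x <= 1)%R] = v%:E.
  by rewrite fineK// ge0_fin_numE// haar_norm_le_lty.
have v0 : 0 <= v by rewrite fine_ge0.
exists (C * v) => [|M M1]; first by rewrite mulr_ge0.
have [L sL LP] := CP M M1.
pose F (h : G) : set (borel G) := [set x : G | N (h^-1 * x)%g <= 1].
have mF h : measurable (F h) by exact: (measurable_mull h^-1%g (measurable_norm_le 1)).
have FE h : mu (F h) = v%:E.
  by rewrite -vE /F (haar_translate h^-1%g (measurable_norm_le 1)).
have [mU le] := @haar_seqU _ F L mF.
have {}le : (mu [set x | (N x <= M)%R] <= \sum_(i <- L) mu (F i))%E.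
  apply: le_trans le.
  apply: (le_measure mu (mem_set (measurable_norm_le M)) (mem_set mU)).
  by move=> x /LP[h hL ?]; exists h.
apply: (le_trans le); under eq_bigr do rewrite FE.
rewrite sumEFin lee_fin big_const_seq count_predT iter_addr_0 mulrAC -[leLHS]mulr_natl ler_wpM2r//.
Qed.

Lemma measurable_haar_mulr A : measurable A ->
  measurable_fun [set: borel G] (fun z : borel G => mu [set y : G | A (y * (z : G))%g]).
Proof.
move=> mA; pose S : set (borel G * borel G) := [set p | A ((p.1 : G) * (p.2 : G))%g].
have mS : measurable S.
  apply: (@measurable_preimage_prod _ _ (fun p : G * G => p.1 * p.2)%g) => //.
  by apply: continuous_mulg => [?|?]; [exact: cvg_fst|exact: cvg_snd].
have := measurable_fun_ysection mu mS; congr (measurable_fun _ _).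
apply/funext => z /=; congr (mu _); apply/seteqP.
by split => y /=; rewrite /ysection /= inE.
Qed.

(** In [haar_convolution] with the unit ball for [A] the integral over [E] vanishes, while the ball
    has positive measure. *)
Lemma haar_inv_null E : measurable E -> mu E = 0%E -> mu [set y : G | E y^-1%g] = 0%E.
Proof.
move=> mE E0; have mB := measurable_hball 1 1%g.
have := haar_convolution mB mE.
have := integral_abs_eq0 mE (measurable_funTS (measurable_haar_mulr mB)) E0.
under eq_integral do rewrite gee0_abs//.
move=> -> /eqP; rewrite mule_eq0 => /orP[/eqP B0|/eqP//].
by have := haar_hball_gt0 1%g ltr01; rewrite B0 ltxx.
Qed.

Lemma haar_null_mulr y E : measurable E -> mu E = 0%E -> mu [set x : G | E (x * y)%g] = 0%E.
Proof.
move=> mE E0; have mE' := measurable_inv mE.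
have -> : [set x : G | E (x * y)%g] = [set x : G | [set t : G | E t^-1%g] (y^-1 * x^-1)%g].
  by apply/seteqP; split => x /=; rewrite invgM !invgK.
apply: (@haar_inv_null [set x : G | [set t : G | E t^-1%g] (y^-1 * x)%g]).
  exact: measurable_mull.
by rewrite haar_translate//; exact: haar_inv_null.
Qed.

Lemma ae_mulr (P : G -> Prop) y : (\forall x \ae mu, P x) ->
  \forall x \ae mu, P (x * y)%g.
Proof.
move=> [B [mB B0 PB]]; exists [set x : G | B (x * y)%g]; split.
- exact: measurable_mulr.
- exact: haar_null_mulr.
- by move=> x /= nP; exact: PB.
Qed.

Lemma haar_setT_gt0 : (0 < mu setT)%E.
Proof. by apply: (haar_open hmu); [exact: openT|exists 1%g]. Qed.

Section Modular.
Variables (A : set (borel G)) (r : R).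
Hypotheses (mA : measurable A) (Ar : forall x, A x -> N x <= r).
Hypothesis A_gt0 : (0 < mu A)%E.

(** Divided by the measure of [A], this is the modular function, up to the convention of inverting
    its argument. *)
Let phi y : R := fine (mu [set x : G | A (x * y)%g]).

Let phiE y : mu [set x : G | A (x * y)%g] = (phi y)%:E.
Proof.
rewrite fineK// ge0_fin_numE//; apply: le_lt_trans (haar_norm_le_lty (r + N y)).
apply: (le_measure mu (mem_set (measurable_mulr y mA)) (mem_set (measurable_norm_le _))).
move=> x /= /Ar xy; rewrite -[x](mulgK y) (le_trans (hn_mul hN _ _))//.
by rewrite (hn_inv hN) lerD2r.
Qed.

Let phi_ge0 y : 0 <= phi y. Proof. exact: fine_ge0. Qed.

Let phi1E : (phi 1%g)%:E = mu A.
Proof. by rewrite -phiE; congr (mu _); apply/seteqP; split => x /=; rewrite mulg1. Qed.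

Let phi_gt0 y : 0 < phi y.
Proof.
rewrite lt_neqAle phi_ge0 andbT eq_sym; apply/eqP => p0.
have := haar_null_mulr y^-1%g (measurable_mulr y mA); rewrite phiE p0 => /(_ erefl).
have -> : [set x : G | [set x : G | A (x * y)%g] (x * y^-1)%g] = A.
  by apply/seteqP; split => x /=; rewrite mulgVK.
by move=> A0; move: A_gt0; rewrite A0 ltxx.
Qed.

(** By [haar_convolution] for [A] and for a right translate of [A], both sides have the same
    integral over every measurable set. Norm balls of integer radius supply integrability. *)
Let phi_ae w : \forall z \ae mu, phi 1%g * phi (z * w)%g = phi w * phi z.
Proof.
have key (M : nat) : \forall z \ae mu, N z <= M%:R -> phi w * phi z = phi 1%g * phi (z * w)%g.
  pose D := [set x : borel G | N x <= M%:R]; have mD : measurable D := measurable_norm_le _.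
  pose f (z : borel G) := ((phi w)%:E * mu [set x : G | A (x * (z : G))%g])%E.
  pose g (z : borel G) := ((phi 1%g)%:E * mu [set x : G | [set t : G | A (t * w)%g] (x * (z : G))%g])%E.
  have mf : measurable_fun setT f.
    by apply: measurable_funeM; exact: measurable_haar_mulr.
  have mg : measurable_fun setT g.
    apply: measurable_funeM.
    exact: (measurable_haar_mulr (measurable_mulr w mA)).
  have If E : measurable E ->
      (\int[mu]_(z in E) f z = (phi w)%:E * ((phi 1%g)%:E * mu [set y : G | E y^-1%g]))%E.
    move=> mE; rewrite phi1E (haar_convolution mA mE) ge0_integralZl_EFin//.
    by apply: measurable_funTS; exact: measurable_haar_mulr.
  have Ig E : measurable E ->
      (\int[mu]_(z in E) g z = (phi w)%:E * ((phi 1%g)%:E * mu [set y : G | E y^-1%g]))%E.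
    move=> mE; have mAw := measurable_mulr w mA.
    rewrite muleCA -[X in (_ * (X * _))%E]phiE (haar_convolution mAw mE) ge0_integralZl_EFin//.
    by apply: measurable_funTS; exact: measurable_haar_mulr.
  have : ae_eq mu D f g.
    apply: integral_ae_eq => //; [|exact: measurable_funTS|by move=> E _ mE; rewrite If// Ig].
    apply/integrableP; split; first exact: measurable_funTS.
    under eq_integral do rewrite gee0_abs ?mule_ge0 ?lee_fin//.
    rewrite If// !lte_mul_pinfty// ?lee_fin//.
    have -> : [set y : G | D y^-1%g] = D by apply/seteqP; split => x; rewrite /D /= (hn_inv hN).
    exact: haar_norm_le_lty.
  apply: filterS => z fg Nz; have := fg Nz; rewrite /f /g phiE.
  have -> : [set x : G | [set t : G | A (t * w)%g] (x * (z : G))%g] = [set x : G | A (x * (z * w))%g].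
    by apply/seteqP; split => x /=; rewrite mulgA.
  by rewrite phiE -!EFinM => -[].
have := ae_foralln key; apply: filterS => z /(_ (Num.truncn (N z)).+1) ->//.
exact/ltW/truncnS_gt.
Qed.

(** A point [y] at which three instances of the almost everywhere identity hold at once gives it at
    every [z] and [w]. *)
Let phiM z w : phi 1%g * phi (z * w)%g = phi z * phi w.
Proof.
have pf := ae_properfilter_algebraOfSetsType haar_setT_gt0.
have [y [[y1 y2] y3]] := filter_ex (filterI (filterI (phi_ae (z * w)%g) (ae_mulr z (phi_ae w))) (phi_ae z)).
apply: (mulIf (lt0r_neq0 (phi_gt0 y))); move: y1 y2 y3; rewrite !mulgA => y1 y2 y3.
rewrite -mulrA -y1 y2 mulrCA y3; ring.
Qed.

(** The right translates of [A] by powers of [w] stay in balls of radius linear in the exponent,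
    which rules out a ratio [c > 1]. *)
Let phi_le w : phi w <= phi 1%g.
Proof.
rewrite leNgt; apply/negP => lt1.
pose c := phi w / phi 1%g.
have c1 : 1 < c by rewrite ltr_pdivlMr// mul1r.
have pX k : phi (w ^+ k)%g = phi 1%g * c ^+ k.
  elim: k => [|k IH]; first by rewrite expr0 mulr1.
  apply: (mulfI (lt0r_neq0 (phi_gt0 1%g))); rewrite expgS phiM IH exprS /c.
  by field; exact: lt0r_neq0.
have NX k : N (w ^+ k)%g <= k%:R * N w.
  elim: k => [|k IH]; first by rewrite mul0r (N1 hN).
  by rewrite expgS (le_trans (hn_mul hN _ _))// -nat1r mulrDl mul1r lerD2l.
have [C C0 CP] := haar_poly_growth.
pose m := (Num.truncn (hom_dim G)).+1; pose b := 1 + `|r| + N w.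
have b1 : 1 <= b by rewrite /b -addrA lerDl addr_ge0// hn_ge0.
apply: (@exp_not_polynomial _ c ((C * b ^+ m) / phi 1%g) m c1) => k.
rewrite mulrAC ler_pdivlMr// mulrC -pX -lee_fin -phiE.
have bk : 1 <= b * k.+1%:R by rewrite mulr_ege1// ler1n.
apply: le_trans (le_trans (CP _ bk) _).
  apply: (le_measure mu (mem_set (measurable_mulr _ mA)) (mem_set (measurable_norm_le _))).
  move=> x /= /Ar xy; rewrite -[x](mulgK (w ^+ k)%g) (le_trans (hn_mul hN _ _))//.
  rewrite (hn_inv hN) (le_trans (lerD xy (NX k)))// /b -natr1 mulrDr mulr1 addrC.
  rewrite lerD//; last by rewrite (le_trans (ler_norm r))// -addrA addrCA lerDl addr_ge0 ?hn_ge0.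
  by rewrite mulrC ler_wpM2r// lerDr addr_ge0.
rewrite lee_fin -mulrA -exprMn ler_wpM2l// -powR_mulrn ?(le_trans ler01)//.
by rewrite ler_powR// ltW// truncnS_gt.
Qed.

(* The modular function is a homomorphism bounded by a polynomial along the
   powers of [w], hence trivial. *)
Lemma haar_right_invariant y : mu [set x : G | A (x * y)%g] = mu A.
Proof.
rewrite -phi1E phiE; congr EFin; apply/eqP; rewrite eq_le phi_le /=.
have := phiM y y^-1%g; rewrite mulgV => e.
rewrite -(@ler_pM2r _ (phi 1%g))// e ler_pM2l//.
Qed.

End Modular.

End Haar.

Lemma ae_seq d (X : measurableType d) (R : realType) (nu : {measure set X -> \bar R})
    (I : eqType) (L : seq I) (P : I -> X -> Prop) :
  (forall a, a \in L -> \forall p \ae nu, P a p) ->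
  \forall p \ae nu, forall a, a \in L -> P a p.
Proof.
elim: L => [|a L IH] h; first exact: aeW.
have h1 := h a (mem_head _ _).
have h2 : \forall p \ae nu, forall b, b \in L -> P b p.
  by apply: IH => b bL; apply: h; rewrite inE bL orbT.
by apply: filterS2 h1 h2 => p Pa PL b; rewrite inE => /predU1P[->//|/PL].
Qed.

Lemma lt_seq_bound (R : realType) (I : eqType) (f : I -> \bar R) (c : \bar R) (L : seq I) :
  (0 < c)%E -> (forall a, a \in L -> (f a < c)%E) ->
  exists t, [/\ (0 <= t)%E, (t < c)%E & forall a, a \in L -> (f a <= t)%E].
Proof.
move=> c0; elim: L => [|a L IH] fc; first by exists 0%E.
have [|t [t0 tc tP]] := IH; first by move=> b bL; apply: fc; rewrite inE bL orbT.
exists (maxe t (f a)); split; first by rewrite le_max t0.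
  by rewrite gt_max tc fc ?mem_head.
move=> b; rewrite inE le_max => /predU1P[->|/tP ->//]; by rewrite lexx orbT.
Qed.

(** * The two-sided control function *)

Section Control.
Variables (R : realType) (G : homogeneousGroup R) (N : G -> R).
Hypothesis hN : homogeneous_norm N.
Variable mu : {sigma_finite_measure set (borel G) -> \bar R}.
Hypothesis hmu : haar_measure mu.
Implicit Types (x y z g : G) (P : G * G -> Prop).

Lemma ae_prod_mull g P : (\forall p \ae (mu \x mu)%E, P p) ->
  \forall p \ae (mu \x mu)%E, P (p.1, g * p.2)%g.
Proof.
move=> [B [mB B0 PB]].
pose B' : set (borel G * borel G) := [set p : G * G | B (p.1, g * p.2)%g].
have mf : measurable_fun setT ((fun p => (p.1, g * (p.2 : G))%g) : borel G * borel G -> borel G * borel G).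
  apply: measurable_fun_pair; first exact: measurable_fst.
  move=> _ C mC; rewrite setTI.
  apply: (@measurable_preimage_prod _ _ (fun p : G * G => g * p.2)%g) => //.
  by apply: continuous_mulg => ?; [exact: cvg_cst|exact: cvg_snd].
have mB' : measurable B' by rewrite -[B']setTI; exact: mf.
exists B'; split=> // [|p /= nP]; last exact: PB.
rewrite -B0 /= /product_measure1; apply: eq_integral => x _ /=.
rewrite -[RHS](haar_translate hmu g); last exact: measurable_xsection.
by congr (mu _); apply/seteqP; split => y /=; rewrite /xsection /= !inE.
Qed.

(** Tonelli reduces the claim to sections, and right translation preserves null sets. *)
Lemma ae_prod_mulr g P : (\forall p \ae (mu \x mu)%E, P p) ->
  \forall p \ae (mu \x mu)%E, P (p.1 * g, p.2)%g.
Proof.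
move=> [B [mB B0 PB]].
pose B' : set (borel G * borel G) := [set p : G * G | B (p.1 * g, p.2)%g].
have mf : measurable_fun setT ((fun p => ((p.1 : G) * g, p.2)%g) : borel G * borel G -> borel G * borel G).
  apply: measurable_fun_pair; last exact: measurable_snd.
  move=> _ C mC; rewrite setTI.
  apply: (@measurable_preimage_prod _ _ (fun p : G * G => p.1 * g)%g) => //.
  by apply: continuous_mulg => ?; [exact: cvg_fst|exact: cvg_cst].
have mB' : measurable B' by rewrite -[B']setTI; exact: mf.
exists B'; split=> // [|p /= nP]; last exact: PB.
have absE (C : set (borel G * borel G)) :
    (\int[mu]_y `|mu (ysection C y)| = \int[mu]_y mu (ysection C y))%E.
  by apply: eq_integral => y _; rewrite gee0_abs.
have B0' : (\int[mu]_y mu (ysection B y) = 0)%E by rewrite -section_tonelli.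
have := ae_eq_integral_abs mu measurableT (measurable_fun_ysection mu mB).
rewrite [X in X = _]absE => -[/(_ B0') aeB _].
rewrite [LHS](section_tonelli mu mB') -absE.
apply/(ae_eq_integral_abs mu measurableT (measurable_fun_ysection mu mB')).
apply: filterS aeB => y /(_ I) /= By _.
rewrite -[RHS](haar_null_mulr hN hmu g _ By); last exact: measurable_ysection.
by congr (mu _); apply/seteqP; split => x /=; rewrite /ysection /= !inE.
Qed.

Lemma prod_setT_gt0 : (0 < (mu \x mu)%E setT)%E.
Proof. by rewrite -setXTT product_measure1E// mule_gt0// haar_setT_gt0. Qed.

Lemma control_ge0 (F : G -> R) x : (0 <= control N mu F x)%E.
Proof.
apply: ess_sup_gee; first exact: prod_setT_gt0.
by apply: aeW => p; rewrite patchE; case: ifPn.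
Qed.

Lemma mem_hball1 (p : G * G) : (p \in hball N 1 1%g `*` hball N 1 1%g) = (N p.1 < 1) && (N p.2 < 1).
Proof.
by apply/idP/andP => [/set_mem[]|[? ?]]; rewrite ?inE /hball /= ?invg1 !mul1g.
Qed.

(** The pairs seen from [y] split into finitely many pieces, each mapped by some [T a] into the
    pairs seen from [z a]. If all the values at the [z a] were smaller, a common bound [t], still
    strictly smaller as [L] is finite, would be an essential bound at [y]. *)
Lemma control_le_cover (I : eqType) (L : seq I) (z : I -> G) (T : I -> G * G -> G * G)
    (F : G -> R) y :
  (forall a P, (\forall p \ae (mu \x mu)%E, P p) -> \forall p \ae (mu \x mu)%E, P (T a p)) ->
  (forall p : G * G, N p.1 < 1 -> N p.2 < 1 -> exists2 a, a \in L &
    [/\ N (T a p).1 < 1, N (T a p).2 < 1 & ((T a p).1 * z a * (T a p).2 = p.1 * y * p.2)%g]) ->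
  exists2 a, a \in L & (control N mu F y <= control N mu F (z a))%E.
Proof.
move=> Tae Tcov; apply: contrapT => nex.
have lt a : a \in L -> (control N mu F (z a) < control N mu F y)%E.
  by move=> aL; rewrite ltNge; apply/negP => le; apply: nex; exists a.
have N11 : N 1%g < 1 by rewrite (N1 hN).
have [a0 a0L _] := Tcov (1%g, 1%g) N11 N11.
have c0 := le_lt_trans (control_ge0 F (z a0)) (lt a0 a0L).
have [t [t0 tc tP]] := lt_seq_bound c0 lt.
move: tc; rewrite ltNge => /negP; apply.
apply/ess_supP.
pose f a : G * G -> \bar R := (fun p : borel G * borel G =>
  `|F ((p.1 : G) * z a * (p.2 : G))%g|%:E) \_ (hball N 1 1%g `*` hball N 1 1%g).
have : \forall p \ae (mu \x mu)%E, forall a, a \in L -> (f a (T a p) <= t)%E.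
  apply: ae_seq => a aL; apply: (Tae a (fun p => is_true (f a p <= t)%E)).
  by apply/ess_supP; exact: tP.
have fl : Filter (almost_everywhere (mu \x mu)%E) by exact: ae_filter_ringOfSetsType.
apply: (@filterS _ _ fl) => p h; rewrite patchE mem_hball1; case: ifPn => // /andP[p1 p2].
have [a aL [T1 T2 e]] := Tcov p p1 p2.
by have := h a aL; rewrite /f patchE mem_hball1 T1 T2 /= e.
Qed.

(** [L] covers the unit ball by balls of radius 1/4, so the new right factor has norm below 1/2 +
    1/4. As one [a] must serve all [w], a counterexample [w a] is chosen for each [a], and the
    covering is applied to the points [y * a * w a]. *)
Lemma control_right_cover : exists L : seq G, forall (F : G -> R) y,
  exists2 a, a \in L & forall w, N w < 2^-1 ->
    (control N mu F y <= control N mu F (y * a * w)%g)%E.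
Proof.
have [gc _] := exists_graded_chart G.
have q0 : 0 < 4^-1 :> R by rewrite invr_gt0.
have [C _ /(_ 1 (lexx _))[L _ LP]] := norm_ball_cover gc hN q0.
exists L => F y; apply: contrapT => nex.
have ex a : exists w, a \in L -> N w < 2^-1 /\ ~ (control N mu F y <= control N mu F (y * a * w)%g)%E.
  have [aL|naL] := boolP (a \in L); last by exists 1%g.
  apply: contrapT => nw; apply: nex; exists a => // w Nw; apply: contrapT => n.
  by apply: nw; exists w.
have [w wP] := choice ex.
have [||a aL le] := @control_le_cover _ L (fun a => y * a * w a)%g
    (fun a p => (p.1, (a * w a)^-1 * p.2)%g) F y.
- by move=> a P; exact: ae_prod_mull.
- move=> p p1 p2; have [a aL aP] := LP p.2 (ltW p2).
  exists a => //; have [Nw _] := wP a aL; split => //=; last first.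
    by rewrite invgM !mulgA -!mulgA mulVKg mulVKg.
  rewrite invgM -mulgA (le_lt_trans (hn_mul hN _ _))// (hn_inv hN).
  by move: aP Nw; lra.
by have [_] := wP a aL.
Qed.

Lemma control_left_cover : exists L : seq G, forall (F : G -> R) y,
  exists2 a, a \in L & forall w, N w < 2^-1 ->
    (control N mu F y <= control N mu F (w * (a * y))%g)%E.
Proof.
have [gc _] := exists_graded_chart G.
have q0 : 0 < 4^-1 :> R by rewrite invr_gt0.
have [C _ /(_ 1 (lexx _))[L _ LP]] := norm_ball_cover gc hN q0.
exists [seq a^-1%g | a <- L] => F y; apply: contrapT => nex.
have ex a : exists w, a \in L -> N w < 2^-1 /\ ~ (control N mu F y <= control N mu F (w * (a^-1 * y))%g)%E.
  have [aL|naL] := boolP (a \in L); last by exists 1%g.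
  apply: contrapT => nw; apply: nex; exists a^-1%g; first by apply/mapP; exists a.
  by move=> w Nw; apply: contrapT => n; apply: nw; exists w.
have [w wP] := choice ex.
have [||a aL le] := @control_le_cover _ L (fun a => w a * (a^-1 * y))%g
    (fun a p => (p.1 * (a * (w a)^-1), p.2)%g) F y.
- by move=> a P; exact: ae_prod_mulr.
- move=> p p1 p2; have := LP p.1^-1%g; rewrite (hn_inv hN) => /(_ (ltW p1))[a aL aP].
  exists a => //; have [Nw _] := wP a aL; split => //=; last first.
    by congr (_ * _)%g; rewrite -!mulgA mulKg mulVKg.
  rewrite mulgA (le_lt_trans (hn_mul hN _ _))// (hn_inv hN).
  have -> : N (p.1 * a)%g = N (a^-1 * p.1^-1)%g by rewrite -(hn_inv hN) invgM.
  by move: aP Nw; lra.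
by have [_] := wP a aL.
Qed.

End Control.

(** * Row and column sums of matrices dominated by amalgam functions *)

Section Amalgam.
Variables (R : realType) (G : homogeneousGroup R) (N : G -> R).
Hypothesis hN : homogeneous_norm N.
Variable mu : {sigma_finite_measure set (borel G) -> \bar R}.
Hypothesis hmu : haar_measure mu.
Implicit Types (x y z w : G).

Lemma le_integral_ge0 (h f : borel G -> \bar R) : (forall x, 0 <= h x)%E ->
  (forall x, h x <= f x)%E -> (\int[mu]_x h x <= \int[mu]_x f x)%E.
Proof.
move=> h0 hf; have f0 x : (0 <= f x)%E by exact: le_trans (h0 x) (hf x).
rewrite !ge0_integralTE//; apply: ge_ereal_sup => _ [u /= uh <-].
by apply: ereal_sup_ubound; exists u => //= x; exact: le_trans (uh x) (hf x).
Qed.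

(* [f] need not be measurable: its integral is only compared with that of a
   step function below it. *)
Lemma packing_bound (I : eqType) (s : seq I) (E : I -> set (borel G)) (t : I -> R)
    (m n : R) (f : borel G -> \bar R) : 0 < n ->
  (forall i, measurable (E i)) -> (forall i, mu (E i) = m%:E) -> (forall i, 0 <= t i) ->
  (forall z, 0 <= f z)%E -> (forall i z, E i z -> ((t i)%:E <= f z)%E) ->
  (forall z, (count (fun i => z \in E i) s)%:R <= n) ->
  (((\sum_(i <- s) t i) * m / n)%:E <= \int[mu]_z f z)%E.
Proof.
move=> n0 mE Em t0 f0 tf cn.
pose h i (z : borel G) : \bar R := ((t i / n)%:E * (\1_(E i) z)%:E)%E.
have h0 i z : (0 <= h i z)%E by rewrite mule_ge0// lee_fin divr_ge0 ?(ltW n0).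
have mh i : measurable_fun setT (h i).
  by apply: measurable_funeM; apply/measurable_EFinP; exact: measurable_indic.
have Ih i : (\int[mu]_z h i z = (t i / n * m)%:E)%E.
  rewrite ge0_integralZl_EFin// ?divr_ge0 ?(ltW n0)//; last first.
    by apply/measurable_EFinP; exact: measurable_indic.
  by rewrite integral_indic// setIT [RHS]EFinM; congr (_ * _)%E; exact: Em.
have -> : ((\sum_(i <- s) t i) * m / n)%:E = (\int[mu]_z \sum_(i <- s) h i z)%E.
  rewrite ge0_integral_sum//.
  under [RHS]eq_bigr do rewrite Ih.
  by rewrite sumEFin mulrAC !mulr_suml.
apply: le_integral_ge0 => z; first by apply: sume_ge0.
have := tf ^~ z; have := f0 z; case: (f z) => [v v0 tv| |//]; last by move=> *; exact: leey.
have hE i : h i z = ((z \in E i)%:R * (t i / n))%:E by rewrite /h indicE -EFinM mulrC.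
under eq_bigr do rewrite hE.
rewrite sumEFin lee_fin -[leRHS](mulfK (lt0r_neq0 n0)).
apply: (@le_trans _ _ (\sum_(i <- s) (z \in E i)%:R * (v / n))).
  apply: ler_sum => i _; have [/set_mem zE|_] := boolP (z \in E i); last by rewrite !mul0r.
  by rewrite !mul1r ler_wpM2r ?invr_ge0 ?(ltW n0)// -lee_fin; exact: tv.
rewrite -mulr_suml -natr_sum mulrCA -mulrA ler_wpM2l// ler_wpM2r ?invr_ge0 ?(ltW n0)//.
rewrite (_ : (\sum_(i <- s) _)%N = count (fun i => z \in E i) s)//.
by rewrite -sum1_count [RHS]big_mkcond; apply: eq_bigr => i _; case: (z \in E i).
Qed.

Section Sum.
Variables (F : G -> R) (alpha : R) (k : nat) (L : set G) (M : R).
Hypotheses (F_Wst : Wst N mu alpha F) (F_control : controlled_pointwise N mu F).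
Hypotheses (k_alpha : k%:R <= alpha) (L_sep : relatively_separated N L) (M_ge1 : 1 <= M).

(** Each term is at most [kap] times the integrand at any point of [E l]; these sets have equal
    measure and bounded overlap, so [packing_bound] compares the sum with the amalgam norm. Leaving
    [y], [E] and [cen] free lets rows and columns share the estimate. *)
Lemma amalgam_sum_bound : exists2 K, 0 <= K &
  forall (y : L -> G) (E : L -> set (borel G)) (cen : G -> G),
    (forall l, measurable (E l)) -> (forall l, mu (E l) = mu (hball N 2^-1 1%g)) ->
    (forall l z, E l z -> [/\ (control N mu F (y l) <= control N mu F z)%E,
       N (y l) <= M + N z & N ((cen z)^-1 * val l)%g <= M]) ->
    forall s : seq L, uniq s -> \sum_(l <- s) `|F (y l)| * (1 + N (y l)) ^+ k <= K.
Proof.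
pose f (z : borel G) := (control N mu F z * (weight N alpha z)%:E)%E.
have f0 z : (0 <= f z)%E by rewrite mule_ge0 ?control_ge0// lee_fin powR_ge0.
have If : (\int[mu]_z f z)%E \is a fin_num.
  by rewrite ge0_fin_numE ?integral_ge0//; exact: F_Wst.2.
pose m := fine (mu (hball N 2^-1 1%g)).
have mE : mu (hball N 2^-1 1%g) = m%:E.
  rewrite fineK// ge0_fin_numE//; apply: le_lt_trans (haar_norm_le_lty hN hmu 2^-1).
  apply: (le_measure mu (mem_set (measurable_hball hN _ _)) (mem_set (measurable_norm_le hN _))).
  by move=> x; rewrite /hball /= invg1 mul1g => /ltW.
have m0 : 0 < m by rewrite -lte_fin -mE haar_hball_gt0// invr_gt0.
have [C C0 CP] := ball_count hN L_sep.
(* The overlap: [z] in [E l] confines [l] to the ball of radius [M] around [cen z]. The 1 makes [n]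
   positive. *)
pose n := C * M `^ hom_dim G + 1.
have n0 : 0 < n by rewrite ltr_wpDl// mulr_ge0// powR_ge0.
pose kap := (1 + M) ^+ k.
have M0 : 0 <= M by rewrite (le_trans _ M_ge1).
have kap0 : 0 < kap by rewrite exprn_gt0// ltr_wpDr.
pose J := fine (\int[mu]_z f z)%E.
have J0 : 0 <= J by rewrite fine_ge0// integral_ge0.
exists (J * n / m * kap) => [|y E cen mEl El Ez s us].
  by rewrite !mulr_ge0 ?invr_ge0// ltW.
rewrite -ler_pdivrMr// ler_pdivlMr// -ler_pdivrMr// mulr_suml -lee_fin fineK//.
apply: packing_bound => // [l|l|l z Elz|z].
- by rewrite El.
- by rewrite divr_ge0 ?(ltW kap0)// mulr_ge0 ?exprn_ge0 ?addr_ge0 ?hn_ge0.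
- have [c1 c2 _] := Ez l z Elz.
  apply: (@le_trans _ _ (`|F (y l)|%:E * (weight N alpha z)%:E)%E); last first.
    by rewrite lee_wpmul2r ?lee_fin ?powR_ge0// (le_trans (F_control _)).
  rewrite -EFinM lee_fin -mulrA ler_wpM2l// ler_pdivrMr// /kap.
  have z1 : 1 <= 1 + N z by rewrite lerDl hn_ge0.
  apply: (@le_trans _ _ ((1 + N z) ^+ k * (1 + M) ^+ k)).
    rewrite -exprMn lerXn2r ?nnegrE ?mulr_ge0 ?addr_ge0 ?hn_ge0//.
    rewrite mulrDl mul1r mulrDr mulr1 -addrA lerD2l (le_trans c2)// lerD2l lerDl.
    by rewrite mulr_ge0 ?hn_ge0.
  rewrite ler_wpM2r ?(ltW kap0)// /weight -powR_mulrn ?(le_trans ler01)//.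
  by rewrite ler_powR.
- rewrite -size_filter (le_trans (CP M (cen z) _ M_ge1 _ _))// ?lerDl ?filter_uniq// => l.
  by rewrite mem_filter => /andP[/set_mem Elz _]; have [] := Ez l z Elz.
Qed.

End Sum.

Lemma norm_seq_bound (A : seq G) a : a \in A -> N a <= \sum_(b <- A) N b.
Proof.
move=> aA; rewrite (big_rem _ aA)/= lerDl; apply: sumr_ge0 => b _; exact: hn_ge0.
Qed.

Lemma amalgam_row_sum (F : G -> R) alpha (k : nat) (L : set G) :
  Wst N mu alpha F -> controlled_pointwise N mu F -> k%:R <= alpha ->
  relatively_separated N L -> exists2 K, 0 <= K & forall x (s : seq L), uniq s ->
    \sum_(l <- s) `|F (x^-1 * val l)%g| * (1 + N (x^-1 * val l)%g) ^+ k <= K.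
Proof.
move=> FW Fc ka sL; have [A AP] := control_right_cover hN hmu.
pose M := 1 + \sum_(a <- A) N a.
have S0 : 0 <= \sum_(a <- A) N a by apply: sumr_ge0 => a _; exact: hn_ge0.
have [|K K0 KP] := amalgam_sum_bound FW Fc ka sL (M := M); first by rewrite lerDl.
exists K => // x s us.
have ex (l : L) : exists a, a \in A /\ forall w, N w < 2^-1 ->
    (control N mu F (x^-1 * val l)%g <= control N mu F (x^-1 * val l * a * w)%g)%E.
  by have [a aA aw] := AP F (x^-1 * val l)%g; exists a.
have [a aP] := choice ex.
pose E l : set (borel G) := [set z : G | hball N 2^-1 1%g ((x^-1 * val l * a l)^-1 * z)%g].
have mB := measurable_hball hN 2^-1 1%g.
apply: (KP (fun l => x^-1 * val l)%g E (fun z => x * z)%g) => // [l|l|l z Ez].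
- exact: (measurable_mull (x^-1 * val l * a l)^-1%g mB).
- exact: (haar_translate hmu).
have [/norm_seq_bound aA aw] := aP l; move: Ez; rewrite /E /hball /= invg1 mul1g => Nw.
pose w := ((x^-1 * val l * a l)^-1 * z)%g.
have zE : z = (x^-1 * val l * a l * w)%g by rewrite /w mulVKg.
have {}Nw : N w < 2^-1 by [].
have NM : N (z^-1 * (x^-1 * val l))%g <= M.
  rewrite [X in N (X^-1 * _)%g]zE -(mulgA _ (a l)) invgM mulgVK (hn_inv hN).
  by rewrite (le_trans (hn_mul hN _ _))// /M; move: Nw aA; lra.
split; first by rewrite [in leRHS]zE; exact: aw.
  rewrite -[X in N X](mulVKg z) addrC (le_trans (hn_mul hN _ _))// lerD2l//.
by rewrite invgM -mulgA.
Qed.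

(** The sets [E l] are now right translates of a ball; that they have its measure is where
    unimodularity enters. *)
Lemma amalgam_col_sum (F : G -> R) alpha (k : nat) (L : set G) :
  Wst N mu alpha F -> controlled_pointwise N mu F -> k%:R <= alpha ->
  relatively_separated N L -> exists2 K, 0 <= K & forall x (s : seq L), uniq s ->
    \sum_(l <- s) `|F ((val l)^-1 * x)%g| * (1 + N ((val l)^-1 * x)%g) ^+ k <= K.
Proof.
move=> FW Fc ka sL; have [A AP] := control_left_cover hN hmu.
pose M := 1 + \sum_(a <- A) N a.
have S0 : 0 <= \sum_(a <- A) N a by apply: sumr_ge0 => a _; exact: hn_ge0.
have [|K K0 KP] := amalgam_sum_bound FW Fc ka sL (M := M); first by rewrite lerDl.
exists K => // x s us.
have ex (l : L) : exists a, a \in A /\ forall w, N w < 2^-1 ->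
    (control N mu F ((val l)^-1 * x)%g <= control N mu F (w * (a * ((val l)^-1 * x)))%g)%E.
  by have [a aA aw] := AP F ((val l)^-1 * x)%g; exists a.
have [a aP] := choice ex.
pose E l : set (borel G) :=
  [set z : G | hball N 2^-1 1%g (z * (a l * ((val l)^-1 * x))^-1)%g].
have mB := measurable_hball hN 2^-1 1%g.
apply: (KP (fun l => (val l)^-1 * x)%g E (fun z => x * z^-1)%g) => // [l|l|l z Ez].
- exact: (measurable_mulr (a l * ((val l)^-1 * x))^-1%g mB).
- apply: (haar_right_invariant hN hmu mB (r := 2^-1)).
    by move=> y; rewrite /hball /= invg1 mul1g => /ltW.
  by rewrite haar_hball_gt0// invr_gt0.
have [/norm_seq_bound aA aw] := aP l; move: Ez; rewrite /E /hball /= invg1 mul1g => Nw.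
pose w := (z * (a l * ((val l)^-1 * x))^-1)%g.
have zE : z = (w * (a l * ((val l)^-1 * x)))%g by rewrite /w mulgVK.
have {}Nw : N w < 2^-1 by [].
have NM : N (z * ((val l)^-1 * x)^-1)%g <= M.
  rewrite zE mulgA mulgK.
  by rewrite (le_trans (hn_mul hN _ _))// /M; move: Nw aA; lra.
split; first by rewrite [in leRHS]zE; exact: aw.
  rewrite -[X in N X](mulKg (z * ((val l)^-1 * x)^-1)%g) mulgVK.
  by rewrite (le_trans (hn_mul hN _ _))// (hn_inv hN) lerD2r.
by move: NM; rewrite !invgM !invgK mulgA.
Qed.

End Amalgam.

Lemma amalgam_matrix_bound (R : realType) (G : homogeneousGroup R) (N : G -> R)
    (mu : {sigma_finite_measure set (borel G) -> \bar R}) (F : G -> R) (alpha : R) (k : nat)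
    (L1 L2 : set G) (M : L1 -> L2 -> R[i]) :
  homogeneous_norm N -> haar_measure mu -> Wst N mu alpha F -> controlled_pointwise N mu F ->
  k%:R <= alpha -> relatively_separated N L1 -> relatively_separated N L2 ->
  (forall l1 l2, cabs (M l1 l2) <= F ((val l1)^-1 * val l2)%g) ->
  exists2 K, 0 <= K & forall K', K <= K' ->
    (forall l1, \esum_(l2 in [set: L2])
       (cabs (M l1 l2) * pweight (fun x y => N (x^-1 * y)%g) k (val l1) (val l2))%:E <= K'%:E)%E /\
    (forall l2, \esum_(l1 in [set: L1])
       (cabs (M l1 l2) * pweight (fun x y => N (x^-1 * y)%g) k (val l1) (val l2))%:E <= K'%:E)%E.
Proof.
move=> hN hmu FW Fc ka sL1 sL2 MF.
have [K1 K10 K1P] := amalgam_row_sum hN hmu FW Fc ka sL2.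
have [K2 K20 K2P] := amalgam_col_sum hN hmu FW Fc ka sL1.
have MF' l1 l2 : cabs (M l1 l2) * pweight (fun x y => N (x^-1 * y)%g) k (val l1) (val l2) <=
    `|F ((val l1)^-1 * val l2)%g| * (1 + N ((val l1)^-1 * val l2)%g) ^+ k.
  rewrite /pweight ler_wpM2r ?exprn_ge0 ?addr_ge0 ?hn_ge0//.
  exact: le_trans (MF l1 l2) (ler_norm _).
exists (K1 + K2) => [|K' KK']; first exact: addr_ge0.
split=> l; apply: esum_le_seq => s us; rewrite sumEFin lee_fin.
  apply: (@le_trans _ _ K1); last by rewrite (le_trans _ KK')// lerDl.
  by apply: le_trans (K1P _ _ us); apply: ler_sum.
apply: (@le_trans _ _ K2); last by rewrite (le_trans _ KK')// lerDr.
by apply: le_trans (K2P _ _ us); apply: ler_sum.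
Qed.

Lemma omega_esum_bound (R : realType) (G : homogeneousGroup R) (N : G -> R) (k : nat) (L : set G) :
  homogeneous_norm N -> relatively_separated N L -> hom_dim G < k%:R ->
  exists2 K, 0 <= K & forall K', K <= K' -> forall x,
    (\esum_(l in [set: L]) (omega (fun x y => N (x^-1 * y)%g) k 1 x (val l))%:E <= K'%:E)%E.
Proof.
move=> hN sL Qk; have [K K0 KP] := weight_sum_bound hN sL Qk.
exists K => // K' KK' x; apply: esum_le_seq => s us; rewrite sumEFin lee_fin.
rewrite (le_trans _ KK')//; apply: le_trans (KP x s us).
by apply: ler_sum => l _; rewrite /omega mul1r.
Qed.

Theorem theoremB5 (R : realType) (G : homogeneousGroup R)
    (N : G -> R) (hN : homogeneous_norm N)
    (mu : {sigma_finite_measure set (borel G) -> \bar R})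
    (hmu : haar_measure mu)
    (Lambda Gamma : set G)
    (hLambda : relatively_separated N Lambda) (hGamma : relatively_separated N Gamma)
    (P : (Gamma -> R[i]) -> (Gamma -> R[i])) (A : (Gamma -> R[i]) -> (Lambda -> R[i]))
    (hP : bounded_operator P) (hA : bounded_operator A)
    (hPP : forall c : Gamma -> R[i], ell 2%:E c -> P (P c) = P c)
    (alpha : R) (halpha : hom_dim G + 1 <= alpha)
    (Theta1 Theta2 : G -> R)
    (hTheta1 : Wst N mu alpha Theta1) (hTheta2 : Wst N mu alpha Theta2)
    (hTheta1c : controlled_pointwise N mu Theta1)
    (hTheta2c : controlled_pointwise N mu Theta2)
    (hATheta : forall (l : Lambda) (g : Gamma),
       cabs (entry A l g) <= Theta1 ((val l)^-1 * val g)%g)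
    (hPTheta : forall g g' : Gamma,
       cabs (entry P g g') <= Theta2 ((val g)^-1 * val g')%g)
    (p : \bar R) (hp : (1 <= p)%E) (C : R) (hC : 0 < C)
    (hstable : forall c : Gamma -> R[i], ell p c ->
       (C%:E * ell_norm p (matrix_act (entry P) c)
        <= ell_norm p (matrix_act (entry A) (matrix_act (entry P) c)))%E) :
  exists C' : R, 0 < C' /\
    forall q : \bar R, (1 <= q)%E -> forall c : Gamma -> R[i], ell q c ->
      (C'%:E * ell_norm q (matrix_act (entry P) c)
       <= ell_norm q (matrix_act (entry A) (matrix_act (entry P) c)))%E.

Proof.
have [gc _] := exists_graded_chart G.
have Q0 : 0 <= hom_dim G.
  by rewrite -(gc_weight_sum gc); apply: sumr_ge0 => i _; exact/ltW/weight_gt0.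
(* [Q < k] makes the weights summable over relatively separated sets; [k <= Q + 1 <= alpha] lets the
   amalgam weight dominate [(1 + d) ^ k]. *)
pose k := (Num.truncn (hom_dim G)).+1.
have Qk : hom_dim G < k%:R by exact: truncnS_gt.
have ka : k%:R <= alpha by rewrite (le_trans _ halpha)// -natr1 lerD2r truncn_le.
pose d (x y : G) := N (x^-1 * y)%g.
have d_ge0 x y : 0 <= d x y by exact: (hn_ge0 hN).
have dxx x : d x x = 0 by rewrite /d mulVg (N1 hN).
have d_sym x y : d x y = d y x by rewrite /d -(hn_inv hN) invgM invgK.
have d_tri x y z : d x z <= d x y + d y z.
  have -> : d x z = N ((x^-1 * y) * (y^-1 * z))%g by rewrite /d mulgA mulgK.
  exact: hn_mul.
have [K1 K10 oG] := omega_esum_bound hN hGamma Qk.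
have [K2 K20 oL] := omega_esum_bound hN hLambda Qk.
have [K3 K30 PK] := amalgam_matrix_bound hN hmu hTheta2 hTheta2c ka hGamma hGamma hPTheta.
have [K4 K40 AK] := amalgam_matrix_bound hN hmu hTheta1 hTheta1c ka hLambda hGamma hATheta.
have K0_gt0 : 0 < K1 + K2 + 1 by rewrite ltr_wpDl ?addr_ge0.
have K_gt0 : 0 < K3 + K4 + 1 by rewrite ltr_wpDl ?addr_ge0.
have le1 : K1 <= K1 + K2 + 1 by rewrite -addrA lerDl addr_ge0.
have le2 : K2 <= K1 + K2 + 1 by rewrite addrAC lerDr addr_ge0.
have le3 : K3 <= K3 + K4 + 1 by rewrite -addrA lerDl addr_ge0.
have le4 : K4 <= K3 + K4 + 1 by rewrite addrAC lerDr addr_ge0.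
have [rowP colP] := PK _ le3; have [rowA colA] := AK _ le4.
apply: (stability_all_exponents d_ge0 dxx d_sym d_tri K0_gt0 K_gt0
  (oG _ le1) (oL _ le2) rowP colP rowA colA _ hp hC hstable).
(* The products of entries are summable because the columns of [P] are bounded and its rows are
   summable. *)
apply: (entry_idem hP hPP) => i l.
apply: (matrix_act_csummable d_ge0 rowP (B := K3 + K4 + 1)) => [|g]; first exact: ltW.
rewrite -lee_fin; apply: le_trans (colP l).
have w1 x y : 1 <= pweight d k x y by rewrite exprn_ege1// lerDl.
apply: le_trans (esum_ge_term
  (fun g => (cabs (entry P g l) * pweight d k (val g) (val l))%:E) g).
by rewrite lee_fin ler_peMr ?cabs_ge0.
Qed.
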